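(* Let $m\in\mathbb{N}$ and, for $j=1,2$, let $Q_j=Q_j^*$ be self-adjoint $m\times m$ matrix-valued potentials with $Q_j\in L^1([0,R])^{m\times m}$ for all $R>0$. Let $H_j=-\frac{d^2}{dx^2}I_m+Q_j$ be a corresponding self-adjoint Schrödinger operator in $L^2([0,\infty))^m$ with a Dirichlet boundary condition at $x=0_+$ (and a self-adjoint boundary condition at $\infty$, if any is needed), and let $M_j(z)$, $z\in\mathbb{C}\setminus\mathbb{R}$, be the $m\times m$ matrix-valued Weyl-Titchmarsh function associated with $H_j$. Let $a>0$, $0<\varepsilon<\pi/2$, and suppose that $$\|M_1(z)-M_2(z)\|_{\mathbb{C}^{m\times m}} = O\big(e^{-2\,\mathrm{Im}(z^{1/2})\,a}\big)\quad\text{as } |z|\to\infty$$ along the ray $\arg(z)=\pi-\varepsilon$. Then $$Q_1(x)=Q_2(x)\quad\text{for a.e. } x\in[0,a].$$ In particular, if $\|M_1(z)-M_2(z)\|_{\mathbb{C}^{m\times m}} = O\big(e^{-2\,\mathrm{Im}(z^{1/2})\,a}\big)$ as $|z|\to\infty$ along the ray $\arg(z)=\pi-\varepsilon$ holds for all $a>0$, then $Q_1=Q_2$ a.e. on $[0,\infty)$.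
   Context: The branch of the square root is fixed by $\mathrm{Im}(z^{1/2})\ge 0$; $I_m$ is the identity matrix in $\mathbb{C}^m$; $\mathrm{AC}$ denotes absolutely continuous functions; primes denote $x$-derivatives. For $Q=Q^*\in L^1([0,R])^{m\times m}$ for all $R>0$, the operator $H$ in $L^2([0,\infty))^m$ is $Hg=-g''+Qg$ with domain $$\mathrm{dom}(H)=\{g\in L^2([0,\infty))^m : g,g'\in \mathrm{AC}([0,R])^m\ \forall R>0;\ g(0_+)=0;\ \text{s.-a. b.c. at }\infty;\ -g''+Qg\in L^2([0,\infty))^m\},$$ where ''s.-a. b.c. at $\infty$'' denotes a fixed boundary condition at $\infty$ (depending only on the behavior of $g$ near $\infty$) making $H$ self-adjoint; no condition is present if $Q$ is in the limit point case at $\infty$. For $z\in\mathbb{C}\setminus\mathbb{R}$, the Weyl solution $\Psi(z,\cdot)$ is the $m\times m$ matrix-valued solution, unique up to right multiplication by nonsingular constant $m\times m$ matrices, of $-\Psi''(z,x)+[Q(x)-zI_m]\Psi(z,x)=0$ with linearly independent columns, such that $\Psi(z,\cdot)\in L^2([0,\infty))^{m\times m}$ and $\Psi(z,\cdot)$ satisfies the s.-a. b.c. of $H$ at $\infty$ (if any), i.e. each column agrees near $\infty$ with an element of $\mathrm{dom}(H)$. The Weyl-Titchmarsh matrix of $H$ is $M(z)=\Psi'(z,0_+)\Psi(z,0_+)^{-1}$. *)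

(* Defs.v *)
From HB Require Import structures.
From mathcomp Require Import all_boot all_order all_algebra.
From mathcomp Require Import complex.
From mathcomp Require Import all_classical all_reals all_analysis.
Set Implicit Arguments.
Unset Strict Implicit.
Unset Printing Implicit Defensive.
Import Order.TTheory GRing.Theory Num.Theory.
Import numFieldNormedType.Exports.
Local Open Scope classical_set_scope.
Local Open Scope complex_scope.
Local Open Scope ring_scope.

(* Functions on the half-line [0, +oo[ are represented by functions on the
   whole of R, whose values at negative arguments play no role. *)

Section real_functions.
Variable R : realType.
Implicit Types f : R -> R.

Definition AC_on (a b : R) f : Prop :=
  forall e : R, 0 < e -> exists2 d : R, 0 < d &
    forall (n : nat) (s t : 'I_n -> R),
      (forall i, [/\ a <= s i, s i <= t i & t i <= b]) ->
      (forall i j, i != j -> t i <= s j \/ t j <= s i) ->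
      \sum_i (t i - s i) < d ->
      \sum_i `|f (t i) - f (s i)| < e.

Definition AC_halfline f : Prop := forall X : R, 0 < X -> AC_on 0 X f.

Definition L1loc_halfline f : Prop :=
  forall X : R, 0 < X ->
    (@lebesgue_measure R).-integrable `[0, X] (fun x => (f x)%:E).

Definition L2_halfline f : Prop :=
  measurable_fun (`[0, +oo[ : set R) f /\
  (@lebesgue_measure R).-integrable `[0, +oo[ (fun x => (f x ^+ 2)%:E).

(* The derivative on ]0, +oo[, extended to x = 0 by the limit f'(0+). *)
Definition deriv_halfline f (x : R) : R :=
  if 0 < x then derive1 f x else lim (derive1 f t @[t --> 0^'+]).

End real_functions.

Section matrix_functions.
Variables (R : realType) (p q : nat).
Implicit Types F : R -> 'M[R[i]]_(p, q).

(* For the properties used here (absolute continuity, integrability,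
   differentiability), a complex matrix-valued function has the property iff
   the real and imaginary parts of all its entries do. *)
Definition entrywise (P : (R -> R) -> Prop) F : Prop :=
  forall i j, P (fun x => complex.Re (F x i j)) /\
              P (fun x => complex.Im (F x i j)).

Definition deriv F (x : R) : 'M[R[i]]_(p, q) :=
  \matrix_(i, j) (deriv_halfline (fun t => complex.Re (F t i j)) x +i*
                  deriv_halfline (fun t => complex.Im (F t i j)) x).

Definition ae_halfline (P : R -> Prop) : Prop :=
  {ae @lebesgue_measure R, forall x, 0 <= x -> P x}.

(* F and F' are absolutely continuous on every [0, X]; then F'' exists a.e. *)
Definition F_F'_AC F : Prop :=
  [/\ entrywise (@AC_halfline R) F,
      entrywise (fun f => forall x, 0 < x -> derivable f x 1) F &
      entrywise (@AC_halfline R) (deriv F)].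

Definition schrodinger_expr (Q : R -> 'M[R[i]]_p) F (x : R) :
    'M[R[i]]_(p, q) :=
  - deriv (deriv F) x + Q x *m F x.

End matrix_functions.

Section operators.
Variables (R : realType) (m : nat).
Local Notation vfun := (R -> 'cV[R[i]]_m).
Local Notation mu := (@lebesgue_measure R).

Definition L2 : vfun -> Prop := entrywise (@L2_halfline R).

Definition inner (u v : vfun) : R[i] :=
  let w x := \sum_(k < m) (u x k 0)^* * v x k 0 in
  (\int[mu]_(x in `[0%R, +oo[) complex.Re (w x)) +i*
  (\int[mu]_(x in `[0%R, +oo[) complex.Im (w x)).

(* Elements of L^2 are functions up to a.e. equality, so (u, w) belongs to the
   graph of the operator T with domain D as soon as it is a.e. equal to some
   (g, T g) with D g. *)
Definition in_graph (D : vfun -> Prop) (T : vfun -> vfun) (u w : vfun) : Prop :=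
  exists g, [/\ D g, ae_halfline (fun x => u x = g x)
                & ae_halfline (fun x => w x = T g x)].

Definition in_adjoint_graph (D : vfun -> Prop) (T : vfun -> vfun)
    (u w : vfun) : Prop :=
  forall g, D g -> inner (T g) u = inner g w.

Definition densely_defined (D : vfun -> Prop) : Prop :=
  forall h, L2 h -> forall e : R, 0 < e ->
    exists2 g, D g & complex.Re (inner (h \- g) (h \- g)) < e.

Definition self_adjoint (D : vfun -> Prop) (T : vfun -> vfun) : Prop :=
  densely_defined D /\
  forall u w, L2 u -> L2 w -> in_graph D T u w <-> in_adjoint_graph D T u w.

Definition potential (Q : R -> 'M[R[i]]_m) : Prop :=
  entrywise (@L1loc_halfline R) Q /\
  ae_halfline (fun x => Q x = map_mx (@conjc R) (Q x)^T).

(* g is absolutely continuous on [0, X], so that g(0+) is g 0. *)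
Definition domH (Q : R -> 'M[R[i]]_m) (B : vfun -> Prop) (g : vfun) : Prop :=
  [/\ L2 g, F_F'_AC g, g 0 = 0, B g & L2 (schrodinger_expr Q g)].

Definition depends_only_near_infinity (B : vfun -> Prop) : Prop :=
  forall g h : vfun, (\forall x \near +oo, g x = h x) -> B g -> B h.

(* In the limit point case, self-adjointness forces B to hold on the whole
   domain obtained without B, i.e. there is no condition at infinity. *)
Definition sa_bc_at_infinity (Q : R -> 'M[R[i]]_m) (B : vfun -> Prop) : Prop :=
  depends_only_near_infinity B /\ self_adjoint (domH Q B) (schrodinger_expr Q).

Definition weyl_solution (Q : R -> 'M[R[i]]_m) (B : vfun -> Prop) (z : R[i])
    (Psi : R -> 'M[R[i]]_m) : Prop :=
  [/\ F_F'_AC Psi,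
      ae_halfline (fun x =>
        - deriv (deriv Psi) x + (Q x - z%:M) *m Psi x = 0),
      (forall c : 'cV[R[i]]_m, (forall x, 0 <= x -> Psi x *m c = 0) -> c = 0),
      entrywise (@L2_halfline R) Psi &
      forall j, exists2 g, domH Q B g & \forall x \near +oo, col j (Psi x) = g x].

(* The quotient does not depend on the choice of the Weyl solution Psi, and
   Psi 0 is always invertible: otherwise z would be a nonreal eigenvalue of a
   self-adjoint operator. *)
Definition weyl_titchmarsh (Q : R -> 'M[R[i]]_m) (B : vfun -> Prop)
    (M : R[i] -> 'M[R[i]]_m) : Prop :=
  forall z, complex.Im z != 0 ->
    exists2 Psi, weyl_solution Q B z Psi
               & M z = deriv Psi 0 *m invmx (Psi 0).

Definition on_ray (theta r : R) : R[i] := (r * cos theta) +i* (r * sin theta).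

(* O(exp(-2 Im(z^(1/2)) a)) as |z| -> +oo along the ray arg(z) = theta;
   sqrtC is the branch of the square root with nonnegative imaginary part;
   the norm on matrices is the library's maximum norm (all norms on a
   finite-dimensional space being equivalent). *)
Definition ray_asymp (M1 M2 : R[i] -> 'M[R[i]]_m) (theta a : R) : Prop :=
  exists K : R, \forall r \near +oo,
    `|M1 (on_ray theta r) - M2 (on_ray theta r)| <=
      (K * expR (- (2 * complex.Im (sqrtC (on_ray theta r)) * a)))%:C.

End operators.

(* Main.v *)
(* Write F^+(z) = F(z^* )^* and let theta_j, phi_j be the solutions for Q_j with Cauchy data (1, 0),
   (0, 1) at 0. For fixed x in [0, a] the entire function W = theta_1 phi_2^+ - phi_1 theta_2^+
   equals psi_1 phi_2^+ - phi_1 psi_2^+ - phi_1 (M_1 - M_2) phi_2^+, where psi_j = theta_j + phi_j M_j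
   is the normalised Weyl solution. With k = z^(1/2), phi_j is O(exp(x Im k) / |k|), and psi_j is
   O(exp(- x Im k)) on nonreal rays: the flux Im (u^* u') of a Weyl solution u is monotone and vanishes at
   infinity, which is incompatible with the growth that a large u' - i k u would force.
   Hence k W(k^2) is bounded on the given ray, on the conjugate one (as M_j^+ = M_j) and for real k,
   and Phragmen-Lindelof in the sectors in between bounds it everywhere; so W = O(1 / k) is 0.
   The vanishing of W on [0, a] for the single value z = 0 already forces Q_1 = Q_2 there.
   Holomorphy enters only through second-order expansions, which suffice for the maximum principle. *)
From HB Require Import structures.
Require Import Defs.
From mathcomp Require Import all_boot all_order all_algebra.
From mathcomp Require Import complex.
From mathcomp Require Import all_classical all_reals all_analysis.
From mathcomp Require Import ring lra.
From mathcomp Require Import measurable_realfun.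
Set Implicit Arguments.
Unset Strict Implicit.
Unset Printing Implicit Defensive.
Import Order.TTheory GRing.Theory Num.Theory.
Import numFieldNormedType.Exports.
Local Open Scope classical_set_scope.
Local Open Scope ring_scope.

(** * Bounded variation of absolutely continuous functions *)

Section absolute_continuity.
Variable R : realType.
Implicit Types (a b : R) (f : R -> R).
Local Notation TV := total_variation.

(** Since the potentials are merely integrable and absolute continuity is given in epsilon-delta
    form, every differential inequality rests on one fact: an absolutely continuous function with
    a.e. nonnegative derivative is nondecreasing. It follows from the existence of a density (Jordan
    decomposition, Radon-Nikodym) and is carried by the relations [rprim], [cprim], [prim]. The
    range of eps is the geometry of the sectors. On the ray, k has argument b = (pi - eps) / 2; the
    arguments 0, b, pi - b, pi cut the upper half-plane into sectors of openings b, eps, b, all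
    below pi / 2. This is what the damping factor exp (- e k^2), taken about the bisector,
    tolerates, and it beats the exponential type of k W(k^2). Evenness in k supplies the lower
    half-plane. Why one value of z is enough at the end: up to sign W is a block of T = Y_1 Y_2^-1,
    with Y_j the fundamental matrices, and T' = A_1 T - T A_2 with T(0) = 1. Feeding the vanishing
    of that block into this system kills or fixes the other blocks one after the other, until T = 1
    and the equation itself reads Q_1 = Q_2. *)

Lemma AC_on_fin a b f : AC_on a b f -> forall e : R, 0 < e ->
  exists2 d : R, 0 < d & forall (I : finType) (s t : I -> R),
      (forall i, [/\ a <= s i, s i <= t i & t i <= b]) ->
      (forall i j, i != j -> t i <= s j \/ t j <= s i) ->
      \sum_i (t i - s i) < d ->
      \sum_i `|f (t i) - f (s i)| < e.
Proof.
move=> ac e /ac[d d0 H]; exists d => // I s t st dis.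
have E (F : I -> R) : \sum_i F i = \sum_(i < #|I|) F (enum_val i).
  by rewrite (reindex (@enum_val I predT)) //; apply/onW_bij/enum_val_bij.
rewrite !E => sd; apply: (H _ (fun i => s (enum_val i)) (fun i => t (enum_val i))) => //.
move=> i j ij; apply: dis; apply: contra ij => /eqP/enum_val_inj ->; exact: eqxx.
Qed.

Lemma itv_partition_nth_le_mono a b (p : seq R) i j : itv_partition a b p ->
  (i <= j <= size p)%N -> nth b (a :: p) i <= nth b (a :: p) j.
Proof.
move=> [pp _] /andP[ij jp].
have srt : sorted <=%R (a :: p) by apply: sub_path pp => x y /ltW.
by apply: (sorted_leq_nth le_trans le_refl b srt) => //; rewrite inE /= ltnS ?(leq_trans ij).
Qed.

Lemma variation_sum a b f p :
  variation a b f p = \sum_(k < size p) `|f (nth b (a :: p) k.+1) - f (nth b (a :: p) k)|.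
Proof. by rewrite /variation big_mkord. Qed.

(* The subintervals of partitions of disjoint intervals are again disjoint. *)
Lemma AC_on_variation a b f e : AC_on a b f -> 0 < e ->
  exists2 d : R, 0 < d & forall n (s t : 'I_n -> R) (p : 'I_n -> seq R),
      (forall i, [/\ a <= s i, s i <= t i & t i <= b]) ->
      (forall i j, i != j -> t i <= s j \/ t j <= s i) ->
      (forall i, itv_partition (s i) (t i) (p i)) ->
      \sum_i (t i - s i) < d ->
      \sum_i variation (s i) (t i) f (p i) < e.
Proof.
move=> /AC_on_fin ac /ac[d d0 H]; exists d => // n s t p st dis pp sd.
have sigE (F : forall i, 'I_(size (p i)) -> R) : \sum_i \sum_k F i k =
    \sum_(u : {i : 'I_n & 'I_(size (p i))}) F (tag u) (tagged u).
  exact: (@sig_big_dep _ _ _ _ (fun i => 'I_(size (p i))) predT (fun _ => predT) F).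
have [nu nuE] : exists nu : 'I_n -> nat -> R, forall i k, nu i k = nth (t i) (s i :: p i) k.
  by eexists; move=> i k; reflexivity.
have nu0 i : nu i 0%N = s i by rewrite nuE.
have nus i : nu i (size (p i)) = t i by rewrite nuE (itv_partition_nth_size _ (pp i)).
have num i k l : (k <= l <= size (p i))%N -> nu i k <= nu i l.
  by move=> h; rewrite !nuE; exact: itv_partition_nth_le_mono (pp i) h.
have -> : \sum_i variation (s i) (t i) f (p i) =
    \sum_i \sum_(k < size (p i)) `|f (nu i k.+1) - f (nu i k)|.
  by apply: eq_bigr => i _; rewrite variation_sum; apply: eq_bigr => k _; rewrite !nuE.
rewrite sigE.
have ge_s i k : (k <= size (p i))%N -> s i <= nu i k by move=> h; rewrite -nu0 num.
have le_t i k : (k <= size (p i))%N -> nu i k <= t i by move=> h; rewrite -nus num ?h /=.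
apply: (H {i : 'I_n & 'I_(size (p i))} (fun u => nu (tag u) (tagged u))
  (fun u => nu (tag u) (tagged u).+1)).
- move=> [i k] /=; have [h1 h2 h3] := st i; split.
  + by rewrite (le_trans h1) ?ge_s// ltnW.
  + by apply: num; rewrite leqnSn /=.
  + by rewrite (le_trans _ h3) ?le_t.
- move=> [i k] [j l] /= ne; have [ij|ij] := eqVneq i j; last first.
    have [h|h] := dis _ _ ij; [left|right].
      by rewrite (le_trans (le_t _ _ _))// (le_trans h)// ge_s// ltnW.
    by rewrite (le_trans (le_t _ _ _))// (le_trans h)// ge_s// ltnW.
  subst j; have [kl|lk|kl] := ltngtP k l.
  + by left; apply: num; rewrite kl /= ltnW.
  + by right; apply: num; rewrite lk /= ltnW.
  + by move: ne; rewrite (val_inj kl) eqxx.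
- rewrite -(sigE (fun i k => nu i k.+1 - nu i k)).
  rewrite (eq_bigr (fun i => t i - s i)) // => i _.
  by rewrite -(big_mkord xpredT (fun k => nu i k.+1 - nu i k)) telescope_sumr // nu0 nus.
Qed.

Lemma AC_on_short_BV a b f : AC_on a b f -> exists2 d : R, 0 < d &
  forall x y, a <= x -> x <= y -> y <= b -> y - x < d -> TV x y f \is a fin_num.
Proof.
move=> /AC_on_variation/(_ ltr01)[d d0 H]; exists d => // x y ax xy yb xyd.
apply/bounded_variationP => //; exists 1 => _ [p pp <-]; apply: ltW.
have := H 1 (fun=> x) (fun=> y) (fun=> p); rewrite !big_ord1; apply => //.
by move=> i j; rewrite !ord1.
Qed.

Lemma AC_on_BV a b f : a <= b -> AC_on a b f ->
  forall x y, a <= x -> x <= y -> y <= b -> TV x y f \is a fin_num.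
Proof.
move=> ab /AC_on_short_BV[d d0 H] x y ax xy yb.
(* Induction on the number of steps d / 2 that cover [x, y]: the last step is shorter than d, and
   variation is additive. *)
suff : forall n : nat, forall x y, a <= x -> x <= y -> y <= b -> y - x < n%:R * (d / 2) ->
    TV x y f \is a fin_num.
  move/(_ (Num.truncn ((y - x) / (d / 2))).+1); apply => //.
  by rewrite -ltr_pdivrMr ?divr_gt0// -truncn_le_nat// ltnS.
elim => {x y ax xy yb} [x y _ xy _|n IH x y ax xy yb xyd].
  by rewrite mul0r subr_lt0 ltNge xy.
have [h|h] := ltP (y - x) d; first exact: H.
have xz : x <= y - d / 2 by lra.
have zy : y - d / 2 <= y by lra.
rewrite (total_variationD f xz zy) fin_numD; apply/andP; split.
  apply: IH => //; first by rewrite (le_trans zy).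
  by move: xyd; rewrite -natr1 mulrDl mul1r; lra.
by apply: H => //; lra.
Qed.

Lemma AC_on_TV a b f : a <= b -> AC_on a b f ->
  AC_on a b (fun x => fine (TV a x f)).
Proof.
move=> ab ac e e0; have e20 : 0 < e / 2 by lra.
have [d d0 H] := AC_on_variation ac e20.
exists d => // n s t st dis sd.
have fin i : TV (s i) (t i) f \is a fin_num.
  by have [? ? ?] := st i; exact: AC_on_BV ac _ _ _ _ _.
have E i : fine (TV a (t i) f) - fine (TV a (s i) f) = fine (TV (s i) (t i) f).
  have [h1 h2 h3] := st i.
  rewrite (total_variationD f h1 h2) fineD //; last first.
    by apply: (AC_on_BV ab ac) => //; rewrite (le_trans h2).
  by rewrite addrC addKr.
under eq_bigr do rewrite E.
have n1 : 0 < n.+1%:R :> R by [].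
(* One partition per interval reaches the variation up to e / 2 / n.+1, so the n errors add up to at
   most e / 2. *)
have /choice[p hp] : forall i, exists p, itv_partition (s i) (t i) p /\
    fine (TV (s i) (t i) f) <= variation (s i) (t i) f p + e / 2 / n.+1%:R.
  move=> i; have en : 0 < e / 2 / n.+1%:R by rewrite divr_gt0.
  have [_ [_ [p pp <-] <-] ] := ub_ereal_sup_adherent en (fin i).
  rewrite -/(TV (s i) (t i) f) -{1}(fineK (fin i)) -EFinB lte_fin => h.
  by exists p; split => //; rewrite -lerBlDr ltW.
have pp i := (hp i).1; have {}hp i := (hp i).2.
have := H n s t p st dis pp sd => {}H.
apply: (@le_lt_trans _ _ (\sum_(i < n) (variation (s i) (t i) f (p i) + e / 2 / n.+1%:R))).
  apply: ler_sum => i _; rewrite ger0_norm //.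
  by apply: fine_ge0; apply: total_variation_ge0; have [] := st i.
rewrite big_split /= sumr_const card_ord -[X in _ + X]mulr_natr.
have : e / 2 / n.+1%:R * n%:R <= e / 2.
  by rewrite mulrAC ler_pdivrMr// (ler_wpM2l (ltW e20))// ler_nat.
by move=> h; rewrite [ltRHS](splitr e); exact: ltr_leD H h.
Qed.

Lemma AC_onB a b f g : AC_on a b f -> AC_on a b g -> AC_on a b (fun x => f x - g x).
Proof.
move=> acf acg e e0; have e20 : 0 < e / 2 by lra.
have [d1 d10 H1] := acf _ e20; have [d2 d20 H2] := acg _ e20.
exists (Num.min d1 d2); first by rewrite lt_min d10.
move=> n s t st dis; rewrite lt_min => /andP[sd1 sd2].
have {}H1 := H1 n s t st dis sd1; have {}H2 := H2 n s t st dis sd2.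
apply: (@le_lt_trans _ _ (\sum_i (`|f (t i) - f (s i)| + `|g (t i) - g (s i)|))).
  apply: ler_sum => i _; rewrite (_ : _ - _ = (f (t i) - f (s i)) - (g (t i) - g (s i)));
    last by ring.
  exact: ler_normB.
by rewrite big_split /=; lra.
Qed.

End absolute_continuity.

(** * Domination of Stieltjes measures by Lebesgue measure *)

Section lebesgue_stieltjes_density.
Variable R : realType.
Local Notation mu := (@lebesgue_measure R).
Import SetRing.

(** No bounding interval here: a [cumulative] function lives on the whole line. It will be applied
    to a function frozen outside [0, X]. *)
Definition globally_AC (h : R -> R) := forall e : R, 0 < e ->
  exists2 d : R, 0 < d & forall (n : nat) (s t : 'I_n -> R),
      (forall i, s i <= t i) ->
      (forall i j, i != j -> t i <= s j \/ t j <= s i) ->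
      \sum_i (t i - s i) < d -> \sum_i `|h (t i) - h (s i)| < e.

Variable h : cumulative R R.
Local Notation nu := (lebesgue_stieltjes_measure h).

Lemma lebesgue_stieltjes_itvoc (g : cumulative R R) a b : a <= b ->
  lebesgue_stieltjes_measure g `]a, b] = (g b - g a)%:E.
Proof.
move=> ab; rewrite /lebesgue_stieltjes_measure /measure_extension measurable_mu_extE/=; last first.
  by exists (a, b).
by rewrite wlength_itv_bnd.
Qed.

Lemma lebesgue_itvoc (a b : R) : a <= b -> mu `]a, b] = (b - a)%:E.
Proof.
rewrite le_eqVlt => /predU1P[<-|ab].
  by rewrite set_itvoc0 measure0 subrr.
by rewrite lebesgue_measure_itv/= lte_fin ab.
Qed.

(** A set of the ring is a finite disjoint union of half-open intervals, for which both measures are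
    the sums in the definition of absolute continuity. *)
Lemma ring_lebesgue_stieltjes_le (e : R) : globally_AC h -> 0 < e ->
  exists2 d : R, 0 < d & forall A : set (type (ocitv_type R)), measurable A ->
    (mu A < d%:E -> nu A < e%:E)%E.
Proof.
move=> ac /ac[d d0 H]; exists d => // A /ring_finite_set[B [Bfin Bn0 Btriv Bm ->]].
have Bo X : B X -> exists2 ab : R * R, ab.1 < ab.2 & X = `]ab.1, ab.2]%classic.
  move=> BX; have /ocitvP[X0|//] : ocitv X by apply: Bm; rewrite inE.
  by have [x] := Bn0 _ BX; rewrite X0.
have mB X : B X -> measurable (X : set R).
  by move=> /Bo[ab _ ->]; exact: measurable_itv.
rewrite [in X in (X < _)%E](@measure_fin_bigcup _ _ _ mu) //.
rewrite (@measure_fin_bigcup _ _ _ nu) //.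
pose l := finmap.enum_fset (fset_set B).
have lB i : (i < size l)%N -> B (nth set0 l i).
  move=> il; apply/set_mem; rewrite -(in_fset_set Bfin); exact: mem_nth.
have /choice[ab hab] : forall i : 'I_(size l), exists ab : R * R,
    ab.1 < ab.2 /\ nth set0 l i = `]ab.1, ab.2]%classic.
  by move=> i; have [ab ? ?] := Bo _ (lB _ (ltn_ord i)); exists ab.
rewrite !fsbig_finite //= !(big_nth set0) !big_mkord -/l.
under eq_bigr => i _ do rewrite (hab i).2 (lebesgue_itvoc (ltW (hab i).1)).
under [in X in _ -> X]eq_bigr => i _ do
  rewrite (hab i).2 (lebesgue_stieltjes_itvoc h (ltW (hab i).1)).
rewrite !sumEFin !lte_fin => /H; rewrite (eq_bigr (fun i => h (ab i).2 - h (ab i).1)).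
  apply=> [i|i j ij]; first exact/ltW/(hab i).1.
  have [lt1 E1] := hab i; have [lt2 E2] := hab j.
  have dis : nth set0 l i `&` nth set0 l j = set0.
    apply: contrapT => /eqP/set0P/Btriv => /(_ (lB _ (ltn_ord i)) (lB _ (ltn_ord j)))/eqP.
    rewrite nth_uniq ?finmap.fset_uniq// => /eqP/val_inj E.
    by move: ij; rewrite E eqxx.
  have [|h1] := leP (ab i).2 (ab j).1; first by left.
  have [|h2] := leP (ab j).2 (ab i).1; first by right.
  (* Disjoint half-open intervals are ordered: otherwise the smaller right end belongs to both. *)
  exfalso; have : (nth set0 l i `&` nth set0 l j) (Num.min (ab i).2 (ab j).2).
    rewrite E1 E2; split; rewrite /= in_itv /= lt_min ge_min lexx ?orbT ?andbT.
      by rewrite lt1 h2.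
    by rewrite lt2 h1.
  by rewrite dis.
by move=> i _; rewrite ger0_norm// subr_ge0; apply: cumulative_is_nondecreasing; exact/ltW/(hab i).1.
Qed.

(** A null set has a countable cover by half-open intervals of total length below d. The finite
    partial unions lie in the ring, hence have measure below e, and continuity from below passes
    this on to the whole cover. *)
Lemma lebesgue_stieltjes_dominates : globally_AC h -> nu `<< mu.
Proof.
move=> ac; apply/null_content_dominatesP => A mA A0.
apply/eqP; rewrite eq_le measure_ge0 andbT; apply/lee_addgt0Pr => e e0; rewrite add0e.
have [d d0 H] := ring_lebesgue_stieltjes_le ac e0.
have : (mu A < d%:E)%E by rewrite A0 lte_fin.
move=> /ereal_inf_lt[z [/= M covM sMz zd]].
have mM i : measurable (M i : set R) by case: covM => /(_ i)[[a b] _ <-] _; exact: measurable_itv.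
have AM : A `<=` \bigcup_k M k by case: covM.
apply: (@le_trans _ _ (nu (\bigcup_n \big[setU/set0]_(i < n.+1) M i))).
  rewrite bigcup_bigsetU_bigcup.
  by apply: le_measure => //; rewrite inE //; exact: bigcupT_measurable.
have mU n : measurable (\big[setU/set0]_(i < n.+1) (M i : set R)).
  by apply: bigsetU_measurable => i _; exact: mM.
have := @nondecreasing_cvg_mu _ _ _ nu (fun n => \big[setU/set0]_(i < n.+1) M i) mU
  (bigcupT_measurable _ mU).
have nd : nondecreasing_seq (fun n => \big[setU/set0]_(i < n.+1) M i).
  by move=> n m nm; apply/subsetPset; exact: subset_bigsetU.
move=> /(_ nd) /cvg_lim <- //; apply: lime_le.
  apply: ereal_nondecreasing_is_cvgn => n m nm; apply: le_measure; [rewrite inE; exact: mU|rewrite inE; exact: mU|].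
  exact: subset_bigsetU.
apply: nearW => n /=; apply: ltW; apply: H.
  apply: bigsetU_measurable => i _; apply: measurable_subring.
  by case: covM => /(_ i).
apply: (@le_lt_trans _ _ (\sum_(i < n.+1) mu (M i))%E).
  by apply: (@Boole_inequality _ _ _ mu (fun i => M i : set R)) => i _; exact: mM.
apply: le_lt_trans zd; rewrite -sMz.
apply: (@le_trans _ _ (\sum_(i < n.+1) wlength idfun (M i))%E).
  apply: lee_sum => i _; have [[a b] _ <-] := covM.1 i.
  by rewrite lebesgue_measure_itv wlength_itv.
rewrite -(big_mkord xpredT (fun i => wlength idfun (M i))).
by apply: nneseries_lim_ge => k _; have := measure_ge0 (wlength (@idfun R)) (M k).
Qed.

End lebesgue_stieltjes_density.

(** * Densities of absolutely continuous functions *)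

Section AC_density.
Variable R : realType.
Implicit Types (f h g : R -> R).
Local Notation mu := (@lebesgue_measure R).

Lemma AC_nondecreasing_density (X : R) h : 0 < X -> AC_on 0 X h ->
  {in `[0, X] &, {homo h : x y / x <= y}} ->
  exists2 g : R -> R, mu.-integrable setT (EFin \o g) &
    forall x, 0 <= x <= X -> h x = h 0 + \int[mu]_(t in `[0, x]) g t.
Proof.
move=> X0 ac nd.
(* Clamping to [0, X] is nondecreasing and 1-Lipschitz, so [h \o c] is monotone, globally absolutely
   continuous and right-continuous: a Stieltjes function. *)
pose c (x : R) := Num.max 0 (Num.min x X).
have cX x : 0 <= x <= X -> c x = x.
  by move=> /andP[x0 xX]; rewrite /c (min_idPl xX) (max_idPr x0).
have c01 x : 0 <= c x <= X by rewrite /c le_max lexx ge_max (ltW X0) ge_min lexx orbT.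
have cle x y : x <= y -> c x <= c y.
  move=> xy; rewrite /c ge_max le_max lexx /= le_max; case: (leP 0 (Num.min x X)) => // h0.
    by rewrite le_min !ge_min xy lexx !orbT.
  by rewrite [X in _ || X](_ : _ = true) ?orbT//; rewrite le_min !ge_min xy lexx !orbT.
have clip x y : x <= y -> c y - c x <= y - x.
  move=> xy; rewrite /c /Num.min /Num.max.
  case: (ltP x X) => ?; case: (ltP y X) => ?; case: (ltP 0 x) => ?; case: (ltP 0 y) => ?;
    rewrite ?X0; lra.
have acc : globally_AC (h \o c).
  move=> e /ac[d d0 H]; exists d => // n s t st dis sd.
  apply: H.
  - move=> i; have /andP[? ?] := c01 (s i); have /andP[? ?] := c01 (t i); split => //.
    exact: cle.
  - by move=> i j /dis[h1|h1]; [left|right]; exact: cle.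
  - by apply: le_lt_trans sd; apply: ler_sum => i _; exact: clip.
have ndc : nondecreasing (h \o c).
  by move=> x y xy /=; apply: nd; rewrite ?in_itv ?c01//; exact: cle.
have rcc (x : R) : (h \o c) y @[y --> x^'+] --> (h \o c) x.
  apply/cvgrPdist_lt => e /acc[d d0 H]; near=> y.
  have xy : x <= y by apply: ltW; near: y; exact: nbhs_right_gt.
  have := H 1 (fun=> x) (fun=> y); rewrite !big_ord1 distrC; apply => //.
    by move=> i j; rewrite !ord1.
  by rewrite ltrBlDl; near: y; apply: nbhs_right_lt; rewrite ltrDl.
pose H : cumulative R R := HB.pack (h \o c) (isCumulative.Build R _ R (h \o c) ndc rcc).
pose nu : {measure set (measurableTypeR R) -> \bar R} := lebesgue_stieltjes_measure H.
have nuE a b : a <= b -> nu `]a, b]%classic = (h (c b) - h (c a))%:E.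
  exact: (lebesgue_stieltjes_itvoc H).
have mD : measurable (`]0, X]%classic : set (measurableTypeR R)) by exact: measurable_itv.
have fD : (nu `]0%R, X]%classic < +oo)%E.
  by rewrite nuE ?ltry// ltW.
(* The restriction to ]0, X] is finite and still dominated; its Radon-Nikodym derivative is the
   density. *)
pose nuf : {finite_measure set (measurableTypeR R) -> \bar R} := mfrestr mD fD.
have dom : nuf `<< mu.
  apply/null_content_dominatesP => A mA A0.
  have /null_content_dominatesP/(_ A mA A0) nuA := lebesgue_stieltjes_dominates (h := H) acc.
  apply/eqP; rewrite eq_le measure_ge0 andbT -nuA.
  rewrite /nuf /= /mfrestr /mrestr; apply: le_measure; rewrite ?inE//; exact: measurableI.
have [F [F0 Ffin Fint FE]] := @radon_nikodym_sigma_finite _ _ _ mu nuf dom.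
have gF : EFin \o (fine \o F) = F by apply/funext => x /=; rewrite fineK.
exists (fine \o F); first by rewrite gF.
move=> x /andP[x0 xX]; rewrite -Rintegral_itv_obnd_cbnd; last first.
  by rewrite gF; exact: (integrableS measurableT).
rewrite /Rintegral.
have -> : (\int[mu]_(t in `]0%R, x]) ((fine \o F) t)%:E = \int[mu]_(t in `]0%R, x]) F t)%E.
  by apply: eq_integral => t _; rewrite /= fineK.
rewrite -FE; last exact: measurable_itv.
rewrite /nuf /= /mfrestr /mrestr (_ : _ `&` _ = `]0%R, x]%classic); last first.
  apply/seteqP; split => t /=; first by case.
  by rewrite !in_itv /= => /andP[t0 tx]; rewrite t0 tx (le_trans tx).
rewrite [X in fine X](_ : _ = (h x - h 0%R)%:E) /=; first by rewrite addrC subrK.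
by rewrite nuE// !cX ?x0 ?xX ?lexx ?(ltW X0).
Unshelve. all: by end_near. Qed.

(** Jordan decomposition f = V - (V - f), with V the variation function: both terms are
    nondecreasing and absolutely continuous. *)
Lemma AC_density (X : R) f : 0 < X -> AC_on 0 X f ->
  exists2 g : R -> R, mu.-integrable setT (EFin \o g) &
    forall x, 0 <= x <= X -> f x = f 0 + \int[mu]_(t in `[0, x]) g t.
Proof.
move=> X0 ac.
have fin := AC_on_BV (ltW X0) ac.
pose V x := fine (total_variation 0 x f).
have VB x y : 0 <= x -> x <= y -> y <= X -> `|f y - f x| <= V y - V x.
  move=> x0 xy yX; have xX : x <= X by rewrite (le_trans xy).
  rewrite /V (total_variationD f x0 xy) fineD ?fin//.
  rewrite addrAC subrr add0r -lee_fin fineK ?fin//; exact: total_variation_ge.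
have acV : AC_on 0 X V by exact: AC_on_TV (ltW X0) ac.
have [g1 ig1 g1E] : exists2 g : R -> R, mu.-integrable setT (EFin \o g) &
    forall x, 0 <= x <= X -> V x = V 0 + \int[mu]_(t in `[0, x]) g t.
  apply: AC_nondecreasing_density => // x y; rewrite !in_itv/= => /andP[x0 xX] /andP[y0 yX] xy.
  by rewrite -subr_ge0 (le_trans _ (VB _ _ x0 xy yX)).
have [g2 ig2 g2E] : exists2 g : R -> R, mu.-integrable setT (EFin \o g) &
    forall x, 0 <= x <= X -> V x - f x = (V 0 - f 0) + \int[mu]_(t in `[0, x]) g t.
  apply: (AC_nondecreasing_density (h := fun x => V x - f x)) => //; first exact: AC_onB.
  move=> x y; rewrite !in_itv/= => /andP[x0 xX] /andP[y0 yX] xy.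
  have := VB _ _ x0 xy yX; have := ler_norm (f y - f x); lra.
exists (fun x => g1 x - g2 x).
  by rewrite [X in _.-integrable _ X](_ : _ = (EFin \o g1) \- (EFin \o g2))%E//; exact: integrableB.
move=> x xX; rewrite RintegralB//; first by have := g1E _ xX; have := g2E _ xX; lra.
  exact: (integrableS measurableT).
exact: (integrableS measurableT).
Qed.

Lemma locally_integrableT g : mu.-integrable setT (EFin \o g) -> locally_integrable setT g.
Proof. by move=> ig; apply: open_integrable_locally => //; exact: openT. Qed.

Lemma is_derive_near f1 f2 x d : {near x, f1 =1 f2} -> is_derive x 1 f1 d -> is_derive x 1 f2 d.
Proof. exact: near_eq_is_derive. Qed.

Lemma Rintegral_is_derive_ae g : mu.-integrable setT (EFin \o g) ->
  {ae mu, forall x : R, 0 < x -> is_derive x 1 (fun y => \int[mu]_(t in `[0, y]) g t) (g x)}.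
Proof.
move=> ig; have h y : mu.-integrable [set` Interval (BLeft 0) (BRight y)] (EFin \o g).
  exact: (integrableS measurableT).
have := FTC1 h (locally_integrableT ig).
apply: filterS; first exact: (ae_filter_ringOfSetsType mu).
move=> x H x0; have [|D E] := H; first by rewrite lte_fin.
by rewrite derive1E in E; split.
Qed.

End AC_density.

(** * Algebra of absolutely continuous functions *)

Section AC_calculus.
Variable R : realType.
Implicit Types (f g : R -> R) (a b : R).

(** Common source of the sum, product and composition rules: in each of them the increments of the
    result are controlled by those of the operands. *)
Lemma AC_on_dist2 a b f g F (L : R) : 0 <= L ->
  (forall s t, a <= s -> s <= t -> t <= b ->
    `|F t - F s| <= L * (`|f t - f s| + `|g t - g s|)) ->
  AC_on a b f -> AC_on a b g -> AC_on a b F.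
Proof.
move=> L0 FL acf acg e e0; pose e' := e / (2 * (L + 1)).
have L1 : 0 < L + 1 by rewrite ltr_wpDl.
have e'0 : 0 < e' by rewrite divr_gt0// mulr_gt0.
have [d1 d10 H1] := acf _ e'0; have [d2 d20 H2] := acg _ e'0.
exists (Num.min d1 d2); first by rewrite lt_min d10.
move=> n s t st dis; rewrite lt_min => /andP[sd1 sd2].
have {}H1 := H1 n s t st dis sd1; have {}H2 := H2 n s t st dis sd2.
apply: (@le_lt_trans _ _ (\sum_i (L * (`|f (t i) - f (s i)| + `|g (t i) - g (s i)|)))).
  by apply: ler_sum => i _; have [? ? ?] := st i; exact: FL.
rewrite -mulr_sumr big_split /=.
apply: (@le_lt_trans _ _ ((L + 1) * (\sum_i `|f (t i) - f (s i)| + \sum_i `|g (t i) - g (s i)|))).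
  by apply: ler_wpM2r; [apply: addr_ge0; apply: sumr_ge0|lra].
have -> : e = (L + 1) * (e' + e').
  rewrite /e'; field; exact: lt0r_neq0.
by rewrite ltr_pM2l//; exact: ltrD.
Qed.

Lemma AC_on_bounded a b f : a <= b -> AC_on a b f ->
  exists2 M, 0 <= M & forall x, a <= x <= b -> `|f x| <= M.
Proof.
move=> ab ac; exists (`|f a| + fine (total_variation a b f)).
  by apply: addr_ge0 => //; exact/fine_ge0/total_variation_ge0.
move=> x /andP[ax xb]; have -> : f x = f a + (f x - f a) by ring.
rewrite (le_trans (ler_normD _ _))// lerD2l -lee_fin fineK; last exact: (AC_on_BV ab ac).
rewrite (le_trans (total_variation_ge f ax))// (total_variationD f ax xb).
by rewrite leeDl// total_variation_ge0.
Qed.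

Lemma AC_on_dist a b f : AC_on a b f -> forall e, 0 < e -> exists2 d, 0 < d &
  forall x y, a <= x <= b -> a <= y <= b -> `|y - x| < d -> `|f y - f x| < e.
Proof.
move=> ac e /ac[d d0 H]; exists d => //.
have key x y : a <= x -> x <= y -> y <= b -> `|y - x| < d -> `|f y - f x| < e.
  move=> ax xy yb; rewrite ger0_norm ?subr_ge0// => yx.
  have := H 1 (fun=> x) (fun=> y); rewrite !big_ord1; apply => //.
  by move=> i j; rewrite !ord1.
move=> x y /andP[ax xb] /andP[ay yb]; have [xy|/ltW xy] := leP x y; first exact: key.
by rewrite distrC [`|f _ - _|]distrC; exact: key.
Qed.

Lemma AC_on_continuous a b f : AC_on a b f -> {within `[a, b], continuous f}.
Proof.
move=> /AC_on_dist ac; apply/subspace_continuousP => x; rewrite /= in_itv/= => xab.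
apply/cvgrPdist_lt => e /ac[d d0 H]; near=> y.
have yab : a <= y <= b by move: (near (withinT `[a, b] (nbhs_filter x)) y); rewrite /= in_itv /=; apply.
rewrite distrC; apply: H => //.
near: y; apply: cvg_within; exists d => //= y; rewrite /= distrC.
by [].
Unshelve. all: by end_near. Qed.

Lemma AC_onD a b f g : AC_on a b f -> AC_on a b g -> AC_on a b (fun x => f x + g x).
Proof.
apply: (AC_on_dist2 (L := 1)) => // s t _ _ _; rewrite mul1r.
by rewrite (_ : _ - _ = (f t - f s) + (g t - g s)) ?ler_normD//; ring.
Qed.

Lemma AC_onN a b f : AC_on a b f -> AC_on a b (fun x => - f x).
Proof.
move=> ac; apply: (AC_on_dist2 (L := 1) _ _ ac ac) => // s t _ _ _; rewrite mul1r.
by rewrite -opprD normrN lerDl.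
Qed.

Lemma AC_onM a b f g : a <= b ->
  AC_on a b f -> AC_on a b g -> AC_on a b (fun x => f x * g x).
Proof.
move=> ab acf acg.
have [M M0 HM] := AC_on_bounded ab acf; have [N N0 HN] := AC_on_bounded ab acg.
apply: (AC_on_dist2 (L := M + N) _ _ acf acg); first exact: addr_ge0.
move=> s t as_ st tb.
rewrite (_ : _ - _ = (f t - f s) * g t + f s * (g t - g s)); last by ring.
rewrite (le_trans (ler_normD _ _))// !normrM.
have h1 : `|g t| <= N by apply: HN; rewrite tb (le_trans as_).
have h2 : `|f s| <= M by apply: HM; rewrite as_ (le_trans st).
have h3 : `|f t - f s| * `|g t| <= N * `|f t - f s| by rewrite mulrC ler_wpM2r.
have h4 : `|f s| * `|g t - g s| <= M * `|g t - g s| by rewrite ler_wpM2r.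
apply: (le_trans (lerD h3 h4)).
have h5 : 0 <= M * `|f t - f s| by rewrite mulr_ge0.
have h6 : 0 <= N * `|g t - g s| by rewrite mulr_ge0.
by move: h5 h6; rewrite mulrDr !mulrDl; lra.
Qed.

Lemma AC_on_lipschitz a b f (L : R) : 0 <= L ->
  (forall s t, a <= s -> s <= t -> t <= b -> `|f t - f s| <= L * (t - s)) -> AC_on a b f.
Proof.
move=> L0 H e e0; have L1 : 0 < L + 1 by rewrite ltr_wpDl.
exists (e / (L + 1)); first by rewrite divr_gt0.
move=> n s t st _; rewrite ltr_pdivlMr// => sd.
apply: le_lt_trans sd; rewrite mulr_suml; apply: ler_sum => i _.
have [h1 h2 h3] := st i; rewrite (le_trans (H _ _ h1 h2 h3))// mulrC ler_wpM2l ?subr_ge0//; lra.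
Qed.

Lemma AC_on_cst a b (c : R) : AC_on a b (fun=> c).
Proof. by apply: (AC_on_lipschitz (L := 0)) => // s t _ _ _; rewrite subrr normr0 mul0r. Qed.

(* The mean value theorem makes C^1 functions Lipschitz on compact intervals. *)
Lemma AC_on_C1 a b f (df : R -> R) (M : R) : (forall x : R, is_derive x 1 f (df x)) ->
  (forall x, a <= x <= b -> `|df x| <= M) -> AC_on a b f.
Proof.
move=> Hd HM.
apply: (AC_on_lipschitz (L := `|M|)) => // s t as_ st tb.
have cf : {within `[s, t], continuous f}.
  apply: continuous_subspaceT => x.
  by apply: differentiable_continuous; apply/derivable1_diffP; have [] := Hd x.
have [c] := MVT_segment st (fun x _ => Hd x) cf.
rewrite in_itv/= => /andP[sc ct] ->; rewrite normrM [`|t - s|]ger0_norm ?subr_ge0//.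
rewrite ler_wpM2r ?subr_ge0//.
by rewrite (le_trans (HM _ _)) ?ler_norm// (le_trans as_)//= (le_trans ct).
Qed.

(** The range of [f] is bounded, and on a compact interval containing it [dg] is bounded, so [g] is
    Lipschitz there. *)
Lemma AC_on_comp a b f (g dg : R -> R) : a <= b -> AC_on a b f ->
  (forall x : R, is_derive x 1 g (dg x)) -> continuous dg ->
  AC_on a b (fun x => g (f x)).
Proof.
move=> ab ac Hd cd; have [M M0 HM] := AC_on_bounded ab ac.
have MM : - M <= M by lra.
have [|c _ Hc] := @EVT_max R (fun x => `|dg x|) (- M) M MM.
  by apply: continuous_subspaceT => x; apply: continuous_comp; [exact: cd|exact: norm_continuous].
apply: (AC_on_dist2 (L := `|dg c|) _ _ ac ac) => // s t as_ st tb.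
have bnd u v : u \in `[- M, M] -> v \in `[- M, M] -> u <= v -> `|g v - g u| <= `|dg c| * `|v - u|.
  rewrite !in_itv/= => /andP[Mu uM] /andP[Mv vM] uv.
  have cg : {within `[u, v], continuous g}.
    apply: continuous_subspaceT => x.
    by apply: differentiable_continuous; apply/derivable1_diffP; have [] := Hd x.
  have [d] := MVT_segment uv (fun x _ => Hd x) cg.
  rewrite in_itv/= => /andP[ud dv] ->; rewrite normrM ler_wpM2r//.
  by apply: Hc; rewrite in_itv/= (le_trans Mu)//= (le_trans dv).
have fM x : a <= x <= b -> f x \in `[- M, M] by move=> /HM; rewrite in_itv/= ler_norml.
have ft : f t \in `[- M, M] by apply: fM; rewrite tb (le_trans as_).
have fs : f s \in `[- M, M] by apply: fM; rewrite as_ (le_trans st).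
have [fst|/ltW fst] := leP (f s) (f t).
  by rewrite (le_trans (bnd _ _ fs ft fst))// mulrDr lerDl mulr_ge0.
by rewrite distrC (le_trans (bnd _ _ ft fs fst))// distrC mulrDr lerDl mulr_ge0.
Qed.

End AC_calculus.

(** * Carathéodory derivatives and monotonicity *)

Section primitives.
Variable R : realType.
Implicit Types (f g : R -> R) (a b : R).
Local Notation mu := (@lebesgue_measure R).

(** The Carathéodory form of f' = g, through which all differential equations and inequalities below
    are expressed. *)
Definition rprim f g := AC_halfline f /\
  {ae mu, forall x : R, 0 < x -> is_derive x 1 f (g x)}.

Lemma ae_imply (P Q : R -> Prop) : (forall x, P x -> Q x) ->
  {ae mu, forall x, P x} -> {ae mu, forall x, Q x}.
Proof. by move=> PQ; apply: filterS; first exact: (ae_filter_ringOfSetsType mu). Qed.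

Lemma ae_imply2 (P Q S : R -> Prop) : (forall x, P x -> Q x -> S x) ->
  {ae mu, forall x, P x} -> {ae mu, forall x, Q x} -> {ae mu, forall x, S x}.
Proof. by move=> PQ; apply: filterS2; first exact: (ae_filter_ringOfSetsType mu). Qed.

Lemma ae_all (P : R -> Prop) : (forall x, P x) -> {ae mu, forall x, P x}.
Proof. by move=> h; exists set0; split => // x /= /(_ (h x)). Qed.

Lemma gt_nbhs (x a : R) : a < x -> \forall y \near x, a < y.
Proof.
move=> ax; have : - x < - a by rewrite ltrN2.
by move/Nlt_nbhsl; apply: filterS => y; rewrite ltrN2.
Qed.

Lemma AC_on_is_derive (X : R) f : 0 < X -> AC_on 0 X f ->
  exists g : R -> R, [/\ mu.-integrable setT (EFin \o g),
    (forall x, 0 <= x <= X -> f x = f 0 + \int[mu]_(t in `[0, x]) g t) &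
    {ae mu, forall x : R, 0 < x < X -> is_derive x 1 f (g x)}].
Proof.
move=> X0 /(AC_density X0)[g ig fE]; exists g; split => //.
have := Rintegral_is_derive_ae ig; apply: ae_imply => x H /andP[x0 xX].
have {}H := H x0.
apply: (@is_derive_near R (fun y => f 0 + \int[mu]_(t in `[0, y]) g t)).
  near=> y; apply/esym/fE; apply/andP; split; apply: ltW; near: y.
    exact: gt_nbhs.
  exact: lt_nbhsl.
by rewrite -[g x]add0r; apply: is_deriveD.
Unshelve. all: by end_near. Qed.

Lemma AC_derivable_ae f : AC_halfline f -> {ae mu, forall x : R, 0 < x -> derivable f x 1}.
Proof.
move=> ac.
have : {ae mu, forall x : R, forall n : nat, 0 < x < n.+1%:R -> derivable f x 1}.
  apply/ae_foralln => n.
  have [g [_ _]] := AC_on_is_derive (ltr0Sn R n) (ac _ (ltr0Sn R n)).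
  by apply: ae_imply => x H /H[].
apply: ae_imply => x H x0; apply: (H (Num.truncn x)).
by rewrite x0 /= -truncn_le_nat.
Qed.

(** The increment of [f] is the integral of its density, which equals [g] a.e. Absolute continuity
    is essential: minus the Cantor function has derivative 0 a.e. and decreases. *)
Lemma rprim_le f g a b : rprim f g -> 0 <= a -> a <= b ->
  {ae mu, forall x : R, a < x < b -> 0 <= g x} -> f a <= f b.
Proof.
move=> [ac df] a0; rewrite le_eqVlt => /predU1P[->//|ab] g0.
have b0 : 0 < b by exact: le_lt_trans ab.
have [c [ic fE dc]] := AC_on_is_derive b0 (ac _ b0).
have fa : f a = f 0 + \int[mu]_(t in `[0, a]) c t by apply: fE; rewrite a0 ltW.
have fb : f b = f 0 + \int[mu]_(t in `[0, b]) c t by apply: fE; rewrite lexx ltW.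
rewrite -subr_ge0 fa fb.
have -> : (f 0 + \int[mu]_(t in `[0, b]) c t) - (f 0 + \int[mu]_(t in `[0, a]) c t) =
    \int[mu]_(t in `]a, b]) c t.
  rewrite -(@Rintegral_itvB _ c (BLeft 0) (BRight b) a) ?bnd_simp ?(ltW ab)//.
    by ring.
  exact: (integrableS measurableT).
rewrite -Rintegral_itv_bndo_bndc; last exact: (integrableS measurableT).
have mc : measurable_fun (`]a, b[%classic : set R) (EFin \o c).
  by apply: measurable_funTS; case/integrableP : ic.
rewrite /Rintegral.
(* The density is nonnegative only a.e.; its absolute value is nonnegative everywhere and has the
   same integral. *)
rewrite (@ae_eq_integral _ _ _ mu `]a, b[%classic (fun x => `|(EFin \o c) x|%E) (EFin \o c))//.
- by apply: fine_ge0; apply: integral_ge0.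
- exact: measurableT_comp.
- rewrite /ae_eq; apply: ae_imply2 g0; last first.
    apply: ae_imply2 df dc => x H1 H2; exact: (conj H1 H2).
  move=> x [H1 H2] g0; rewrite /= in_itv/= => /andP[ax xb].
  have x0 : 0 < x by exact: le_lt_trans ax.
  have [_ E1] := H1 x0; have [|_ E2] := H2; first by rewrite x0 xb.
  by rewrite ger0_norm// -E2 E1 g0// ax xb.
Qed.

Lemma rprim_ae f g g' : {ae mu, forall x : R, 0 < x -> g x = g' x} -> rprim f g -> rprim f g'.
Proof.
move=> e [ac d]; split => //; apply: ae_imply2 e d => x E D x0.
by rewrite -E //; exact: D.
Qed.

Lemma rprim_eq f g g' : (forall x : R, 0 < x -> g x = g' x) -> rprim f g -> rprim f g'.
Proof. by move=> e; apply: rprim_ae; exact: ae_all. Qed.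

Lemma rprimD f g f' g' : rprim f f' -> rprim g g' ->
  rprim (fun x => f x + g x) (fun x => f' x + g' x).
Proof.
move=> [acf df] [acg dg]; split.
  by move=> X X0; apply: AC_onD; [exact: acf|exact: acg].
by apply: ae_imply2 df dg => x Df Dg x0; apply: is_deriveD; [exact: Df|exact: Dg].
Qed.

Lemma rprimN f f' : rprim f f' -> rprim (fun x => - f x) (fun x => - f' x).
Proof.
move=> [acf df]; split; first by move=> X X0; apply: AC_onN; exact: acf.
by apply: ae_imply df => x Df x0; apply: is_deriveN; exact: Df.
Qed.

Lemma rprimB f g f' g' : rprim f f' -> rprim g g' ->
  rprim (fun x => f x - g x) (fun x => f' x - g' x).
Proof. by move=> pf pg; apply: rprimD => //; exact: rprimN. Qed.

Lemma rprim_cst (c : R) : rprim (fun=> c) (fun=> 0).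
Proof.
split; first by move=> X _; exact: AC_on_cst.
by apply: ae_all => x _; exact: is_derive_cst.
Qed.

Lemma rprimM f g f' g' : rprim f f' -> rprim g g' ->
  rprim (fun x => f x * g x) (fun x => f' x * g x + f x * g' x).
Proof.
move=> [acf df] [acg dg]; split.
  by move=> X X0; apply: (AC_onM (ltW X0)); [exact: acf|exact: acg].
apply: ae_imply2 df dg => x Df Dg x0.
have := is_deriveM (Df x0) (Dg x0).
by rewrite [f' x * _]mulrC [g x * _ + _]addrC.
Qed.

Lemma rprimZ (c : R) f f' : rprim f f' -> rprim (fun x => c * f x) (fun x => c * f' x).
Proof.
by move=> pf; apply: rprim_eq (rprimM (rprim_cst c) pf) => x _; rewrite mul0r add0r.
Qed.

Lemma rprim_sum n (f f' : 'I_n -> R -> R) : (forall i, rprim (f i) (f' i)) ->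
  rprim (fun x => \sum_i f i x) (fun x => \sum_i f' i x).
Proof.
elim: n f f' => [f f' _|n IH f f' H].
  have -> : (fun x => \sum_(i < 0) f i x) = (fun=> 0).
    by apply/funext => x; rewrite big_ord0.
  have -> : (fun x => \sum_(i < 0) f' i x) = (fun=> 0).
    by apply/funext => x; rewrite big_ord0.
  exact: rprim_cst.
have -> : (fun x => \sum_(i < n.+1) f i x) =
    (fun x => \sum_(i < n) f (widen_ord (leqnSn n) i) x + f ord_max x).
  by apply/funext => x; rewrite big_ord_recr.
have -> : (fun x => \sum_(i < n.+1) f' i x) =
    (fun x => \sum_(i < n) f' (widen_ord (leqnSn n) i) x + f' ord_max x).
  by apply/funext => x; rewrite big_ord_recr.
by apply: rprimD => //; exact: IH.
Qed.

Lemma rprim_C1 f f' : (forall x : R, is_derive x 1 f (f' x)) -> continuous f' -> rprim f f'.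
Proof.
move=> df cf; split; last by apply: ae_all => x _; exact: df.
move=> X X0; have [|c _ Hc] := @EVT_max R (fun x => `|f' x|) 0 X (ltW X0).
  by apply: continuous_subspaceT => x; apply: continuous_comp; [exact: cf|exact: norm_continuous].
by apply: (AC_on_C1 df (M := `|f' c|)) => x x0X; apply: Hc; rewrite in_itv.
Qed.

Lemma rprim_id : rprim id (fun=> 1).
Proof. by apply: (rprim_C1 (fun x => is_derive_id x 1)) => x; exact: cst_continuous. Qed.

Lemma rprim_comp f f' (g dg : R -> R) : rprim f f' ->
  (forall x : R, is_derive x 1 g (dg x)) -> continuous dg ->
  rprim (fun x => g (f x)) (fun x => dg (f x) * f' x).
Proof.
move=> [ac df] Hd cd; split.
  by move=> X X0; apply: (AC_on_comp (ltW X0) _ Hd cd); exact: ac.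
apply: ae_imply df => x Df x0.
by have := is_derive1_comp (Hd (f x)) (Df x0).
Qed.

Lemma L1loc_integrable g (a X : R) : L1loc_halfline g -> 0 <= a ->
  mu.-integrable `[a, X] (EFin \o g).
Proof.
move=> ig a0; have h : 0 < Num.max X 1 by rewrite lt_max ltr01 orbT.
apply: (integrableS _ _ _ (ig _ h)) => // x; rewrite /= !in_itv/= => /andP[ax xX].
by rewrite (le_trans a0)//= le_max xX.
Qed.

Lemma rprim_integral g : L1loc_halfline g -> rprim (fun x => \int[mu]_(t in `[0, x]) g t) g.
Proof.
move=> ig.
(* Cutting [g] off beyond X gives a function integrable on the whole line, with the same integrals
   up to X. *)
have P (X : R) : exists c : R -> R, [/\ mu.-integrable setT (EFin \o c),
    forall x, 0 <= x <= X -> c x = g x &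
    forall x, x <= X -> \int[mu]_(t in `[0, x]) g t = \int[mu]_(t in `[0, x]) c t].
  exists (g \_ `[0, X]); split.
  - by rewrite -restrict_EFin -integrable_mkcond//; exact: L1loc_integrable.
  - by move=> x xX; rewrite patchE mem_set// /= in_itv.
  - move=> x xX; apply: eq_Rintegral => t; rewrite inE /= in_itv /= => /andP[t0 tx].
    by rewrite patchE mem_set//= in_itv/= t0 (le_trans tx).
split.
- move=> X X0; have [c [ic _ cE]] := P X.
  move=> e e0; have [d [d0 H]] := @integral_normr_continuous _ _ _ mu c ic e e0.
  exists d => // n s t st dis sd.
  pose F i : set R := `]s i, t i]%classic.
  have mF i : measurable (F i) by exact: measurable_itv.
  have tF : trivIset setT F.
    apply/trivIsetP => i j _ _ ij; apply/seteqP; split => // x; rewrite /F /= !in_itv/=.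
    by move=> [/andP[h1 h2] /andP[h3 h4]]; have [h|h] := dis _ _ ij; lra.
  have mU : measurable (\big[setU/set0]_i F i) by exact: bigsetU_measurable.
  have E : mu (\big[setU/set0]_i F i) = (\sum_i (t i - s i))%:E.
    rewrite measure_bigsetU_ord// -sumEFin; apply: eq_bigr => i _.
    by apply: lebesgue_itvoc; have [] := st i.
  have {}H : \int[mu]_(x in \big[setU/set0]_i F i) `|c x| < e.
    apply: (H _ mU); have : ((\sum_i (t i - s i))%:E < d%:E)%E by rewrite lte_fin.
    by rewrite -E.
  apply: le_lt_trans H; rewrite [leRHS]/Rintegral ge0_integral_bigsetU ?index_enum_uniq//.
  - rewrite -sum_fine; last first.
      move=> i _; apply: integrable_fin_num; first exact: mF.
      apply: (integrableS measurableT _ _ (integrable_norm ic)) => //; exact: mF.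
    apply: ler_sum => i _; have [h1 h2 h3] := st i.
    rewrite !cE ?(le_trans h2)// (@Rintegral_itvB _ c (BLeft 0) (BRight (t i)) (s i)) ?bnd_simp//.
      by apply: le_normr_Rintegral => //; exact: (integrableS measurableT).
    exact: (integrableS measurableT).
  - exact: sub_trivIset tF.
  - by apply: measurable_funTS; case/integrableP : (integrable_norm ic).
- have : {ae mu, forall x : R, forall n : nat, 0 < x < n.+1%:R ->
      is_derive x 1 (fun x => \int[mu]_(t in `[0, x]) g t) (g x)}.
    apply/ae_foralln => n; have [c [ic gc cE]] := P n.+1%:R.
    apply: ae_imply (Rintegral_is_derive_ae ic) => x H /andP[x0 xn].
    rewrite -gc ?(ltW x0) ?(ltW xn)//.
    apply: (@is_derive_near _ _ _ _ _ _ (H x0)).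
    by near=> y; rewrite cE//; apply: ltW; near: y; exact: lt_nbhsl.
  apply: ae_imply => x H x0; apply: (H (Num.truncn x)).
  by rewrite x0 /= -truncn_le_nat.
Unshelve. all: by end_near. Qed.

End primitives.

(** * Norms on the complex numbers *)

Section complex_norms.
Variable R : realType.
Local Notation C := R[i].
Local Notation Re := complex.Re.
Local Notation Im := complex.Im.
Implicit Types (z w : C).

Lemma cReD z w : Re (z + w) = Re z + Re w. Proof. by case: z w => [a b] [c d]. Qed.
Lemma cImD z w : Im (z + w) = Im z + Im w. Proof. by case: z w => [a b] [c d]. Qed.
Lemma cReN z : Re (- z) = - Re z. Proof. by case: z. Qed.
Lemma cImN z : Im (- z) = - Im z. Proof. by case: z. Qed.
Lemma cReM z w : Re (z * w) = Re z * Re w - Im z * Im w. Proof. by case: z w => [a b] [c d]. Qed.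
Lemma cImM z w : Im (z * w) = Re z * Im w + Im z * Re w. Proof. by case: z w => [a b] [c d]. Qed.
Lemma cReJ z : Re (z^*)%C = Re z. Proof. by case: z. Qed.
Lemma cImJ z : Im (z^*)%C = - Im z. Proof. by case: z. Qed.
Lemma complex_eqP z w : Re z = Re w -> Im z = Im w -> z = w.
Proof. by case: z w => [a b] [c d] /= -> ->. Qed.
Lemma cRe_sum (I : Type) (s : seq I) (P : pred I) (F : I -> C) :
  Re (\sum_(i <- s | P i) F i) = \sum_(i <- s | P i) Re (F i).
Proof. exact: (big_morph _ cReD). Qed.
Lemma cIm_sum (I : Type) (s : seq I) (P : pred I) (F : I -> C) :
  Im (\sum_(i <- s | P i) F i) = \sum_(i <- s | P i) Im (F i).
Proof. exact: (big_morph _ cImD). Qed.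

(* The l^1 norm of C = R^2: unlike [`|z|] it is real-valued, and it is also submultiplicative. *)
Definition N1 z : R := `|Re z| + `|Im z|.

Lemma N1_ge0 z : 0 <= N1 z. Proof. exact: addr_ge0. Qed.
Lemma N1_eq0 z : N1 z <= 0 -> z = 0.
Proof.
rewrite /N1 => h; have := normr_ge0 (Re z); have := normr_ge0 (Im z) => h1 h2.
by apply: complex_eqP => /=; apply/eqP; rewrite -normr_le0; lra.
Qed.
Lemma N1_0 : N1 0 = 0. Proof. by rewrite /N1 /= normr0 addr0. Qed.
Lemma N1_1 : N1 1 = 1. Proof. by rewrite /N1 /= normr0 normr1 addr0. Qed.
Lemma N1_real (a : R) : N1 a%:C%C = `|a|. Proof. by rewrite /N1 /= normr0 addr0. Qed.
Lemma N1D z w : N1 (z + w) <= N1 z + N1 w.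
Proof.
rewrite /N1 cReD cImD; have := ler_normD (Re z) (Re w); have := ler_normD (Im z) (Im w); lra.
Qed.
Lemma N1N z : N1 (- z) = N1 z. Proof. by rewrite /N1 cReN cImN !normrN. Qed.
Lemma N1J z : N1 (z^*)%C = N1 z. Proof. by rewrite /N1 cReJ cImJ normrN. Qed.
Lemma N1M z w : N1 (z * w) <= N1 z * N1 w.
Proof.
rewrite /N1 cReM cImM; have := ler_normB (Re z * Re w) (Im z * Im w).
have := ler_normD (Re z * Im w) (Im z * Re w); rewrite !normrM mulrDl !mulrDr; lra.
Qed.
Lemma N1_sum (I : Type) (s : seq I) (P : pred I) (F : I -> C) :
  N1 (\sum_(i <- s | P i) F i) <= \sum_(i <- s | P i) N1 (F i).
Proof.
elim/big_ind2 : _ => //; first by rewrite N1_0.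
by move=> a b c d h1 h2; apply: (le_trans (N1D _ _)); exact: lerD.
Qed.

Definition sq z : R := Re z ^+ 2 + Im z ^+ 2.
Lemma sq_ge0 z : 0 <= sq z. Proof. by rewrite addr_ge0// sqr_ge0. Qed.
Lemma sqM z w : sq (z * w) = sq z * sq w. Proof. by rewrite /sq cReM cImM; ring. Qed.
Lemma sq_le_N1 z : sq z <= N1 z ^+ 2.
Proof.
rewrite /sq /N1 -(real_normK (num_real (Re z))) -(real_normK (num_real (Im z))).
by have := mulr_ge0 (normr_ge0 (Re z)) (normr_ge0 (Im z)); nra.
Qed.
Lemma N1_le_sq z : N1 z ^+ 2 <= 2 * sq z.
Proof.
rewrite /sq /N1 -(real_normK (num_real (Re z))) -(real_normK (num_real (Im z))).
by have := sqr_ge0 (`|Re z| - `|Im z|); nra.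
Qed.
Lemma sq_conj z : z * (z^*)%C = (sq z)%:C%C.
Proof. by apply: complex_eqP; rewrite ?cReM ?cImM cReJ cImJ /= /sq; ring. Qed.

Lemma N1_inv_le z : z != 0 -> N1 z^-1 <= 2 / N1 z.
Proof.
move=> z0; have N0 : 0 < N1 z.
  by rewrite lt_def N1_ge0 andbT; apply: contra z0 => /eqP h; rewrite [z]N1_eq0 ?h.
have s0 : 0 < sq z by have := N1_le_sq z; have := exprn_gt0 2 N0; lra.
have -> : z^-1 = (z^*)%C * ((sq z)^-1)%:C%C.
  apply: (mulfI z0); rewrite mulfV// mulrA sq_conj.
  by apply: complex_eqP; rewrite ?cReM ?cImM /=; field; exact: lt0r_neq0.
apply: (le_trans (N1M _ _)); rewrite N1J N1_real ger0_norm ?invr_ge0 ?sq_ge0//.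
rewrite ler_pdivrMr// mulrAC ler_pdivlMr// -expr2; exact: N1_le_sq.
Qed.

(** Bridge from the complex-valued modulus of the hypothesis on M_1 - M_2; each coordinate is at
    most [a], whence the factor 2. *)
Lemma N1_le_real (z : C) (a : R) : `|z| <= (a%:C)%C -> N1 z <= 2 * a.
Proof.
case: z => x y; rewrite normc_def /= lecE /= => /andP[_ h].
have a0 : 0 <= a by apply: le_trans h; exact: sqrtr_ge0.
have key u v : Num.sqrt (u ^+ 2 + v ^+ 2) <= a -> `|u| <= a.
  move=> hh; rewrite -sqrtr_sqr; apply: le_trans hh; rewrite ler_wsqrtr// lerDl sqr_ge0//.
rewrite /N1 /=; have := key x y h; have := key y x; rewrite addrC => /(_ h); lra.
Qed.

End complex_norms.

(** * Norms and adjoints of matrices *)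

Section matrix_norms.
Variable R : realType.
Local Notation C := R[i].

Definition mxN p q (A : 'M[C]_(p, q)) : R := \sum_i \sum_j N1 (A i j).

Section any_size.
Variables p q : nat.
Implicit Types A B : 'M[C]_(p, q).

Lemma mxN_ge0 A : 0 <= mxN A.
Proof. by apply: sumr_ge0 => i _; apply: sumr_ge0 => j _; exact: N1_ge0. Qed.

Lemma N1_le_mxN A i j : N1 (A i j) <= mxN A.
Proof.
rewrite /mxN (bigD1 i)//= (bigD1 j)//= -addrA lerDl addr_ge0//.
  by apply: sumr_ge0 => k _; exact: N1_ge0.
by apply: sumr_ge0 => k _; apply: sumr_ge0 => l _; exact: N1_ge0.
Qed.

Lemma mxN_eq0 A : mxN A <= 0 -> A = 0.
Proof.
move=> h; apply/matrixP => i j; rewrite mxE; apply: N1_eq0.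
exact: le_trans (N1_le_mxN A i j) h.
Qed.

Lemma mxN0 : mxN (0 : 'M[C]_(p, q)) = 0.
Proof. by rewrite /mxN big1// => i _; rewrite big1// => j _; rewrite mxE N1_0. Qed.

Lemma mxND A B : mxN (A + B) <= mxN A + mxN B.
Proof.
rewrite /mxN -big_split; apply: ler_sum => i _; rewrite -big_split.
by apply: ler_sum => j _; rewrite mxE N1D.
Qed.

Lemma mxNN A : mxN (- A) = mxN A.
Proof. by apply: eq_bigr => i _; apply: eq_bigr => j _; rewrite mxE N1N. Qed.

Lemma mxNB A B : mxN (A - B) <= mxN A + mxN B.
Proof. by rewrite -[mxN B]mxNN mxND. Qed.

Lemma mxNZ (a : C) A : mxN (a *: A) <= N1 a * mxN A.
Proof.
rewrite /mxN mulr_sumr; apply: ler_sum => i _; rewrite mulr_sumr.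
by apply: ler_sum => j _; rewrite mxE N1M.
Qed.

(** The squared Frobenius norm. Unlike [mxN] it is a smooth function of the entries, so Gronwall
    estimates are run on it and then converted. *)
Definition mxsq A : R := \sum_i \sum_j sq (A i j).

Lemma mxsq_ge0 A : 0 <= mxsq A.
Proof. by apply: sumr_ge0 => i _; apply: sumr_ge0 => j _; exact: sq_ge0. Qed.

Lemma sq_le_mxsq A i j : sq (A i j) <= mxsq A.
Proof.
rewrite /mxsq (bigD1 i)//= (bigD1 j)//= -addrA lerDl addr_ge0//.
  by apply: sumr_ge0 => k _; exact: sq_ge0.
by apply: sumr_ge0 => k _; apply: sumr_ge0 => l _; exact: sq_ge0.
Qed.

Lemma mxN_le_mxsq A : mxN A ^+ 2 <= 2 * (p * q)%:R ^+ 2 * mxsq A.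
Proof.
pose s := Num.sqrt (2 * mxsq A).
have s2 : s ^+ 2 = 2 * mxsq A by rewrite sqr_sqrtr// mulr_ge0// mxsq_ge0.
have h i j : N1 (A i j) <= s.
  rewrite -(ler_pXn2r (n := 2))// ?nnegrE ?N1_ge0 ?sqrtr_ge0//.
  by rewrite s2 (le_trans (N1_le_sq _))// ler_wpM2l// sq_le_mxsq.
have : mxN A <= (p * q)%:R * s.
  apply: (@le_trans _ _ (\sum_(i < p) \sum_(j < q) s)).
    by apply: ler_sum => i _; apply: ler_sum => j _.
  under eq_bigr do rewrite sumr_const card_ord.
  by rewrite sumr_const card_ord -mulrnA mulnC -[leLHS]mulr_natl.
rewrite -(ler_pXn2r (n := 2))// ?nnegrE ?mxN_ge0 ?mulr_ge0 ?sqrtr_ge0//.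
by rewrite exprMn s2; lra.
Qed.

Lemma mxsq_le_mxN A : mxsq A <= mxN A ^+ 2.
Proof.
rewrite expr2 {1}/mxN mulr_suml; apply: ler_sum => i _; rewrite mulr_suml.
apply: ler_sum => j _; rewrite (le_trans (sq_le_N1 _))// expr2 ler_wpM2l ?N1_ge0//.
exact: N1_le_mxN.
Qed.

End any_size.

Lemma mxNM p q r (A : 'M[C]_(p, q)) (B : 'M[C]_(q, r)) : mxN (A *m B) <= mxN A * mxN B.
Proof.
apply: (@le_trans _ _ (\sum_i \sum_j \sum_k N1 (A i k) * N1 (B k j))).
  apply: ler_sum => i _; apply: ler_sum => j _; rewrite mxE (le_trans (N1_sum _ _ _))//.
  by apply: ler_sum => k _; exact: N1M.
rewrite {1}/mxN mulr_suml; apply: ler_sum => i _.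
rewrite exchange_big /= mulr_suml; apply: ler_sum => k _.
rewrite -mulr_sumr ler_wpM2l ?N1_ge0//.
rewrite /mxN (bigD1 k)//= lerDl; apply: sumr_ge0 => l _; apply: sumr_ge0 => j _.
exact: N1_ge0.
Qed.

Definition adj p q (A : 'M[C]_(p, q)) : 'M[C]_(q, p) := map_mx (@conjc R) A^T.

Lemma adjE p q (A : 'M[C]_(p, q)) i j : adj A i j = ((A j i)^*)%C.
Proof. by rewrite !mxE. Qed.
Lemma adjK p q (A : 'M[C]_(p, q)) : adj (adj A) = A.
Proof. by apply/matrixP => i j; rewrite !adjE conjcK. Qed.
Lemma adjD p q (A B : 'M[C]_(p, q)) : adj (A + B) = adj A + adj B.
Proof. by apply/matrixP => i j; rewrite !(adjE, mxE) rmorphD. Qed.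
Lemma adjN p q (A : 'M[C]_(p, q)) : adj (- A) = - adj A.
Proof. by apply/matrixP => i j; rewrite !(adjE, mxE) rmorphN. Qed.
Lemma adjB p q (A B : 'M[C]_(p, q)) : adj (A - B) = adj A - adj B.
Proof. by rewrite adjD adjN. Qed.
Lemma adjZ p q a (A : 'M[C]_(p, q)) : adj (a *: A) = (a^*)%C *: adj A.
Proof. by apply/matrixP => i j; rewrite !(adjE, mxE) rmorphM. Qed.
Lemma adj0 p q : adj (0 : 'M[C]_(p, q)) = 0.
Proof. by apply/matrixP => i j; rewrite !(adjE, mxE) rmorph0. Qed.
Lemma adj1 p : adj (1%:M : 'M[C]_p) = 1%:M.
Proof. by apply/matrixP => i j; rewrite !(adjE, mxE) eq_sym rmorph_nat. Qed.
Lemma adjM p q r (A : 'M[C]_(p, q)) (B : 'M[C]_(q, r)) : adj (A *m B) = adj B *m adj A.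
Proof.
apply/matrixP => i j; rewrite !(adjE, mxE) rmorph_sum; apply: eq_bigr => k _.
by rewrite !adjE rmorphM mulrC.
Qed.
Lemma mxN_adj p q (A : 'M[C]_(p, q)) : mxN (adj A) = mxN A.
Proof.
rewrite /mxN exchange_big; apply: eq_bigr => i _; apply: eq_bigr => j _.
by rewrite adjE N1J.
Qed.

End matrix_norms.

(** * Derivatives of matrix functions, Gronwall, complex exponential *)

Section matrix_primitives.
Variable R : realType.
Local Notation C := R[i].
Local Notation Re := complex.Re.
Local Notation Im := complex.Im.
Local Notation mu := (@lebesgue_measure R).
Implicit Types (f g : R -> C).

Definition cprim f g := rprim (fun x => Re (f x)) (fun x => Re (g x)) /\
  rprim (fun x => Im (f x)) (fun x => Im (g x)).

Lemma cprim_ae f g g' : {ae mu, forall x : R, 0 < x -> g x = g' x} -> cprim f g -> cprim f g'.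
Proof. by move=> e [pr pi]; split; [apply: rprim_ae pr|apply: rprim_ae pi]; apply: ae_imply e => x E /E ->. Qed.

Lemma cprim_eq f g g' : (forall x : R, 0 < x -> g x = g' x) -> cprim f g -> cprim f g'.
Proof. by move=> e; apply: cprim_ae; exact: ae_all. Qed.

Lemma cprim_cst (c : C) : cprim (fun=> c) (fun=> 0).
Proof. by split; exact: rprim_cst. Qed.

Lemma cprim_real : cprim (fun x : R => x%:C%C) (fun=> 1).
Proof. by split; [exact: (rprim_id R)|exact: rprim_cst]. Qed.

Lemma cprimD f g f' g' : cprim f f' -> cprim g g' -> cprim (fun x => f x + g x) (fun x => f' x + g' x).
Proof.
move=> [fr fi] [gr gi]; split.
  under eq_fun do rewrite cReD; under [X in rprim _ X]eq_fun do rewrite cReD; exact: rprimD.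
under eq_fun do rewrite cImD; under [X in rprim _ X]eq_fun do rewrite cImD; exact: rprimD.
Qed.

Lemma cprimN f f' : cprim f f' -> cprim (fun x => - f x) (fun x => - f' x).
Proof.
move=> [fr fi]; split.
  under eq_fun do rewrite cReN; under [X in rprim _ X]eq_fun do rewrite cReN; exact: rprimN.
under eq_fun do rewrite cImN; under [X in rprim _ X]eq_fun do rewrite cImN; exact: rprimN.
Qed.

Lemma cprimJ f f' : cprim f f' -> cprim (fun x => (f x)^*)%C (fun x => (f' x)^*)%C.
Proof.
move=> [fr fi]; split.
  by under eq_fun do rewrite cReJ; under [X in rprim _ X]eq_fun do rewrite cReJ.
under eq_fun do rewrite cImJ; under [X in rprim _ X]eq_fun do rewrite cImJ; exact: rprimN.
Qed.

Lemma cprimM f g f' g' : cprim f f' -> cprim g g' ->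
  cprim (fun x => f x * g x) (fun x => f' x * g x + f x * g' x).
Proof.
move=> [fr fi] [gr gi]; split.
  under eq_fun do rewrite cReM.
  apply: rprim_eq (rprimB (rprimM fr gr) (rprimM fi gi)) => x _.
  by rewrite cReD !cReM; ring.
under eq_fun do rewrite cImM.
apply: rprim_eq (rprimD (rprimM fr gi) (rprimM fi gr)) => x _.
by rewrite cImD !cImM; ring.
Qed.

Lemma cprim_sum n (f f' : 'I_n -> R -> C) : (forall i, cprim (f i) (f' i)) ->
  cprim (fun x => \sum_i f i x) (fun x => \sum_i f' i x).
Proof.
move=> H; split.
  under eq_fun do rewrite cRe_sum; under [X in rprim _ X]eq_fun do rewrite cRe_sum.
  by apply: rprim_sum => i; have [] := H i.
under eq_fun do rewrite cIm_sum; under [X in rprim _ X]eq_fun do rewrite cIm_sum.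
by apply: rprim_sum => i; have [] := H i.
Qed.

Definition prim p q (F G : R -> 'M[C]_(p, q)) :=
  forall i j, cprim (fun x => F x i j) (fun x => G x i j).

Lemma prim_ae p q (F G G' : R -> 'M[C]_(p, q)) :
  {ae mu, forall x : R, 0 < x -> G x = G' x} -> prim F G -> prim F G'.
Proof. by move=> e H i j; apply: cprim_ae (H i j); apply: ae_imply e => x E /E ->. Qed.

Lemma prim_eq p q (F G G' : R -> 'M[C]_(p, q)) :
  (forall x : R, 0 < x -> G x = G' x) -> prim F G -> prim F G'.
Proof. by move=> e; apply: prim_ae; exact: ae_all. Qed.

Lemma prim_cst p q (A : 'M[C]_(p, q)) : prim (fun=> A) (fun=> 0).
Proof. by move=> i j; apply: cprim_eq (cprim_cst (A i j)) => x _; rewrite mxE. Qed.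

Lemma primD p q (F G F' G' : R -> 'M[C]_(p, q)) : prim F F' -> prim G G' ->
  prim (fun x => F x + G x) (fun x => F' x + G' x).
Proof.
move=> HF HG i j; under eq_fun do rewrite mxE.
by apply: cprim_eq (cprimD (HF i j) (HG i j)) => x _; rewrite mxE.
Qed.

Lemma primN p q (F F' : R -> 'M[C]_(p, q)) : prim F F' ->
  prim (fun x => - F x) (fun x => - F' x).
Proof.
move=> HF i j; under eq_fun do rewrite mxE.
by apply: cprim_eq (cprimN (HF i j)) => x _; rewrite mxE.
Qed.

Lemma primB p q (F G F' G' : R -> 'M[C]_(p, q)) : prim F F' -> prim G G' ->
  prim (fun x => F x - G x) (fun x => F' x - G' x).
Proof. by move=> HF HG; apply: primD => //; exact: primN. Qed.

Lemma primM p q r (F F' : R -> 'M[C]_(p, q)) (G G' : R -> 'M[C]_(q, r)) :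
  prim F F' -> prim G G' ->
  prim (fun x => F x *m G x) (fun x => F' x *m G x + F x *m G' x).
Proof.
move=> HF HG i j; under eq_fun do rewrite mxE.
apply: cprim_eq (cprim_sum (fun k => cprimM (HF i k) (HG k j))) => x _.
by rewrite !mxE -big_split.
Qed.

Lemma primZ p q (a a' : R -> C) (F F' : R -> 'M[C]_(p, q)) : cprim a a' -> prim F F' ->
  prim (fun x => a x *: F x) (fun x => a' x *: F x + a x *: F' x).
Proof.
move=> ha HF i j; under eq_fun do rewrite mxE.
by apply: cprim_eq (cprimM ha (HF i j)) => x _; rewrite !mxE.
Qed.

Lemma primZc p q (a : C) (F F' : R -> 'M[C]_(p, q)) : prim F F' ->
  prim (fun x => a *: F x) (fun x => a *: F' x).
Proof.
move=> HF; apply: prim_eq (primZ (cprim_cst a) HF) => x _.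
by rewrite scale0r add0r.
Qed.

Lemma primMr p q r (A : 'M[C]_(q, r)) (G G' : R -> 'M[C]_(p, q)) :
  prim G G' -> prim (fun x => G x *m A) (fun x => G' x *m A).
Proof.
move=> HG; apply: prim_eq (primM HG (prim_cst A)) => x _; by rewrite mulmx0 addr0.
Qed.

Lemma prim_adj p q (F F' : R -> 'M[C]_(p, q)) : prim F F' ->
  prim (fun x => adj (F x)) (fun x => adj (F' x)).
Proof.
move=> HF i j; under eq_fun do rewrite adjE.
by apply: cprim_eq (cprimJ (HF j i)) => x _; rewrite adjE.
Qed.

(* Testing F b - F a against the signs of its entries turns the l^1 norm into a linear form. *)
Lemma prim_norm_le p q (F G : R -> 'M[C]_(p, q)) (h h' : R -> R) a b :
  prim F G -> rprim h h' -> 0 <= a -> a <= b ->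
  {ae mu, forall x : R, a < x < b -> mxN (G x) <= h' x} ->
  mxN (F b - F a) <= h b - h a.
Proof.
move=> HF Hh a0 ab HG.
pose s i j := Num.sg (Re (F b i j - F a i j)); pose t i j := Num.sg (Im (F b i j - F a i j)).
pose l (M : 'M[C]_(p, q)) := \sum_i \sum_j (s i j * Re (M i j) + t i j * Im (M i j)).
have lN M : l M <= mxN M.
  apply: ler_sum => i _; apply: ler_sum => j _; rewrite /N1.
  have sgn (x y : R) : Num.sg x * y <= `|y|.
    rewrite (le_trans (ler_norm _))// normrM normr_sg; case: (x != 0); rewrite ?mul1r ?mul0r//.
  exact: (lerD (sgn _ _) (sgn _ _)).
have lB : l (F b) - l (F a) = mxN (F b - F a).
  rewrite /l /mxN -sumrB; apply: eq_bigr => i _; rewrite -sumrB; apply: eq_bigr => j _.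
  rewrite /N1 !mxE !normrEsg -/(s i j) -/(t i j) !(cReD, cReN, cImD, cImN); ring.
have pl : rprim (fun x => l (F x)) (fun x => l (G x)).
  apply: rprim_sum => i; apply: rprim_sum => j.
  by have [h1 h2] := HF i j; apply: rprimD; exact: rprimZ.
rewrite -lB; suff : h a - l (F a) <= h b - l (F b) by lra.
apply: (rprim_le (rprimB Hh pl) a0 ab).
by apply: ae_imply HG => x H /H {}H; rewrite subr_ge0 (le_trans (lN _)).
Qed.

(** The function f exp (- g) is nonincreasing. *)
Lemma gronwall (f f' g g' : R -> R) a b : rprim f f' -> rprim g g' -> 0 <= a -> a <= b ->
  {ae mu, forall x : R, a < x < b -> f' x <= g' x * f x} ->
  f b <= f a * expR (g b - g a).
Proof.
move=> pf pg a0 ab H.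
have pe : rprim (fun x => expR (- g x)) (fun x => expR (- g x) * - g' x).
  exact: (rprim_comp (rprimN pg) (fun x => is_derive_expR x) (@continuous_expR R)).
have h : - (f a * expR (- g a)) <= - (f b * expR (- g b)).
  apply: (rprim_le (f := fun x => - (f x * expR (- g x))) (rprimN (rprimM pf pe)) a0 ab).
  apply: ae_imply H => x H /H {}H.
  have := expR_gt0 (- g x) => e0; rewrite oppr_ge0.
  rewrite (_ : _ + _ = expR (- g x) * (f' x - g' x * f x)); last by ring.
  by rewrite pmulr_rle0// subr_le0.
have -> : g b - g a = - g a - (- g b) by ring.
move: h; rewrite lerN2 expRD opprK mulrA => h.
rewrite -(ler_pM2r (expR_gt0 (- g b))); apply: (le_trans h).
by rewrite -[leRHS]mulrA -expRD subrr expR0 mulr1.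
Qed.

Lemma rprim_mxsq p q (F F' : R -> 'M[C]_(p, q)) : prim F F' ->
  rprim (fun x => mxsq (F x)) (fun x => \sum_i \sum_j
    2 * (Re (F x i j) * Re (F' x i j) + Im (F x i j) * Im (F' x i j))).
Proof.
move=> HF; apply: rprim_sum => i; apply: rprim_sum => j; have [hr hi] := HF i j.
apply: rprim_eq (rprimD (rprimM hr hr) (rprimM hi hi)) => x _; ring.
Qed.

(** The left-hand side is the derivative of [mxsq] at [A] in the direction [B], as in
    [rprim_mxsq]. *)
Lemma mxsq_deriv_le p q (A B : 'M[C]_(p, q)) :
  \sum_i \sum_j 2 * (Re (A i j) * Re (B i j) + Im (A i j) * Im (B i j)) <= 2 * mxN A * mxN B.
Proof.
rewrite -mulrA {2}/mxN mulr_suml mulr_sumr; apply: ler_sum => i _.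
rewrite mulr_suml mulr_sumr; apply: ler_sum => j _; rewrite ler_wpM2l//.
apply: (@le_trans _ _ (N1 (A i j) * N1 (B i j))); last first.
  by rewrite ler_wpM2l ?N1_ge0 ?N1_le_mxN.
rewrite /N1; apply: (le_trans (ler_norm _)); apply: (le_trans (ler_normD _ _)).
rewrite !normrM; have h := fun x y : R => mulr_ge0 (normr_ge0 x) (normr_ge0 y).
have := h (Re (A i j)) (Im (B i j)); have := h (Im (A i j)) (Re (B i j)); nra.
Qed.

Lemma cprim_bound p q (F F' : R -> 'M[C]_(p, q)) X : 0 < X -> prim F F' ->
  exists2 M, 0 <= M & forall x, 0 <= x <= X -> mxN (F x) <= M.
Proof.
move=> X0 HF.
have H i j : exists M : R, 0 <= M /\ forall x, 0 <= x <= X -> N1 (F x i j) <= M.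
  have [[ar _] [ai _]] := HF i j.
  have [M M0 HM] := AC_on_bounded (ltW X0) (ar _ X0).
  have [N N0 HN] := AC_on_bounded (ltW X0) (ai _ X0).
  exists (M + N); split; first exact: addr_ge0.
  by move=> x xX; apply: lerD; [exact: HM|exact: HN].
have /choice[M HM] : forall i, exists M : 'I_q -> R, forall j, 0 <= M j /\ forall x, 0 <= x <= X -> N1 (F x i j) <= M j.
  by move=> i; have /choice[M HM] := H i; exists M.
exists (\sum_i \sum_j M i j).
  by apply: sumr_ge0 => i _; apply: sumr_ge0 => j _; have [] := HM i j.
move=> x xX; apply: ler_sum => i _; apply: ler_sum => j _; have [_] := HM i j; exact.
Qed.

Definition cexp (z : C) : C := ((expR (Re z) * cos (Im z)) +i* (expR (Re z) * sin (Im z)))%C.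

Lemma cexpD z w : cexp (z + w) = cexp z * cexp w.
Proof.
by apply: complex_eqP; rewrite ?cReM ?cImM /cexp /= cReD cImD expRD ?cosD ?sinD; ring.
Qed.

Lemma cexp0 : cexp 0 = 1.
Proof. by apply: complex_eqP; rewrite /cexp /= expR0 ?cos0 ?sin0; ring. Qed.

Lemma cexpN z : cexp z * cexp (- z) = 1.
Proof. by rewrite -cexpD subrr cexp0. Qed.

Lemma N1_cexp z : N1 (cexp z) <= 2 * expR (Re z).
Proof.
rewrite /N1 /cexp /= !normrM (ger0_norm (expR_ge0 _)).
have := cos_max (Im z); have := sin_max (Im z); have := expR_ge0 (Re z).
have := normr_ge0 (cos (Im z)); have := normr_ge0 (sin (Im z)); nra.
Qed.

Lemma sq_cexp z : sq (cexp z) = expR (Re z) ^+ 2.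
Proof. by rewrite /sq /= !exprMn -mulrDr cos2Dsin2 mulr1. Qed.

Lemma cprim_cexp (w : C) : cprim (fun x : R => cexp (w * x%:C%C)) (fun x => w * cexp (w * x%:C%C)).
Proof.
case: w => a b.
have E x : (a +i* b)%C * x%:C%C = (a * x +i* (b * x))%C.
  by apply: complex_eqP; rewrite ?cReM ?cImM /=; ring.
have lin c x : is_derive (x : R) 1 (fun y => c * y) c.
  by have := is_deriveZ c (is_derive_id x (1 : R)); rewrite /GRing.scale /= mulr1.
have pl c : rprim (fun x : R => c * x) (fun=> c).
  by apply: (rprim_C1 (lin c)) => x; exact: cst_continuous.
have pexp : rprim (fun x => expR (a * x)) (fun x => expR (a * x) * a).
  exact: (rprim_comp (pl a) (fun x => is_derive_expR x) (@continuous_expR R)).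
have pcos : rprim (fun x => cos (b * x)) (fun x => - sin (b * x) * b).
  apply: (rprim_comp (pl b) (fun x => is_derive_cos x)).
  by move=> x; apply: continuousN; exact: continuous_sin.
have psin : rprim (fun x => sin (b * x)) (fun x => cos (b * x) * b).
  exact: (rprim_comp (pl b) (fun x => is_derive_sin x) (@continuous_cos R)).
under eq_fun do rewrite E; under [X in cprim _ X]eq_fun do rewrite E.
split.
  apply: rprim_eq (rprimM pexp pcos) => x _; rewrite cReM /=; ring.
apply: rprim_eq (rprimM pexp psin) => x _; rewrite cImM /=; ring.
Qed.

End matrix_primitives.

(** * Locally integrable matrix functions and their integrals *)

Section locally_integrable_matrices.
Variable R : realType.
Local Notation C := R[i].
Local Notation Re := complex.Re.
Local Notation Im := complex.Im.
Local Notation mu := (@lebesgue_measure R).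
Implicit Types (f g : R -> R).

(** Multipliers of locally integrable functions. The class contains the absolutely continuous
    functions and is stable under locally uniform limits, as Picard iteration requires. *)
Definition loc_bounded f := forall X : R, 0 < X ->
  measurable_fun (`[0, X]%classic : set R) f /\
  exists M : R, forall x, 0 <= x <= X -> `|f x| <= M.

Lemma AC_loc_bounded f : AC_halfline f -> loc_bounded f.
Proof.
move=> ac X X0; split.
  by apply: subspace_continuous_measurable_fun => //; exact: AC_on_continuous (ac _ X0).
by have [M _ HM] := AC_on_bounded (ltW X0) (ac _ X0); exists M.
Qed.

Lemma L1locM g f : L1loc_halfline g -> loc_bounded f -> L1loc_halfline (fun x => g x * f x).
Proof.
move=> ig bf X X0; have [mf [M HM]] := bf X X0.
have := integrableMl _ (ig X X0) mf; apply => //.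
exists M; split; first exact: num_real.
by move=> y My x; rewrite /= in_itv/= => xX; rewrite (le_trans (HM _ xX)) ?ltW.
Qed.

Lemma L1locD f g : L1loc_halfline f -> L1loc_halfline g -> L1loc_halfline (fun x => f x + g x).
Proof. by move=> hf hg X X0; rewrite [X in _.-integrable _ X](_ : _ = (EFin \o f) \+ (EFin \o g))%E//; apply: integrableD => //; [exact: hf|exact: hg]. Qed.

Lemma L1locN f : L1loc_halfline f -> L1loc_halfline (fun x => - f x).
Proof. by move=> hf X X0; rewrite [X in _.-integrable _ X](_ : _ = \- (EFin \o f))%E//; apply: integrableN; exact: hf. Qed.

Lemma L1locB f g : L1loc_halfline f -> L1loc_halfline g -> L1loc_halfline (fun x => f x - g x).
Proof. by move=> hf hg; apply: L1locD => //; exact: L1locN. Qed.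

Lemma L1loc_norm f : L1loc_halfline f -> L1loc_halfline (fun x => `|f x|).
Proof. by move=> hf X X0; exact: integrable_norm (hf _ X0). Qed.

Lemma L1loc_cst (c : R) : L1loc_halfline (fun=> c).
Proof.
move=> X X0; apply: (@measurable_bounded_integrable _ _ _ mu (fun=> c)) => //.
  by apply: compact_finite_measure; exact: segment_compact.
exists `|c|; split; first exact: num_real.
by move=> y My x _; exact: ltW.
Qed.

Lemma L1loc_sum n (F : 'I_n -> R -> R) : (forall i, L1loc_halfline (F i)) ->
  L1loc_halfline (fun x => \sum_i F i x).
Proof.
move=> HF X X0.
rewrite [X in _.-integrable _ X](_ : _ = fun x => (\sum_i (EFin \o F i) x)%E); last first.
  by apply/funext => x; rewrite /= sumEFin.
by apply: integrable_sum => // i _; exact: HF.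
Qed.

Definition mxL1 p q (F : R -> 'M[C]_(p, q)) := entrywise (@L1loc_halfline R) F.
Definition mxLB p q (F : R -> 'M[C]_(p, q)) := entrywise loc_bounded F.

Lemma prim_LB p q (F G : R -> 'M[C]_(p, q)) : prim F G -> mxLB F.
Proof. by move=> H i j; have [[h1 _] [h2 _]] := H i j; split; exact: AC_loc_bounded. Qed.

Lemma mxL1_cst p q (A : 'M[C]_(p, q)) : mxL1 (fun=> A).
Proof. by move=> i j; split; exact: L1loc_cst. Qed.

Lemma mxL1D p q (F G : R -> 'M[C]_(p, q)) : mxL1 F -> mxL1 G -> mxL1 (fun x => F x + G x).
Proof.
move=> HF HG i j; have [f1 f2] := HF i j; have [g1 g2] := HG i j; split.
  by under eq_fun do rewrite mxE cReD; exact: L1locD.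
by under eq_fun do rewrite mxE cImD; exact: L1locD.
Qed.

Lemma mxL1B p q (F G : R -> 'M[C]_(p, q)) : mxL1 F -> mxL1 G -> mxL1 (fun x => F x - G x).
Proof.
move=> HF HG i j; have [f1 f2] := HF i j; have [g1 g2] := HG i j; split.
  by under eq_fun do rewrite !mxE cReD cReN; exact: L1locB.
by under eq_fun do rewrite !mxE cImD cImN; exact: L1locB.
Qed.

Lemma mxL1M p q r (A : R -> 'M[C]_(p, q)) (Y : R -> 'M[C]_(q, r)) :
  mxL1 A -> mxLB Y -> mxL1 (fun x => A x *m Y x).
Proof.
move=> HA HY i j; split.
  under eq_fun do rewrite mxE cRe_sum; apply: L1loc_sum => k.
  have [a1 a2] := HA i k; have [y1 y2] := HY k j.
  by under eq_fun do rewrite cReM; apply: L1locB; exact: L1locM.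
under eq_fun do rewrite mxE cIm_sum; apply: L1loc_sum => k.
have [a1 a2] := HA i k; have [y1 y2] := HY k j.
by under eq_fun do rewrite cImM; apply: L1locD; exact: L1locM.
Qed.

Lemma L1loc_mxN p q (F : R -> 'M[C]_(p, q)) : mxL1 F -> L1loc_halfline (fun x => mxN (F x)).
Proof.
move=> HF; apply: L1loc_sum => i; apply: L1loc_sum => j; have [h1 h2] := HF i j.
by apply: L1locD; exact: L1loc_norm.
Qed.

Definition rint f (x : R) := \int[mu]_(t in `[0, x]) f t.

Lemma rint0 f : rint f 0 = 0.
Proof. by rewrite /rint set_itv1 Rintegral_set1. Qed.

Lemma rprim_rint_le f a b : L1loc_halfline f -> (forall x, 0 <= f x) -> 0 <= a -> a <= b ->
  rint f a <= rint f b.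
Proof.
move=> hf f0 a0 ab; apply: (rprim_le (rprim_integral hf) a0 ab).
by apply: ae_all => x _.
Qed.

Definition mint p q (F : R -> 'M[C]_(p, q)) (x : R) : 'M[C]_(p, q) :=
  \matrix_(i, j) (rint (fun t => Re (F t i j)) x +i* rint (fun t => Im (F t i j)) x)%C.

Lemma mint0 p q (F : R -> 'M[C]_(p, q)) : mint F 0 = 0.
Proof. by apply/matrixP => i j; rewrite !mxE !rint0. Qed.

Lemma prim_mint p q (F : R -> 'M[C]_(p, q)) : mxL1 F -> prim (mint F) F.
Proof.
move=> HF i j; have [h1 h2] := HF i j; split; under eq_fun do rewrite mxE /=; exact: rprim_integral.
Qed.

Lemma prim_eq_halfline p q (F F' G : R -> 'M[C]_(p, q)) :
  prim F G -> prim F' G -> F 0 = F' 0 -> forall x, 0 <= x -> F x = F' x.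
Proof.
move=> HF HF' E0 x x0; apply/eqP; rewrite -subr_eq0; apply/eqP; apply: mxN_eq0.
have := prim_norm_le (primB HF HF') (rprim_cst 0) (lexx 0) x0.
rewrite E0 !subrr subr0; apply; apply: ae_all => t _; by rewrite subrr mxN0.
Qed.

End locally_integrable_matrices.

(** * Linear systems with integrable coefficients *)

Section picard.
Variable R : realType.
Local Notation C := R[i].
Local Notation mu := (@lebesgue_measure R).
Local Notation Re := complex.Re.
Local Notation Im := complex.Im.

(* [u k - 2 K / 2 ^ k] is nondecreasing and [u k + 2 K / 2 ^ k] is nonincreasing. *)
Lemma geometric_limit (u : nat -> R) (K : R) :
  (forall k, `|u k.+1 - u k| <= K / 2 ^+ k) ->
  exists l, forall k, `|l - u k| <= 2 * K / 2 ^+ k.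
Proof.
move=> H; pose v k := u k - 2 * K / 2 ^+ k; pose w k := u k + 2 * K / 2 ^+ k.
have E k : K / 2 ^+ k = 2 * (K / 2 ^+ k.+1).
  by rewrite exprS invfM; lra.
have K0 k : 0 <= K / 2 ^+ k by exact: le_trans (H k).
have vS k : v k <= v k.+1.
  by rewrite /v -!mulrA (E k); have := H k; rewrite (E k) ler_norml; lra.
have wS k : w k.+1 <= w k.
  by rewrite /w -!mulrA (E k); have := H k; rewrite (E k) ler_norml; lra.
have vw k : v k <= w k by rewrite /v /w -mulrA; have := K0 k; lra.
have vm : {homo v : i j / (i <= j)%N >-> i <= j} by exact: (homo_leq lexx le_trans vS).
have wm : {homo w : i j / (i <= j)%N >-> j <= i}.
  by apply: (homo_leq (r := fun x y => y <= x)) => // x y z h1 h2; exact: le_trans h2 h1.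
have vwm j k : v j <= w k.
  have [jk|/ltnW kj] := leqP j k; first by rewrite (le_trans (vm _ _ jk)).
  by rewrite (le_trans (vw _))// wm.
have ne : range v !=set0 by exists (v 0%N), 0%N.
have ub k : ubound (range v) (w k) by move=> _ [j _ <-].
exists (sup (range v)) => k; rewrite ler_norml; apply/andP; split.
  have : v k <= sup (range v) by apply: ub_le_sup; [exists (w 0%N)|exists k].
  by rewrite /v; lra.
by have : sup (range v) <= w k by [apply: ge_sup]; rewrite /w; lra.
Qed.

Lemma le0_geometric (a K : R) : (forall k, a <= K / 2 ^+ k) -> a <= 0.
Proof.
move=> H; rewrite leNgt; apply/negP => a0.
have K0 : 0 < K by have := H 0%N; rewrite expr0 divr1; exact: lt_le_trans.
have [k Hk] : exists k : nat, K / a < k%:R by exists (Num.truncn (K / a)).+1; rewrite truncnS_gt.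
have := H k; apply/negP; rewrite -ltNge ltr_pdivrMr ?exprn_gt0//.
move: Hk; rewrite ltr_pdivrMr// => Hk; apply: (lt_trans Hk).
by rewrite mulrC ltr_pM2l// -natrX ltr_nat ltn_expl.
Qed.

(** The limit is chosen before [K]: for the Picard iterates [K] depends on the interval [0, X],
    while the solution must not. *)
Lemma geometric_limit_unif (u : nat -> R) : exists l, forall K : R,
  (forall k, `|u k.+1 - u k| <= K / 2 ^+ k) -> forall k, `|l - u k| <= 2 * K / 2 ^+ k.
Proof.
have [[K HK]|none] := pselect (exists K : R, forall k, `|u k.+1 - u k| <= K / 2 ^+ k); last first.
  by exists 0 => K HK; exfalso; apply: none; exists K.
have [l Hl] := geometric_limit HK; exists l => K' HK'; have [l' Hl'] := geometric_limit HK'.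
suff -> : l = l' by [].
apply/eqP; rewrite -subr_eq0 -normr_le0; apply: (@le0_geometric _ (2 * K + 2 * K')) => k.
rewrite mulrDl (_ : l - l' = (l - u k) - (l' - u k)); last by ring.
by apply: (le_trans (ler_normB _ _)); exact: lerD.
Qed.

Lemma mx_geometric_limit p q (U : nat -> 'M[C]_(p, q)) : exists L : 'M[C]_(p, q), forall K : R,
  (forall k, mxN (U k.+1 - U k) <= K / 2 ^+ k) ->
  forall k, mxN (L - U k) <= (p * q)%:R * (4 * K) / 2 ^+ k.
Proof.
have /choice[lr Hr] i : exists lr : 'I_q -> R, forall j, forall K : R,
    (forall k, `|Re (U k.+1 i j) - Re (U k i j)| <= K / 2 ^+ k) ->
    forall k, `|lr j - Re (U k i j)| <= 2 * K / 2 ^+ k.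
  by have /choice[l Hl] := fun j => geometric_limit_unif (fun k => Re (U k i j)); exists l.
have /choice[li Hi] i : exists li : 'I_q -> R, forall j, forall K : R,
    (forall k, `|Im (U k.+1 i j) - Im (U k i j)| <= K / 2 ^+ k) ->
    forall k, `|li j - Im (U k i j)| <= 2 * K / 2 ^+ k.
  by have /choice[l Hl] := fun j => geometric_limit_unif (fun k => Im (U k i j)); exists l.
exists (\matrix_(i, j) (lr i j +i* li i j)%C) => K HK k.
have h i j l : N1 (U l.+1 i j - U l i j) <= K / 2 ^+ l.
  by apply: le_trans (HK l); have := N1_le_mxN (U l.+1 - U l) i j; rewrite !mxE.
apply: (@le_trans _ _ (\sum_(i < p) \sum_(j < q) (4 * K / 2 ^+ k))).
  apply: ler_sum => i _; apply: ler_sum => j _; rewrite !mxE /N1 cReD cReN cImD cImN /=.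
  have hr : `|lr i j - Re (U k i j)| <= 2 * K / 2 ^+ k.
    apply: Hr => l; apply: le_trans (h i j l).
    by rewrite /N1 cReD cReN lerDl.
  have hi : `|li i j - Im (U k i j)| <= 2 * K / 2 ^+ k.
    apply: Hi => l; apply: le_trans (h i j l).
    by rewrite /N1 cImD cImN lerDr.
  by move: hr hi; rewrite -!mulrA; lra.
under eq_bigr do rewrite sumr_const card_ord.
by rewrite sumr_const card_ord -mulrnA mulnC -[leLHS]mulr_natl mulrA.
Qed.

Variables (n q : nat) (A : R -> 'M[C]_n) (f : R -> 'M[C]_(n, q)) (c : 'M[C]_(n, q)).
Hypotheses (hA : mxL1 A) (hf : mxL1 f).

Let T Y := fun x => c + mint (fun t => A t *m Y t + f t) x.
Let Y k := iter k T (fun=> c).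
Let a := rint (fun t => mxN (A t)).

Let pa : rprim a (fun t => mxN (A t)).
Proof. exact/rprim_integral/L1loc_mxN. Qed.

Let primT Z : mxLB Z -> prim (T Z) (fun t => A t *m Z t + f t).
Proof.
move=> hZ; apply: prim_eq (primD (prim_cst c) (prim_mint (mxL1D (mxL1M hA hZ) hf))) => x _.
by rewrite add0r.
Qed.

Let LBY k : mxLB (Y k).
Proof.
elim: k => [|k IH]; first exact: (prim_LB (prim_cst c)).
exact: (prim_LB (primT IH)).
Qed.

Let Y0 k : Y k 0 = c.
Proof. by case: k => [//|k]; rewrite /Y iterS /T mint0 addr0. Qed.

Let T0 Z : T Z 0 = c. Proof. by rewrite /T mint0 addr0. Qed.

Let primTB Z Z' : mxLB Z -> mxLB Z' ->
  prim (fun x => T Z x - T Z' x) (fun t => A t *m (Z t - Z' t)).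
Proof.
move=> hZ hZ'; apply: prim_eq (primB (primT hZ) (primT hZ')) => x _.
by rewrite mulmxBr opprD addrACA subrr addr0.
Qed.

Let a0 : a 0 = 0. Proof. exact: rint0. Qed.
Let a_le x X : 0 <= x -> x <= X -> a x <= a X.
Proof. by move=> x0 xX; apply: rprim_rint_le => // [|y]; [exact: L1loc_mxN|exact: mxN_ge0]. Qed.

(** Bielecki's weight: against exp (2 a), integration with density [mxN (A t)] gains a factor 1 / 2,
    so the iteration contracts on all of [0, X] with no smallness condition. *)
Let step X : 0 < X -> exists K : R, forall k x, 0 <= x <= X ->
  mxN (Y k.+1 x - Y k x) <= K / 2 ^+ k.
Proof.
move=> X0.
have [M M0 HM] := cprim_bound X0 (primB (primT (LBY 0)) (prim_cst c)).
exists (M * expR (2 * a X)) => k x /andP[x0 xX].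
have mono y : 0 <= y -> y <= X -> expR (2 * a y) <= expR (2 * a X).
  by move=> y0 yX; rewrite ler_expR ler_pM2l// a_le.
suff : mxN (Y k.+1 x - Y k x) <= M / 2 ^+ k * expR (2 * a x).
  move/le_trans; apply; rewrite -[leRHS]mulrAC ler_wpM2l ?mono//.
  by rewrite divr_ge0// exprn_ge0.
elim: k x x0 xX => [|k IH] x x0 xX.
  rewrite expr0 divr1 (le_trans (HM x _)) ?x0//.
  rewrite ler_peMr// -expR0 ler_expR mulr_ge0// -a0; exact: a_le.
have M2 : M / 2 ^+ k = 2 * (M / 2 ^+ k.+1).
  by rewrite exprS invfM; lra.
have pe : rprim (fun x => M / 2 ^+ k.+1 * expR (2 * a x))
    (fun x => M / 2 ^+ k * expR (2 * a x) * mxN (A x)).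
  have := rprim_comp (rprimZ 2 pa) (fun x => is_derive_expR x) (@continuous_expR R).
  move=> /(rprimZ (M / 2 ^+ k.+1)); apply: rprim_eq => y _; rewrite M2; ring.
have h : {ae mu, forall t : R, 0 < t < x ->
      mxN (A t *m (Y k.+1 t - Y k t)) <= M / 2 ^+ k * expR (2 * a t) * mxN (A t)} ->
    mxN ((Y k.+2 x - Y k.+1 x) - (Y k.+2 0 - Y k.+1 0)) <=
    M / 2 ^+ k.+1 * expR (2 * a x) - M / 2 ^+ k.+1 * expR (2 * a 0).
  exact: (prim_norm_le (primTB (LBY k.+1) (LBY k)) pe (lexx 0) x0).
rewrite (Y0 k.+2) (Y0 k.+1) (subrr c) subr0 a0 mulr0 expR0 mulr1 in h.
have M3 : 0 <= M / 2 ^+ k.+1 by rewrite divr_ge0// exprn_ge0.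
have {}h : mxN (Y k.+2 x - Y k.+1 x) <= M / 2 ^+ k.+1 * expR (2 * a x) - M / 2 ^+ k.+1.
  apply: h; apply: ae_all => y /andP[y0 yx].
  rewrite (le_trans (mxNM _ _))// mulrC ler_wpM2r ?mxN_ge0// IH// ?ltW//.
  exact: lt_le_trans xX.
by move: h M3; lra.
Qed.

Lemma ode_exists : exists2 Z : R -> 'M[C]_(n, q),
  prim Z (fun x => A x *m Z x + f x) & Z 0 = c.
Proof.
have [Z HZ] : exists Z : R -> 'M[C]_(n, q), forall X, 0 < X -> exists K, forall k x, 0 <= x <= X ->
    mxN (Z x - Y k x) <= K / 2 ^+ k.
  have /choice[Z HZ] (x : R) := mx_geometric_limit (Y ^~ x).
  exists Z => X /step[K HK]; exists ((n * q)%:R * (4 * K)) => k x xX.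
  by apply: HZ => l; exact: HK.
have LBZ : mxLB Z.
  move=> i j; have key (re : C -> R) : (forall z w, re (z - w) = re z - re w) ->
      (forall z, `|re z| <= N1 z) -> (forall k, loc_bounded (fun x => re (Y k x i j))) ->
      loc_bounded (fun x => re (Z x i j)).
    move=> reB reN hY X X0; have [K HK] := HZ X X0.
    have d k x : 0 <= x <= X -> `|re (Z x i j) - re (Y k x i j)| <= K / 2 ^+ k.
      move=> xX; rewrite -reB (le_trans (reN _))// (le_trans _ (HK k x xX))//.
      by have := N1_le_mxN (Z x - Y k x) i j; rewrite !mxE.
    split.
      apply: (measurable_fun_cvg (h := fun k x => re (Y k x i j))).
        by move=> k; have [] := hY k X X0.
      move=> x; rewrite /= in_itv/= => xX; apply/cvgrPdist_le => e e0.
      have [k Hk] : exists k : nat, K / e < k%:R by exists (Num.truncn (K / e)).+1; rewrite truncnS_gt.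
      exists k => // l /= kl; rewrite (le_trans (d l x xX))// ler_pdivrMr ?exprn_gt0//.
      rewrite mulrC -ler_pdivrMr// (le_trans (ltW Hk))// -natrX ler_nat.
      by rewrite (leq_trans kl)// ltnW// ltn_expl.
    have [_ [M HM]] := hY 0%N X X0; exists (M + K / 2 ^+ 0) => x xX.
    have -> : re (Z x i j) = re (Y 0%N x i j) + (re (Z x i j) - re (Y 0%N x i j)) by ring.
    by rewrite (le_trans (ler_normD _ _))// lerD// ?HM// d.
  split; apply: key => [z w|z|k].
  - by rewrite cReD cReN.
  - by rewrite lerDl.
  - by have [] := LBY k i j.
  - by rewrite cImD cImN.
  - by rewrite lerDr.
  - by have [] := LBY k i j.
have ZE x : 0 <= x -> Z x = T Z x.
  move=> x0; have x1 : 0 < x + 1 by lra.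
  have [K HK] := HZ _ x1.
  apply/eqP; rewrite -subr_eq0; apply/eqP; apply: mxN_eq0.
  apply: (@le0_geometric _ (K + K * a x)) => k; rewrite mulrDl.
  have -> : Z x - T Z x = (Z x - Y k.+1 x) + (T (Y k) x - T Z x) by rewrite addrA subrK.
  apply: (le_trans (mxND _ _)); apply: lerD.
    have h : 0 <= K / 2 ^+ k by apply: le_trans (HK k x _); rewrite ?mxN_ge0// x0 lerDl/=.
    rewrite (le_trans (HK k.+1 x _))//; first by rewrite x0 lerDl/=.
    rewrite exprS invfM mulrCA ler_piMl//; lra.
  have h : {ae mu, forall t : R, 0 < t < x -> mxN (A t *m (Y k t - Z t)) <= K / 2 ^+ k * mxN (A t)} ->
      mxN ((T (Y k) x - T Z x) - (T (Y k) 0 - T Z 0)) <= K / 2 ^+ k * a x - K / 2 ^+ k * a 0.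
    exact: (prim_norm_le (primTB (LBY k) LBZ) (rprimZ (K / 2 ^+ k) pa) (lexx 0) x0).
  rewrite (T0 (Y k)) (T0 Z) (subrr c) subr0 a0 mulr0 subr0 in h.
  rewrite -[leRHS]mulrAC; apply: h; apply: ae_all => t /andP[t0 tx].
  rewrite (le_trans (mxNM _ _))// mulrC ler_wpM2r ?mxN_ge0//.
  by rewrite -mxNN opprB; apply: HK; rewrite (ltW t0) (le_trans (ltW tx))// lerDl.
(* [T Z] is a primitive by construction; its equality with [Z] is known for x >= 0 only, which is
   enough to rewrite the derivative. *)
exists (T Z); last by rewrite /T mint0 addr0.
by apply: prim_eq (primT LBZ) => x x0; rewrite -ZE// ltW.
Qed.

End picard.

(** * Solutions of the Schrödinger equation *)

Section schrodinger_solutions.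
Variables (R : realType) (m : nat).
Local Notation C := R[i].
Local Notation Re := complex.Re.
Implicit Types Q : R -> 'M[C]_m.

Lemma subBB (W : zmodType) (a b c d : W) : (a - b) - (c - d) = (a - c) - (b - d).
Proof. by rewrite [in LHS]opprD addrACA -opprD. Qed.

(** [V] stands for U'. The source [G] is there for the derivatives of solutions with respect to z,
    which solve inhomogeneous equations. *)
Definition sol_src Q z p (G U V : R -> 'M[C]_(m, p)) :=
  prim U V /\ prim V (fun x => Q x *m U x - z *: U x + G x).

Definition sol Q z p (U V : R -> 'M[C]_(m, p)) :=
  prim U V /\ prim V (fun x => Q x *m U x - z *: U x).

Lemma sol_src0 Q z p (U V : R -> 'M[C]_(m, p)) : sol_src Q z (fun=> 0) U V <-> sol Q z U V.
Proof. by split=> -[h1 h2]; split=> //; apply: prim_eq h2 => x _; rewrite addr0. Qed.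

Lemma sol_src_exists Q z p (G : R -> 'M[C]_(m, p)) (U0 V0 : 'M[C]_(m, p)) :
  mxL1 Q -> mxL1 G ->
  exists U V, [/\ sol_src Q z G U V, U 0 = U0 & V 0 = V0].
Proof.
move=> hQ hG.
(* The companion matrix of the first-order system for the stacked pair (U, V). *)
have hA : mxL1 (fun x => block_mx 0 1%:M (Q x - z%:M) 0 : 'M[C]_(m + m)).
  have hQz := mxL1B hQ (mxL1_cst z%:M).
  move=> i j; rewrite -(fintype.splitK i) -(fintype.splitK j); case: (fintype.split i) => i'; case: (fintype.split j) => j' /=.
  - split; under eq_fun do rewrite block_mxEul mxE; exact: L1loc_cst.
  - split; under eq_fun do rewrite block_mxEur; exact: L1loc_cst.
  - by have [h1 h2] := hQz i' j'; split; under eq_fun do rewrite block_mxEdl.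
  - split; under eq_fun do rewrite block_mxEdr mxE; exact: L1loc_cst.
have hf : mxL1 (fun x => col_mx 0 (G x) : 'M[C]_(m + m, p)).
  move=> i j; rewrite -(fintype.splitK i); case: (fintype.split i) => i' /=.
    split; under eq_fun do rewrite col_mxEu mxE; exact: L1loc_cst.
  by have [h1 h2] := hG i' j; split; under eq_fun do rewrite col_mxEd.
have [Y pY Y0] := ode_exists (col_mx U0 V0) hA hf.
exists (fun x => usubmx (Y x)), (fun x => dsubmx (Y x)); split; last first.
- by rewrite Y0 col_mxKd.
- by rewrite Y0 col_mxKu.
have E x : block_mx 0 1%:M (Q x - z%:M) 0 *m Y x + col_mx 0 (G x) =
    col_mx (dsubmx (Y x)) (Q x *m usubmx (Y x) - z *: usubmx (Y x) + G x).
  rewrite -{1}[Y x]vsubmxK mul_block_col add_col_mx !mul0mx mul1mx add0r !addr0.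
  by rewrite mulmxBl mul_scalar_mx.
split=> i j; under eq_fun do rewrite mxE.
  by apply: cprim_eq (pY (lshift m i) j) => x _; rewrite E col_mxEu.
by apply: cprim_eq (pY (rshift m i) j) => x _; rewrite E col_mxEd.
Qed.

Lemma sol_exists Q z p (U0 V0 : 'M[C]_(m, p)) : mxL1 Q ->
  exists U V, [/\ sol Q z U V, U 0 = U0 & V 0 = V0].
Proof.
move=> hQ; have [U [V [h h1 h2]]] := sol_src_exists z U0 V0 hQ (mxL1_cst 0).
by exists U, V; split => //; apply/sol_src0.
Qed.

(* Gronwall for the energy |U|^2 + |V|^2 + e^2. *)
Lemma sol_src_bound Q p (c X : R) : mxL1 Q -> 0 <= c -> 0 < X -> exists2 K, 0 <= K &
  forall z (G U V : R -> 'M[C]_(m, p)) e, N1 z <= c -> 0 <= e -> sol_src Q z G U V ->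
  U 0 = 0 -> V 0 = 0 -> (forall x, 0 <= x <= X -> mxN (G x) <= e) ->
  forall x, 0 <= x <= X -> mxN (U x) <= K * e.
Proof.
move=> hQ c0 X0; pose q := rint (fun t => mxN (Q t)).
have pq : rprim q (fun t => mxN (Q t)) by exact/rprim_integral/L1loc_mxN.
pose k : R := 2 * (m * p)%:R ^+ 2.
have k0 : 0 <= k by rewrite mulr_ge0// exprn_ge0.
(* With a = |U|^2 + |V|^2, the energy derivative 2uv + 2v((|Q| + c)u + e) is at most k(1 + c + |Q|)a
   + (k a + e^2); the derivative of [g] collects these coefficients. *)
pose g (x : R) := k * (1 + c + 1) * x + x + k * q x.
have pg : rprim g (fun x => k * (1 + c + 1) + 1 + k * mxN (Q x)).
  have := rprimD (rprimD (rprimZ (k * (1 + c + 1)) (rprim_id R)) (rprim_id R)) (rprimZ k pq).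
  by apply: rprim_eq => x _; rewrite mulr1.
pose S := k * expR (g X); have S0 : 0 <= S by rewrite mulr_ge0// expR_ge0.
exists (Num.sqrt S); first exact: sqrtr_ge0.
move=> z G U V e zc e0 [pU pV] U00 V00 hG x /andP[x0 xX].
pose E y := mxsq (U y) + mxsq (V y) + e ^+ 2.
have pE := rprimD (rprimD (rprim_mxsq pU) (rprim_mxsq pV)) (rprim_cst (e ^+ 2)).
have xsq0 : mxsq (0 : 'M[C]_(m, p)) = 0.
  by apply/le_anti; rewrite mxsq_ge0 andbT; have := mxsq_le_mxN (0 : 'M[C]_(m, p)); rewrite mxN0 expr0n.
have h : E x <= E 0 * expR (g x - g 0).
  apply: (gronwall pE pg (lexx 0) x0); apply: ae_all => y /andP[y0 yx].
  rewrite addr0.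
  set u := mxN (U y); set v := mxN (V y); set Qn := mxN (Q y).
  have u0 : 0 <= u by exact: mxN_ge0.
  have v0 : 0 <= v by exact: mxN_ge0.
  have Q0 : 0 <= Qn by exact: mxN_ge0.
  have hV : mxN (Q y *m U y - z *: U y + G y) <= (Qn + c) * u + e.
    apply: (le_trans (mxND _ _)); apply: lerD; last first.
      by apply: hG; rewrite (ltW y0) (le_trans (ltW yx)).
    rewrite (le_trans (mxNB _ _))// mulrDl lerD ?mxNM// (le_trans (mxNZ _ _))//.
    by rewrite ler_wpM2r.
  have h1 := mxsq_deriv_le (U y) (V y).
  have h2 := mxsq_deriv_le (V y) (Q y *m U y - z *: U y + G y).
  have ku : u ^+ 2 <= k * mxsq (U y) by exact: mxN_le_mxsq.
  have kv : v ^+ 2 <= k * mxsq (V y) by exact: mxN_le_mxsq.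
  apply: (le_trans (lerD h1 h2)).
  apply: (@le_trans _ _ (2 * u * v + 2 * v * ((Qn + c) * u + e))).
    by rewrite lerD2l ler_wpM2l// mulr_ge0.
  have uv : 2 * u * v <= u ^+ 2 + v ^+ 2 by have := sqr_ge0 (u - v); nra.
  have ve : 2 * v * e <= v ^+ 2 + e ^+ 2 by have := sqr_ge0 (v - e); nra.
  have uvk : u ^+ 2 + v ^+ 2 <= k * (mxsq (U y) + mxsq (V y)) by lra.
  set a := mxsq (U y) + mxsq (V y) in uvk *.
  have a0 : 0 <= a by rewrite addr_ge0// mxsq_ge0.
  have Qc : 0 <= Qn + c by exact: addr_ge0.
  have t1 : (Qn + c) * (2 * u * v) <= (Qn + c) * (k * a) by rewrite ler_wpM2l// (le_trans uv).
  have e2 : 0 <= e ^+ 2 by exact: sqr_ge0.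
  have t2 : 0 <= k * (1 + c + 1 + Qn) * e ^+ 2 by rewrite !mulr_ge0//; lra.
  have t3 : v ^+ 2 <= k * a by have := sqr_ge0 u; lra.
  apply: (@le_trans _ _ (k * a + (Qn + c) * (k * a) + (k * a + e ^+ 2))).
    have -> : 2 * v * ((Qn + c) * u + e) = (Qn + c) * (2 * u * v) + 2 * v * e by ring.
    lra.
  rewrite (_ : _ + _ = (k * (1 + c + 1) + 1 + k * Qn) * (a + e ^+ 2)
    - k * (1 + c + 1 + Qn) * e ^+ 2 - a); last by ring.
  lra.
have g0 : g 0 = 0 by rewrite /g /q rint0 !mulr0 !addr0.
have gX : g x <= g X.
  have qq : q x <= q X by apply: rprim_rint_le => // [|y]; [exact: L1loc_mxN|exact: mxN_ge0].
  have h1 : k * (1 + c + 1) * x <= k * (1 + c + 1) * X by rewrite ler_wpM2l// mulr_ge0//; lra.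
  have h2 : k * q x <= k * q X by rewrite ler_wpM2l.
  rewrite /g; lra.
rewrite -(ler_pXn2r (n := 2))// ?nnegrE ?mxN_ge0 ?mulr_ge0 ?sqrtr_ge0//.
rewrite exprMn sqr_sqrtr// (le_trans (mxN_le_mxsq _))// -/k.
rewrite [leRHS](_ : _ = k * (expR (g X) * e ^+ 2)); last by rewrite /S; ring.
rewrite ler_wpM2l//; apply: (@le_trans _ _ (E x)).
  by rewrite /E; have := mxsq_ge0 (V x); have := sqr_ge0 e; lra.
apply: (le_trans h); rewrite /E U00 V00 xsq0 !add0r g0 subr0 mulrC ler_wpM2r ?sqr_ge0//.
by rewrite ler_expR.
Qed.

Lemma sol_unique Q z p (U V U' V' : R -> 'M[C]_(m, p)) : mxL1 Q ->
  sol Q z U V -> sol Q z U' V' -> U 0 = U' 0 -> V 0 = V' 0 ->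
  forall x, 0 <= x -> U x = U' x.
Proof.
move=> hQ [pU pV] [pU' pV'] E1 E2 x x0; apply/eqP; rewrite -subr_eq0; apply/eqP.
have x1 : 0 < x + 1 by lra.
have [K K0 HK] := sol_src_bound p hQ (N1_ge0 z) x1.
apply: mxN_eq0.
have := HK z (fun=> 0) (fun x => U x - U' x) (fun x => V x - V' x) 0 (lexx _) (lexx 0).
rewrite mulr0; apply.
- split; first exact: primB.
  apply: prim_eq (primB pV pV') => y _; rewrite addr0 mulmxBr scalerBr; exact: subBB.
- by rewrite E1 subrr.
- by rewrite E2 subrr.
- by move=> y _; rewrite mxN0.
- by rewrite x0 lerDl/=.
Qed.

Lemma sol_mulr Q z p q (U V : R -> 'M[C]_(m, p)) (A : 'M[C]_(p, q)) :
  sol Q z U V -> sol Q z (fun x => U x *m A) (fun x => V x *m A).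
Proof.
move=> [pU pV]; split; first exact: primMr.
by apply: prim_eq (primMr A pV) => x _; rewrite mulmxBl mulmxA scalemxAl.
Qed.

Lemma rint_mxN_le Q x y : mxL1 Q -> 0 <= x -> x <= y ->
  rint (fun t => mxN (Q t)) x <= rint (fun t => mxN (Q t)) y.
Proof. by move=> hQ x0 xy; apply: rprim_rint_le => // [|t]; [exact: L1loc_mxN|exact: mxN_ge0]. Qed.

Definition cexpx (w : C) (t : R) : C := cexp (w * t%:C%C).

Lemma cexpxN w t : cexpx w t * cexpx (- w) t = 1.
Proof. by rewrite /cexpx mulNr cexpN. Qed.

Lemma N1_cexpx2 w t t0 : N1 (cexpx w t * cexpx (- w) t0) <= 2 * expR (Re w * (t - t0)).
Proof.
rewrite /cexpx -cexpD (le_trans (N1_cexp _))// (_ : Re _ = Re w * (t - t0))//.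
by rewrite cReD !cReM /= cReN; ring.
Qed.

(* [exp (w (t - t0)) P t] has derivative [exp (w (t - t0)) Q t U t]. *)
Lemma transport Q p (P U : R -> 'M[C]_(m, p)) w x0 x t0 b s : mxL1 Q ->
  prim P (fun x => Q x *m U x - w *: P x) -> 0 <= x0 -> x0 <= x -> 0 <= b ->
  (forall t, x0 <= t <= x -> mxN (U t) * expR (Re w * (t - t0)) <= b * s) ->
  mxN ((cexpx w x * cexpx (- w) t0) *: P x - (cexpx w x0 * cexpx (- w) t0) *: P x0) <=
  2 * (b * s) * (rint (fun t => mxN (Q t)) x - rint (fun t => mxN (Q t)) x0).
Proof.
move=> hQ pP x00 x0x b0 H.
have pq : rprim (rint (fun t => mxN (Q t))) (fun t => mxN (Q t)).
  exact/rprim_integral/L1loc_mxN.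
have pc : cprim (fun t => cexpx w t * cexpx (- w) t0) (fun t => w * cexpx w t * cexpx (- w) t0).
  by apply: cprim_eq (cprimM (cprim_cexp w) (cprim_cst (cexpx (- w) t0))) => t _; rewrite mulr0 addr0.
have := prim_norm_le (primZ pc pP) (rprimZ (2 * (b * s)) pq) x00 x0x.
rewrite -mulrBr; apply; apply: ae_all => t /andP[xt tx].
have -> : (w * cexpx w t * cexpx (- w) t0) *: P t +
    (cexpx w t * cexpx (- w) t0) *: (Q t *m U t - w *: P t) =
    (cexpx w t * cexpx (- w) t0) *: (Q t *m U t).
  rewrite scalerBr scalerA addrCA -[RHS]addr0; congr (_ + _); rewrite -scaleNr -scalerDl.
  by rewrite (_ : _ + _ = 0) ?scale0r//; ring.
apply: (le_trans (mxNZ _ _)).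
apply: (@le_trans _ _ (2 * expR (Re w * (t - t0)) * (mxN (Q t) * mxN (U t)))).
  by apply: ler_pM; rewrite ?N1_ge0 ?mxN_ge0 ?N1_cexpx2 ?mxNM.
have {}H : mxN (U t) * expR (Re w * (t - t0)) <= b * s by apply: H; rewrite !ltW.
have := ler_wpM2l (mxN_ge0 (Q t)) H; lra.
Qed.

End schrodinger_solutions.

(** * Solutions at high energy and their dependence on z *)

Section high_energy_bounds.
Variables (R : realType) (m : nat).
Local Notation C := R[i].
Local Notation Re := complex.Re.
Local Notation Im := complex.Im.
Implicit Types Q : R -> 'M[C]_m.

(** 2 B0 is the fixed point of b -> B0 + b / 2. Any a priori bound [B], however bad, starts the
    iteration and leaves no trace in the result. *)
Lemma halving (P : R -> Prop) (f : R -> R) (B0 B : R) : 0 <= B0 -> 0 <= B ->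
  (forall t, P t -> f t <= B) ->
  (forall b, 0 <= b -> (forall t, P t -> f t <= b) -> forall t, P t -> f t <= B0 + b / 2) ->
  forall t, P t -> f t <= 2 * B0.
Proof.
move=> B00 B_0 HB H t Pt; rewrite -subr_le0; apply: (@le0_geometric _ _ B) => k.
rewrite lerBlDl; elim: k t Pt => [|k IH] t Pt.
  by rewrite expr0 divr1 (le_trans (HB _ Pt))// lerDr; lra.
have h0 : 0 <= B / 2 ^+ k by rewrite divr_ge0// exprn_ge0.
have := H (2 * B0 + B / 2 ^+ k) _ IH t Pt.
rewrite exprS invfM => h; apply: (le_trans (h _)); lra.
Qed.

Definition imag : C := (0 +i* 1)%C.

Lemma sqr_imag (k : C) : (imag * k) * (imag * k) = - (k ^+ 2).
Proof. by apply: complex_eqP; rewrite ?(cReN, cImN) expr2 !(cReM, cImM) /=; ring. Qed.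

Lemma Re_imag k : Re (imag * k) = - Im k. Proof. by rewrite cReM /=; ring. Qed.
Lemma Im_imag k : Im (imag * k) = Re k. Proof. by rewrite cImM /=; ring. Qed.

Lemma N1_imag k : N1 (imag * k) = N1 k.
Proof. by rewrite /N1 Re_imag Im_imag normrN addrC. Qed.

(** Factorisation of d^2/dx^2 + k^2 as (d/dx + w)(d/dx - w), used with w = i k and w = - i k: each
    factor leaves a first-order equation forced by Q U. *)
Lemma sol_char Q k p (U V : R -> 'M[C]_(m, p)) w : w * w = - (k ^+ 2) ->
  sol Q (k ^+ 2) U V ->
  prim (fun x => V x - w *: U x) (fun x => Q x *m U x - w *: (V x - w *: U x)).
Proof.
move=> ww [pU pV]; apply: prim_eq (primB pV (primZc w pU)) => x _.
by rewrite scalerBr scalerA ww scaleNr opprB addrA.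
Qed.

Lemma transport_growth Q X p (P U : R -> 'M[C]_(m, p)) w x0 x b s : mxL1 Q ->
  prim P (fun x => Q x *m U x - w *: P x) -> `|Re w| <= s ->
  0 <= x0 -> x0 <= x -> x <= X -> 0 <= b ->
  (forall t, x0 <= t <= x -> mxN (U t) <= b * expR (s * (t - x0))) ->
  mxN (P x) <= 2 * expR (s * (x - x0)) * (mxN (P x0) + b * rint (fun t => mxN (Q t)) X).
Proof.
move=> hQ pP ws x00 x0x xX b0 H; set e := expR (s * (x - x0)).
have e0 : 0 <= e by exact: expR_ge0.
have wle (t : R) : t <= x -> Re w * (t - x) <= s * (x - t).
  move=> tx; rewrite -[Re w * _]opprK -mulrN opprB -mulNr ler_wpM2r ?subr_ge0//.
  by rewrite (le_trans _ ws)// -normrN ler_norm.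
have := transport (t0 := x) (s := e) hQ pP x00 x0x b0.
rewrite cexpxN scale1r => h.
have {}h : mxN (P x - (cexpx w x0 * cexpx (- w) x) *: P x0) <=
    2 * (b * e) * (rint (fun t => mxN (Q t)) x - rint (fun t => mxN (Q t)) x0).
  apply: h => t /andP[x0t tx]; have h := H t; rewrite x0t tx in h.
  apply: (le_trans (ler_wpM2r (expR_ge0 _) (h isT))).
  rewrite -mulrA -expRD ler_wpM2l// ler_expR.
  by have := wle _ tx; rewrite !mulrBr; lra.
have qx0 : 0 <= rint (fun t => mxN (Q t)) x0 by rewrite -(rint0 (fun t => mxN (Q t))) rint_mxN_le.
have qX : rint (fun t => mxN (Q t)) x <= rint (fun t => mxN (Q t)) X.
  by rewrite rint_mxN_le// (le_trans x00).
have h2 : mxN ((cexpx w x0 * cexpx (- w) x) *: P x0) <= 2 * e * mxN (P x0).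
  rewrite (le_trans (mxNZ _ _))// ler_wpM2r ?mxN_ge0// (le_trans (N1_cexpx2 _ _ _))//.
  by rewrite ler_pM2l// ler_expR wle.
rewrite -[P x](subrK ((cexpx w x0 * cexpx (- w) x) *: P x0)).
apply: (le_trans (mxND _ _)); rewrite mulrDr addrC lerD// (le_trans h)//.
rewrite [leRHS](_ : _ = 2 * (b * e) * rint (fun t => mxN (Q t)) X); last by ring.
by rewrite ler_wpM2l ?mulr_ge0//; lra.
Qed.

(** U is recovered from V + w U and V - w U by a division by 2 w. The gain 1 / |k| makes the forcing
    by Q at most half of the bound being proved, and [halving] absorbs it; 8 is what this half
    costs. *)
Lemma sol_growth Q X k p (U V : R -> 'M[C]_(m, p)) x0 x : mxL1 Q -> 0 < X ->
  sol Q (k ^+ 2) U V -> 0 <= Im k -> 0 < N1 k -> 8 * rint (fun t => mxN (Q t)) X <= N1 k ->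
  0 <= x0 -> x0 <= x -> x <= X ->
  mxN (U x) <= 8 * (mxN (U x0) + mxN (V x0) / N1 k) * expR (Im k * (x - x0)).
Proof.
move=> hQ X0 hs k0 Nk qk x00 x0x xX; have [pU pV] := hs.
set w := imag * k; set qX := rint _ X in qk *.
have ww : w * w = - (k ^+ 2) by exact: sqr_imag.
have ww' : (- w) * (- w) = - (k ^+ 2) by rewrite mulrNN.
have pP := sol_char ww hs; have pPp := sol_char ww' hs.
have Nw : N1 w = N1 k by exact: N1_imag.
have w0 : w != 0 by apply/eqP => h; move: Nk; rewrite -Nw h N1_0 ltxx.
have qX0 : 0 <= qX by rewrite -(rint0 (fun t => mxN (Q t))) rint_mxN_le// ltW.
pose B0 := 4 * (mxN (U x0) + mxN (V x0) / N1 k).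
have B00 : 0 <= B0.
  by rewrite mulr_ge0// addr_ge0 ?mxN_ge0// divr_ge0 ?mxN_ge0// ltW.
have [B BB HB] := cprim_bound X0 pU.
pose D t := x0 <= t <= X.
suff : mxN (U x) * expR (- (Im k * (x - x0))) <= 2 * B0.
  rewrite expRN ler_pdivrMr ?expR_gt0// (_ : 2 * B0 = 8 * (mxN (U x0) + mxN (V x0) / N1 k))//.
  by rewrite /B0; ring.
apply: (@halving D (fun t => mxN (U t) * expR (- (Im k * (t - x0)))) B0 B) => //.
- move=> t /andP[x0t tX]; rewrite -[leRHS]mulr1 ler_pM ?mxN_ge0 ?expR_ge0//.
    by rewrite HB// tX (le_trans x00).
  by rewrite -expR0 ler_expR oppr_le0 mulr_ge0// subr_ge0.
- move=> b b0 Hb t /andP[x0t tX].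
  have Hb' u : x0 <= u <= t -> mxN (U u) <= b * expR (Im k * (u - x0)).
    move=> /andP[x0u ut]; have := Hb u; rewrite /D x0u (le_trans ut)// => /(_ isT).
    by rewrite expRN ler_pdivrMr ?expR_gt0.
  set e := expR (Im k * (t - x0)).
  have nw : `|Re w| <= Im k by rewrite Re_imag normrN ger0_norm.
  have nw' : `|Re (- w)| <= Im k by rewrite cReN normrN.
  have h1 := transport_growth hQ pP nw x00 x0t tX b0 Hb'.
  have h2 := transport_growth hQ pPp nw' x00 x0t tX b0 Hb'.
  rewrite -/e -/qX in h1 h2.
  have NP : mxN (V x0 - w *: U x0) <= mxN (V x0) + N1 k * mxN (U x0).
    by rewrite (le_trans (mxNB _ _))// lerD2l -Nw mxNZ.
  have NPp : mxN (V x0 - - w *: U x0) <= mxN (V x0) + N1 k * mxN (U x0).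
    by rewrite (le_trans (mxNB _ _))// lerD2l -Nw -(N1N w) mxNZ.
  have e0 : 0 < e by exact: expR_gt0.
  have E : U t = (2 * w)^-1 *: ((V t - - w *: U t) - (V t - w *: U t)).
    rewrite opprB addrC addrA subrK scaleNr opprK -scalerDl scalerA.
    rewrite (_ : w + w = 2 * w); last by ring.
    by rewrite mulVf ?scale1r// mulf_neq0// pnatr_eq0.
  have N2w : N1 (2 * w)^-1 <= (N1 k)^-1.
    have w20 : 2 * w != 0 by rewrite mulf_neq0// pnatr_eq0.
    rewrite (le_trans (N1_inv_le w20))// (_ : N1 (2 * w) = 2 * N1 k).
      by rewrite invfM mulrA mulfV ?mul1r// pnatr_eq0.
    rewrite -Nw /N1 (_ : 2 * w = w + w); last by ring.
    rewrite cReD cImD -!mulr2n !normrMn !mulr2n; ring.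
  have NU : mxN (U t) <= (N1 k)^-1 * (4 * e * (mxN (V x0) + N1 k * mxN (U x0) + b * qX)).
    rewrite E (le_trans (mxNZ _ _))// ler_pM ?N1_ge0 ?mxN_ge0//.
    apply: (le_trans (mxNB _ _)); apply: (le_trans (lerD h2 h1)).
    by move: (ler_wpM2l (ltW e0) NP) (ler_wpM2l (ltW e0) NPp); clear; lra.
  rewrite expRN ler_pdivrMr// -/e; apply: (le_trans NU).
  rewrite mulrC ler_pdivrMr// /B0.
  have -> : (4 * (mxN (U x0) + mxN (V x0) / N1 k) + b / 2) * e * N1 k =
      e * (4 * (mxN (V x0) + N1 k * mxN (U x0)) + b / 2 * N1 k).
    field; exact: lt0r_neq0.
  rewrite [leLHS](_ : _ = e * (4 * (mxN (V x0) + N1 k * mxN (U x0)) + b / 2 * (8 * qX))); last by field.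
  by rewrite ler_pM2l// lerD2l ler_wpM2l// divr_ge0.
- by rewrite /D x0x.
Qed.

Lemma LB_L1 p q (F : R -> 'M[C]_(p, q)) : mxLB F -> mxL1 F.
Proof.
have key (f : R -> R) : loc_bounded f -> L1loc_halfline f.
  move=> hf X X0; have := L1locM (@L1loc_cst R 1) hf X0.
  by rewrite [X in _.-integrable _ X -> _](_ : _ = EFin \o f)//; apply/funext => x; rewrite /= mul1r.
by move=> h i j; have [h1 h2] := h i j; split; exact: key.
Qed.

Lemma N1X (h : C) n : N1 (h ^+ n) <= N1 h ^+ n.
Proof.
elim: n => [|n IH]; first by rewrite !expr0 N1_1.
by rewrite !exprS (le_trans (N1M _ _))// ler_wpM2l ?N1_ge0.
Qed.

Lemma mxLBN p q (F : R -> 'M[C]_(p, q)) G : prim F G -> mxL1 (fun x => - F x).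
Proof. by move=> /primN/prim_LB/LB_L1. Qed.

(* The Taylor coefficients in z solve U1'' = (Q - z) U1 - U and U2'' = (Q - z) U2 - U1. *)
Lemma sol_taylor Q p z X (U0 V0 : 'M[C]_(m, p)) (UF VF : C -> R -> 'M[C]_(m, p)) :
  mxL1 Q -> 0 < X -> (forall w, sol Q w (UF w) (VF w)) ->
  (forall w, UF w 0 = U0) -> (forall w, VF w 0 = V0) ->
  exists U1 U2 : R -> 'M[C]_(m, p), exists K : R, forall h, N1 h <= 1 ->
    forall x, 0 <= x <= X ->
    mxN (UF (z + h) x - UF z x - h *: U1 x - h ^+ 2 *: U2 x) <= K * N1 h ^+ 3.
Proof.
move=> hQ X0 hs hU hV; have [pUz pVz] := hs z.
have [U1 [V1 [[pU1 pV1] U10 V10]]] := sol_src_exists z 0 0 hQ (mxLBN pUz).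
have [U2 [V2 [[pU2 pV2] U20 V20]]] := sol_src_exists z 0 0 hQ (mxLBN pU1).
have [M M0 HM] := cprim_bound X0 pU2.
have c0 : 0 <= N1 z + 1 by rewrite addr_ge0 ?N1_ge0.
have [K K0 HK] := sol_src_bound p hQ c0 X0.
exists U1, U2, (K * M) => h h1 x xX; have [pUh pVh] := hs (z + h).
have -> : K * M * N1 h ^+ 3 = K * (N1 h ^+ 3 * M) by ring.
have pR := primB (primB (primB pUh pUz) (primZc h pU1)) (primZc (h ^+ 2) pU2).
have pS := primB (primB (primB pVh pVz) (primZc h pV1)) (primZc (h ^+ 2) pV2).
(* The remainder solves the equation at z + h with zero Cauchy data and source - h^3 U2, so its size
   is that of the source. *)
apply: (HK (z + h) (fun x => - h ^+ 3 *: U2 x) _ _ _ _ _ (conj pR _)) => //.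
- by rewrite (le_trans (N1D _ _))// lerD2l.
- by rewrite mulr_ge0// exprn_ge0// N1_ge0.
- apply: prim_eq pS => y _; rewrite !mulmxBr -!scalemxAr.
  move: (Q y *m UF (z + h) y) (Q y *m UF z y) (Q y *m U1 y) (Q y *m U2 y) => A B D E.
  by apply/matrixP => i j; rewrite !mxE; ring.
- by rewrite hU hU U10 U20 !scaler0 subrr !subr0.
- by rewrite hV hV V10 V20 !scaler0 subrr !subr0.
- move=> y yX; rewrite scaleNr mxNN (le_trans (mxNZ _ _))// ler_pM ?N1_ge0 ?mxN_ge0 ?N1X//.
  exact: HM.
Qed.

End high_energy_bounds.

(** * Flux and decay of Weyl solutions *)

Section weyl_bounds.
Variables (R : realType) (m : nat).
Local Notation C := R[i].
Local Notation Re := complex.Re.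
Local Notation Im := complex.Im.
Implicit Types (Q : R -> 'M[C]_m) (U V : R -> 'cV[C]_m).

Definition hermitian_ae Q := ae_halfline (fun x => Q x = adj (Q x)).

Definition flux (u v : 'cV[C]_m) : R := Im ((adj u *m v) 0 0).

Lemma Im_hermitian (S : 'M[C]_1) : adj S = S -> Im (S 0 0) = 0.
Proof. by move=> /matrixP/(_ 0 0); rewrite adjE => h; have := congr1 (@complex.Im R) h; rewrite cImJ; lra. Qed.

Lemma adj_self (u : 'cV[C]_m) : (adj u *m u) 0 0 = (mxsq u)%:C%C.
Proof.
rewrite mxE; apply: complex_eqP; rewrite ?cRe_sum ?cIm_sum /=.
  apply: eq_bigr => i _; rewrite big_ord_recl big_ord0 addr0 adjE cReM cReJ cImJ /sq; ring.
by rewrite big1// => i _; rewrite adjE cImM cReJ cImJ; ring.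
Qed.

(** In the derivative of U^* V the terms V^* V and U^* Q U are real, so only - z U^* U contributes
    an imaginary part. *)
Lemma flux_prim Q z U V : hermitian_ae Q -> sol Q z U V ->
  rprim (fun x => flux (U x) (V x)) (fun x => - Im z * mxsq (U x)).
Proof.
move=> hQ [pU pV]; have [_ h] := primM (prim_adj pU) pV 0 0.
apply: rprim_ae h; apply: ae_imply hQ => x H /ltW/H {}H.
rewrite mxE cImD adj_self /= add0r mulmxBr mxE cImD -scalemxAr [in X in _ + X]mxE.
rewrite [X in _ + Im (- X)]mxE adj_self cImN cImM /= mulr0 add0r.
rewrite mulmxA Im_hermitian; first by ring.
by rewrite !adjM adjK -H mulmxA.
Qed.

Lemma flux_le (u v : 'cV[C]_m) : `|flux u v| <= mxN u * mxN v.
Proof.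
apply: (@le_trans _ _ (N1 ((adj u *m v) 0 0))); first by rewrite /N1 lerDr.
by rewrite (le_trans (N1_le_mxN _ _ _))// (le_trans (mxNM _ _))// mxN_adj.
Qed.

(** Lets exp (Im k), quadratic at least, dominate the linear quantities in |k| that arise in the
    growth argument. *)
Lemma sqr4_le_expR (y : R) : 0 <= y -> y ^+ 2 / 4 <= expR y.
Proof.
move=> y0; rewrite (_ : y = y / 2 + y / 2) ?expRD; last by field.
have h := expR_ge1Dx (y / 2); have : (1 + y / 2) ^+ 2 <= expR (y / 2) * expR (y / 2).
  by rewrite expr2 ler_pM//; lra.
by have := sqr_ge0 y; rewrite (_ : (y / 2 + y / 2) ^+ 2 = y ^+ 2); [|by field]; rewrite sqrrD; lra.
Qed.

Lemma rint_mxN_sub Q X x t : mxL1 Q -> 0 <= x -> 0 <= t -> t <= X ->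
  rint (fun y => mxN (Q y)) t - rint (fun y => mxN (Q y)) x <= rint (fun y => mxN (Q y)) X.
Proof.
move=> hQ x0 t0 tX.
have h1 : rint (fun y => mxN (Q y)) t <= rint (fun y => mxN (Q y)) X by exact: rint_mxN_le.
have h2 : 0 <= rint (fun y => mxN (Q y)) x.
  by rewrite -(rint0 (fun y => mxN (Q y))) rint_mxN_le.
by move: h1 h2; clear; lra.
Qed.

(* If p = U' - i k U is much larger than U at x0, then |U| grows like e^(Im k (x - x0)) / |k|. *)
Lemma growth_lower Q X k U V x0 t : mxL1 Q -> 0 < X -> sol Q (k ^+ 2) U V ->
  let q := rint (fun y => mxN (Q y)) X in
  let w := imag R * k in
  let p := mxN (V x0 - w *: U x0) in
  0 < Im k -> 384 * q <= N1 k -> 0 < N1 k -> 16 <= expR (Im k) -> 8 * N1 k <= expR (Im k) ->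
  0 <= x0 -> x0 + 1 / 2 <= t -> t <= x0 + 1 -> t <= X ->
  4 * (1 + 96 * q) * mxN (U x0) < p ->
  p * expR (Im k / 2) <= 16 * N1 k * mxN (U t).
Proof.
move=> hQ X0 hs q w p sg0 R1 Nk0 e16 eN x00 x0t tx0 tX big.
have q0 : 0 <= q by rewrite -(rint0 (fun y => mxN (Q y))) rint_mxN_le// ltW.
have [pU pV] := hs; set sg := Im k in sg0 e16 eN *.
have ww : w * w = - (k ^+ 2) by exact: sqr_imag.
have ww' : (- w) * (- w) = - (k ^+ 2) by rewrite mulrNN.
have pP := sol_char ww hs; have pPp := sol_char ww' hs.
have Nw : N1 w = N1 k by exact: N1_imag.
have Rw : Re w = - sg by exact: Re_imag.
have x0t' : x0 <= t by move: x0t; clear; lra.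
have t0 : 0 <= t by exact: le_trans x0t'.
have dq : rint (fun y => mxN (Q y)) t - rint (fun y => mxN (Q y)) x0 <= q by exact: rint_mxN_sub.
set u := mxN (U x0) in big *.
have u0 : 0 <= u by exact: mxN_ge0.
have p0 : 0 <= p by exact: mxN_ge0.
have NV : mxN (V x0) <= p + N1 k * u.
  by rewrite -[V x0](subrK (w *: U x0)) (le_trans (mxND _ _))// lerD2l -Nw mxNZ.
(* The a priori growth constant: 8 (u + |V x0| / |k|) from [sol_growth], with |V x0| <= p + |k|
   u. *)
have [S SE] : exists S : R, S = 16 * (u + p / N1 k) by eexists.
have pN0 : 0 <= p / N1 k by rewrite divr_ge0// ltW.
have S0 : 0 <= S by rewrite SE mulr_ge0// addr_ge0.
have qN : 8 * q <= N1 k by move: R1 q0; clear; lra.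
have growth y : x0 <= y <= t -> mxN (U y) <= S * expR (sg * (y - x0)).
  move=> /andP[x0y yt]; have yX : y <= X by rewrite (le_trans yt).
  have := sol_growth hQ X0 hs (ltW sg0) Nk0 qN x00 x0y yX.
  move=> /le_trans; apply; rewrite ler_wpM2r ?expR_ge0//.
  have h : mxN (V x0) / N1 k <= u + p / N1 k.
    by rewrite ler_pdivrMr// mulrDl divfK ?lt0r_neq0// [u * _]mulrC addrC.
  by move: h pN0; rewrite SE -/u; clear; lra.
pose f := expR (sg * (t - x0)); have f0 : 0 < f by exact: expR_gt0.
have fV : expR (- (sg * (t - x0))) = f^-1 by rewrite expRN.
have f'0 : 0 < f^-1 by rewrite invr_gt0.
set cc := cexpx w t * cexpx (- w) x0.
have hF : mxN (cc *: (V t - w *: U t) - (V x0 - w *: U x0)) <= 2 * S * q.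
  have := transport (t0 := x0) (s := 1) hQ pP x00 x0t' S0; rewrite cexpxN scale1r mulr1.
  move=> h; apply: (le_trans (h _)).
    move=> y yt; apply: (le_trans (ler_wpM2r (expR_ge0 _) (growth y yt))).
    by rewrite -mulrA -expRD Rw mulNr subrr expR0 mulr1.
  by rewrite ler_wpM2l// mulr_ge0.
have Ncc : N1 cc <= 2 * f^-1.
  by rewrite (le_trans (N1_cexpx2 _ _ _))// Rw mulNr fV.
have sht : sg / 2 <= sg * (t - x0).
  by rewrite ler_pM2l//; move: x0t; clear; lra.
have fe : expR (sg / 2) <= f by rewrite ler_expR.
have hPp : mxN (V t - - w *: U t) <= 2 * f^-1 * (p + 2 * N1 k * u) + 2 * S * f * q.
  have nw' : Re (- w) = sg by rewrite cReN Rw opprK.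
  have := transport (t0 := t) (s := f) hQ pPp x00 x0t' S0; rewrite cexpxN scale1r => h.
  have {}h : mxN (V t - - w *: U t - (cexpx (- w) x0 * cexpx (- - w) t) *: (V x0 - - w *: U x0)) <=
      2 * S * f * q.
    apply: (le_trans (h _)).
      move=> y /andP[x0y yt]; have {}growth := growth y; rewrite x0y yt in growth.
      apply: (le_trans (ler_wpM2r (expR_ge0 _) (growth isT))).
      rewrite -mulrA -expRD ler_wpM2l// ler_expR nw' -mulrDr (ler_pM2l sg0).
      by move: yt; clear; lra.
    have Sf : 0 <= 2 * S * f by rewrite !mulr_ge0// ltW.
    by rewrite mulrA ler_wpM2l.
  rewrite -[V t - _](subrK ((cexpx (- w) x0 * cexpx (- - w) t) *: (V x0 - - w *: U x0))).
  apply: (le_trans (mxND _ _)); rewrite addrC lerD//.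
  rewrite (le_trans (mxNZ _ _))// ler_pM ?N1_ge0 ?mxN_ge0//.
    by rewrite (le_trans (N1_cexpx2 _ _ _))// nw' -fV -mulrN opprB.
  rewrite (le_trans (mxNB _ _))// (_ : p + 2 * N1 k * u = (p + N1 k * u) + N1 k * u); last by ring.
  by rewrite lerD// (le_trans (mxNZ _ _))// N1N Nw.
have ff : f^-1 * f^-1 <= (expR sg)^-1.
  have finv : f^-1 <= (expR (sg / 2))^-1 by rewrite lef_pV2// posrE expR_gt0.
  have -> : (expR sg)^-1 = (expR (sg / 2))^-1 * (expR (sg / 2))^-1.
    by rewrite -invfM -expRD; congr (expR _)^-1; field.
  by rewrite ler_pM// ltW.
(* Transported back to x0, V - w U nearly reproduces its initial value, while V + w U becomes
   negligible there; so the difference 2 w U must carry the growth. *)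
have split : V x0 - w *: U x0 = cc *: (V t - - w *: U t) - (2 * w * cc) *: U t -
   (cc *: (V t - w *: U t) - (V x0 - w *: U x0)).
  by apply/matrixP => i j; rewrite !mxE; ring.
set e' := (expR sg)^-1 in ff.
have e0 : 0 < expR sg by exact: expR_gt0.
have T1 : mxN (cc *: (V t - - w *: U t)) <= 4 * e' * (p + 2 * N1 k * u) + 4 * S * q.
  apply: (le_trans (mxNZ _ _)).
  apply: (le_trans (ler_pM (N1_ge0 _) (mxN_ge0 _) Ncc hPp)).
  have pu : 0 <= p + 2 * N1 k * u by rewrite addr_ge0// !mulr_ge0// ltW.
  have h := ler_wpM2r pu ff.
  rewrite [leLHS](_ : _ = 4 * (f^-1 * f^-1 * (p + 2 * N1 k * u)) + 4 * S * q * (f^-1 * f)); last by ring.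
  by rewrite mulVf ?lt0r_neq0// mulr1; move: h; clear; lra.
have T2 : mxN ((2 * w * cc) *: U t) <= 4 * N1 k * f^-1 * mxN (U t).
  apply: (le_trans (mxNZ _ _)); rewrite ler_wpM2r ?mxN_ge0//.
  rewrite (le_trans (N1M _ _))// (_ : 4 * N1 k * f^-1 = 2 * N1 k * (2 * f^-1)); last by ring.
  rewrite ler_pM ?N1_ge0// (le_trans (N1M _ _))// Nw ler_wpM2r ?N1_ge0//.
  rewrite (_ : 2 = (2%:R)%:C%C) ?N1_real ?ger0_norm//.
  by rewrite rmorph_nat.
have T : p <= 4 * e' * (p + 2 * N1 k * u) + 6 * S * q + 4 * N1 k * f^-1 * mxN (U t).
  rewrite /p {1}split (le_trans (mxNB _ _))//.
  have := mxNB (cc *: (V t - - w *: U t)) ((2 * w * cc) *: U t).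
  by rewrite -/p; move: T1 T2 hF; clear; lra.
(* The errors 4 e' p, 96 (q / |k|) p and (1 + 96 q) u take at most p / 4 each, the last one by
   [big]; p / 4 is left for U t. Hence the thresholds 16, 8 |k|, 384 q = 4 * 96 q and the constant 4
   (1 + 96 q). *)
have e1 : e' <= 16^-1 by rewrite lef_pV2// posrE.
have e2 : 8 * N1 k * e' <= 1 by rewrite ler_pdivrMr// mul1r.
have e3 : 96 * q / N1 k <= 1 / 4 by rewrite ler_pdivrMr//; move: R1; clear; lra.
have t1 := ler_wpM2r p0 e1; have t2 := ler_wpM2r u0 e2; have t3 := ler_wpM2r p0 e3.
have T' : p / 4 <= 4 * N1 k * f^-1 * mxN (U t).
  move: T big; rewrite SE.
  rewrite (_ : 6 * (16 * (u + p / N1 k)) * q = 96 * q * u + 96 * q / N1 k * p); last by ring.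
  rewrite (_ : 4 * e' * (p + 2 * N1 k * u) = 4 * (e' * p) + 8 * N1 k * e' * u); last by ring.
  by move: t1 t2 t3; clear; lra.
have : p * f <= 16 * N1 k * mxN (U t).
  by rewrite -ler_pdivlMr//; move: T'; clear; lra.
by apply: le_trans; rewrite ler_wpM2l.
Qed.

(* Fast growth on [x0 + 1/2, x0 + 1] contradicts the bound that the decreasing flux imposes on
   the integral of |U|^2. *)
Lemma weyl_dominated Q (X c s : R) : mxL1 Q -> hermitian_ae Q -> 0 < X -> c != 0 -> 0 < s ->
  exists L K : R, 0 <= L /\ forall r, K <= r -> forall U V, let k := (r * c +i* (r * s))%C in
  sol Q (k ^+ 2) U V -> (forall x, 0 <= x -> 0 <= c * flux (U x) (V x)) ->
  forall x0, 0 <= x0 <= X -> mxN (V x0 - (imag R * k) *: U x0) <= L * mxN (U x0).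
Proof.
move=> hQ hH X0 c0 s0; have X1 : 0 < X + 1 by rewrite addr_gt0.
pose q := rint (fun t => mxN (Q t)) (X + 1).
have q0 : 0 <= q by rewrite -(rint0 (fun t => mxN (Q t))) rint_mxN_le// ltW.
pose nu : R := `|c| + s; have c1 : 0 < `|c| by rewrite normr_gt0.
have nu0 : 0 < nu by rewrite addr_gt0.
pose k2 : R := 2 * (m * 1)%:R ^+ 2 + 1.
have k20 : 0 < k2 by rewrite ltr_wpDl// mulr_ge0// exprn_ge0.
pose A : R := 256 * nu ^+ 2 * k2 / (`|c| * s).
have A0 : 0 < A.
  apply: divr_gt0; last exact: mulr_gt0.
  have h256 : 0 < 256 :> R by rewrite ltr0n.
  exact: mulr_gt0 (mulr_gt0 h256 (exprn_gt0 2 nu0)) k20.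
pose L := 4 * (1 + 96 * q).
have L1 : 1 <= L by move: q0; rewrite /L; clear; lra.
have s20 : 0 < s ^+ 2 by rewrite exprn_gt0.
(* The second to fourth bounds give 384 q <= |k|, 16 <= e and 8 |k| <= e for [growth_lower], the
   last two through e^y >= y^2 / 4; the fifth makes e exceed A (1 + r nu). *)
have [K HK] : exists K : R, forall r, K <= r -> [/\ 1 < r, 384 * q / nu <= r, 8 / s <= r,
    32 * nu / s ^+ 2 <= r & 4 * A * (1 + nu) / s ^+ 2 < r].
  exists (Num.max 2 (Num.max (384 * q / nu) (Num.max (8 / s) (Num.max (32 * nu / s ^+ 2)
    (4 * A * (1 + nu) / s ^+ 2 + 1))))) => r; rewrite !ge_max => /and5P[h1 h2 h3 h4 h5].
  by split => //; [apply: lt_le_trans h1; rewrite ltr1n|apply: lt_le_trans h5; rewrite ltrDl].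
exists L, K; split; first by rewrite (le_trans _ L1).
move=> r /HK[r1 R1 R2 R3 R4] U V k hs hJ x0 /andP[x00 x0X].
have r0 : 0 < r by exact: lt_trans r1.
rewrite ler_pdivrMr// in R1; rewrite ler_pdivrMr// in R2; rewrite ler_pdivrMr// in R3.
rewrite ltr_pdivrMr// in R4.
have [sg sgE'] : exists sg, sg = r * s by eexists.
have Ik : Im k = sg by rewrite sgE'.
have sg0 : 0 < sg by rewrite sgE' mulr_gt0.
have Nk : N1 k = r * nu.
  by rewrite /N1 /k /= !normrM (gtr0_norm r0) (gtr0_norm s0) /nu mulrDr.
have Nk0 : 0 < N1 k by rewrite Nk mulr_gt0.
have [e eE] : exists e, e = expR sg by eexists.
have e0 : 0 < e by rewrite eE expR_gt0.
have sgE : sg ^+ 2 = r * (r * s ^+ 2) by rewrite sgE' exprMn expr2 mulrA.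
have esq : r * (r * s ^+ 2) / 4 <= e by rewrite -sgE eE; apply: sqr4_le_expR; exact: ltW.
have e16 : 16 <= e.
  have : 8 * 8 <= sg * sg by rewrite sgE' ler_pM.
  by move: esq; rewrite -sgE expr2; clear; lra.
have eN : 8 * N1 k <= e.
  by rewrite Nk; have := ler_wpM2l (ltW r0) R3; move: esq; clear; lra.
have eA : A * (1 + r * nu) < e.
  have h1 : r * (4 * A * (1 + nu)) < r * (r * s ^+ 2) by rewrite ltr_pM2l.
  have h2 : A * (1 + r * nu) <= A * (r + r * nu) by rewrite (ler_wpM2l (ltW A0))// lerD2r ltW.
  by move: h1 h2 esq; clear; lra.
set w := imag R * k.
set u := mxN (U x0); set p := mxN (V x0 - w *: U x0).
have u0 : 0 <= u by exact: mxN_ge0.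
have p0 : 0 <= p by exact: mxN_ge0.
have NV : mxN (V x0) <= p + N1 k * u.
  by rewrite -[V x0](subrK (w *: U x0)) (le_trans (mxND _ _))// lerD2l -(N1_imag k) mxNZ.
rewrite leNgt; apply/negP => big.
have lower t : x0 + 1 / 2 <= t <= x0 + 1 -> p * expR (sg / 2) <= 16 * N1 k * mxN (U t).
  move=> /andP[h1 h2]; have tX : t <= X + 1 by rewrite (le_trans h2)// lerD2r.
  rewrite -Ik; apply: (growth_lower hQ X1 hs) => //; rewrite ?Ik -?eE//.
  by rewrite Nk.
have p1 : 0 < p by apply: le_lt_trans big; rewrite mulr_ge0// (le_trans _ L1).
have [e1 e1E] : exists e1, e1 = p ^+ 2 * e / (256 * N1 k ^+ 2 * k2) by eexists.
have N20 : 0 < N1 k ^+ 2 by rewrite exprn_gt0.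
have lower2 t : x0 + 1 / 2 <= t <= x0 + 1 -> e1 <= mxsq (U t).
  move=> /lower h; rewrite e1E ler_pdivrMr ?mulr_gt0//.
  have h3 : (p * expR (sg / 2)) ^+ 2 <= (16 * N1 k * mxN (U t)) ^+ 2.
    by rewrite ler_pXn2r// ?nnegrE ?mulr_ge0 ?expR_ge0 ?mxN_ge0// ltW.
  have h4 : (p * expR (sg / 2)) ^+ 2 = p ^+ 2 * e.
    by rewrite exprMn eE; congr (_ * _); rewrite expr2 -expRD; congr expR; field.
  have h2 : mxN (U t) ^+ 2 <= k2 * mxsq (U t).
    rewrite /k2; have := mxN_le_mxsq (U t); have := mxsq_ge0 (U t); clear; lra.
  by have := ler_wpM2l (ltW N20) h2; move: h3; rewrite h4; clear; lra.
(* As Im (k^2) = 2 r^2 c s, the factor [c] makes [J] nonincreasing for either sign of [c]. *)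
pose J t := c * flux (U t) (V t).
have [B BE] : exists B, B = c ^+ 2 * s * r ^+ 2 by eexists.
have B0 : 0 <= B.
  by rewrite BE; apply: mulr_ge0; [apply: mulr_ge0; [exact: sqr_ge0|exact: ltW]|exact: sqr_ge0].
have pJ : rprim J (fun t => - (2 * B) * mxsq (U t)).
  apply: rprim_eq (rprimZ c (flux_prim hH hs)) => t _.
  by rewrite BE expr2 cImM /k /=; ring.
have J1 : J (x0 + 1 / 2) <= J x0.
  have h : x0 <= x0 + 1 / 2 by clear; lra.
  have := rprim_le (rprimN pJ) x00 h; rewrite lerN2; apply; apply: ae_all => t _.
  by rewrite mulNr opprK !mulr_ge0// mxsq_ge0.
have J2 : J (x0 + 1) <= J (x0 + 1 / 2) - B * e1.
  have h : x0 + 1 / 2 <= x0 + 1 by clear; lra.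
  have h' : 0 <= x0 + 1 / 2 by move: x00; clear; lra.
  have := rprim_le (rprimB (rprimN pJ) (rprimZ (2 * B * e1) (rprim_id R))) h' h.
  move=> H; have {}H : - J (x0 + 1 / 2) - 2 * B * e1 * (x0 + 1 / 2) <=
     - J (x0 + 1) - 2 * B * e1 * (x0 + 1).
    apply: H; apply: ae_all => t /andP[h1 h2].
    rewrite mulNr opprK mulr1 -mulrBr !mulr_ge0// subr_ge0.
    by apply: lower2; rewrite (ltW h1) (ltW h2).
  by move: H; clear; lra.
have J3 : 0 <= J (x0 + 1) by apply: hJ; rewrite addr_ge0.
have J4 : J x0 <= `|c| * ((1 + N1 k) * p ^+ 2).
  rewrite /J (le_trans (ler_norm _))// normrM ler_wpM2l// (le_trans (flux_le _ _))//.
  have up : u <= p.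
    have h : 1 * u <= L * u by rewrite ler_wpM2r.
    by rewrite mul1r in h; apply: (le_trans h); exact: ltW.
  rewrite -/u (_ : (1 + N1 k) * p ^+ 2 = p * (p + N1 k * p)); last by ring.
  by rewrite ler_pM ?mxN_ge0// (le_trans NV)// lerD2l (ler_wpM2l (ltW Nk0)).
(* [J] drops by at least B e1 over [x0 + 1/2, x0 + 1] and stays nonnegative. After division by |c|
   p^2 this says e <= A (1 + r nu), against [eA]. *)
have fin : B * e1 <= `|c| * ((1 + N1 k) * p ^+ 2) by move: J1 J2 J3 J4; clear; lra.
have p20 : 0 < p ^+ 2 by rewrite exprn_gt0.
move: fin; rewrite BE e1E -(real_normK (num_real c)) Nk.
have -> : `|c| ^+ 2 * s * r ^+ 2 * (p ^+ 2 * e / (256 * (r * nu) ^+ 2 * k2)) =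
   `|c| * p ^+ 2 * (e / A).
  by rewrite /A; field; rewrite !lt0r_neq0.
have -> : `|c| * ((1 + r * nu) * p ^+ 2) = `|c| * p ^+ 2 * (1 + r * nu) by ring.
rewrite ler_pM2l ?mulr_gt0// ler_pdivrMr// mulrC => h.
by move: eA; rewrite ltNge h.
Qed.

(** Writing B = w A + (B - w A) isolates the exact rate 2 Re w from an error controlled by B - w
    A. *)
Lemma mxsq_dot p q w (A B : 'M[C]_(p, q)) :
  \sum_i \sum_j 2 * (Re (A i j) * Re (B i j) + Im (A i j) * Im (B i j)) <=
  2 * Re w * mxsq A + 2 * mxN A * mxN (B - w *: A).
Proof.
have -> : \sum_i \sum_j 2 * (Re (A i j) * Re (B i j) + Im (A i j) * Im (B i j)) =
  2 * Re w * mxsq A + \sum_i \sum_j 2 *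
    (Re (A i j) * Re ((B - w *: A) i j) + Im (A i j) * Im ((B - w *: A) i j)).
  rewrite /mxsq mulr_sumr -big_split; apply: eq_bigr => i _ /=.
  rewrite mulr_sumr -big_split; apply: eq_bigr => j _ /=.
  by rewrite !mxE !(cReD, cImD, cReN, cImN, cReM, cImM) /sq; ring.
by rewrite lerD2l mxsq_deriv_le.
Qed.

(** Gronwall for |U|^2 with U' = w U + error: on [0, X] the error costs only a bounded factor, so
    [D] is independent of w and the rate Re w = - Im k survives. *)
Lemma dominated_decay (L X : R) : 0 <= L -> 0 < X -> exists2 D, 0 <= D &
  forall U V w, prim U V ->
  (forall x, 0 <= x <= X -> mxN (V x - w *: U x) <= L * mxN (U x)) ->
  forall x, 0 <= x <= X -> mxN (U x) <= D * expR (Re w * x) * mxN (U 0).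
Proof.
move=> L0 X0; pose k2 : R := 2 * (m * 1)%:R ^+ 2.
have k20 : 0 <= k2 by rewrite mulr_ge0// exprn_ge0.
pose S := k2 * expR (2 * L * k2 * X).
have S0 : 0 <= S by rewrite mulr_ge0// expR_ge0.
exists (Num.sqrt S); first exact: sqrtr_ge0.
move=> U V w pU H x /andP[x0 xX].
have := gronwall (rprim_mxsq pU) (rprimZ (2 * Re w + 2 * L * k2) (rprim_id R)) (lexx 0) x0.
move=> h; have {}h : mxsq (U x) <= mxsq (U 0) * expR ((2 * Re w + 2 * L * k2) * x).
  rewrite -[X in expR X]subr0 -[X in _ - X](mulr0 (2 * Re w + 2 * L * k2)).
  apply: h; apply: ae_all => y /andP[y0 yx].
  apply: (@le_trans _ _ (2 * Re w * mxsq (U y) + 2 * mxN (U y) * mxN (V y - w *: U y))).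
    exact: mxsq_dot.
  rewrite mulr1 [leRHS]mulrDl lerD2l.
  have yX : 0 <= y <= X by rewrite (ltW y0) (le_trans (ltW yx)).
  have h1 := ler_wpM2l (mxN_ge0 (U y)) (H y yX).
  have h2 := ler_wpM2l L0 (mxN_le_mxsq (U y)).
  by rewrite -/k2 in h2; move: h1 h2; clear; lra.
rewrite -(ler_pXn2r (n := 2))// ?nnegrE ?mxN_ge0 ?mulr_ge0 ?sqrtr_ge0 ?expR_ge0 ?mxN_ge0//.
rewrite !exprMn sqr_sqrtr// (le_trans (mxN_le_mxsq _))// -/k2.
have h2 : mxsq (U 0) * expR ((2 * Re w + 2 * L * k2) * x) <=
    mxN (U 0) ^+ 2 * (expR (2 * L * k2 * X) * expR (Re w * x) ^+ 2).
  apply: ler_pM; rewrite ?mxsq_ge0 ?expR_ge0 ?mxsq_le_mxN//.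
  rewrite expr2 -!expRD ler_expR.
  have : 2 * L * k2 * x <= 2 * L * k2 * X by rewrite ler_wpM2l// !mulr_ge0.
  lra.
rewrite [leRHS](_ : _ = k2 * (mxN (U 0) ^+ 2 * (expR (2 * L * k2 * X) * expR (Re w * x) ^+ 2))); last by rewrite /S; ring.
by rewrite ler_wpM2l// (le_trans h).
Qed.

End weyl_bounds.

(** * Integrals over the half-line *)

Section boundary_form.
Variables (R : realType).
Local Notation C := R[i].
Local Notation mu := (@lebesgue_measure R).
Local Notation half := (`[0%R, +oo[%classic : set R).

Lemma rint_cvg (g : R -> R) : mu.-integrable half (EFin \o g) ->
  rint g n%:R @[n --> \oo] --> \int[mu]_(x in half) g x.
Proof.
move=> ig.
have mg : measurable_fun half (EFin \o g) by case/integrableP: ig.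
pose seg (n : nat) : set R := `[0, n%:R]%classic.
have mA n : measurable (seg n) by exact: measurable_itv.
have sA n : seg n `<=` half.
  by move=> x /=; rewrite !in_itv /= andbT => /andP[].
have mF n : measurable_fun half ((EFin \o g) \_ (seg n)).
  apply: (measurable_restrict (EFin \o g) (mA n) (measurable_itv _)).1.
  by apply: measurable_funS mg; [exact: measurable_itv|exact: subIsetl].
have h := @dominated_convergence _ _ _ mu half (measurable_itv _)
  (fun n => (EFin \o g) \_ (seg n)) (EFin \o g) (fun x => `|g x|%:E)
  mF mg _ (integrable_abse ig) _.
have {}h : ((\int[mu]_(x in half) ((EFin \o g) \_ (seg n)) x)%E
    @[n --> \oo]) --> (\int[mu]_(x in half) (EFin \o g) x)%E.
  have [||_ _] := h; last exact.
    apply: ae_all => x; rewrite /= in_itv /= andbT => x0.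
    apply: cvg_near_cst; exists (Num.truncn x).+1 => // n /= xn.
    rewrite patchE ifT//; apply/mem_set; rewrite /seg /= in_itv /= x0 /=.
    rewrite ltW// (lt_le_trans (truncnS_gt x))//.
    by rewrite ler_nat.
  apply: ae_all => x n _; rewrite patchE; case: ifPn => _ //=.
  by rewrite normr0 lee_fin.
have E n : rint g n%:R = fine (\int[mu]_(x in half) ((EFin \o g) \_ (seg n)) x)%E.
  by rewrite -integral_mkcondr setIidr//.
under eq_fun do rewrite E.
apply: fine_cvg; rewrite /Rintegral fineK//.
by apply: integrable_fin_num ig => //; exact: measurable_itv.
Qed.

Lemma L2_mul (f g : R -> R) : L2_halfline f -> L2_halfline g ->
  mu.-integrable half (fun x => (f x * g x)%:E).
Proof.
move=> [mf f2] [mg g2].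
apply: (@le_integrable _ _ _ mu half (measurable_itv _) _ (fun x => (f x ^+ 2 + g x ^+ 2)%:E)).
- by apply/measurable_EFinP; exact: measurable_funM.
- move=> x _; rewrite /= lee_fin [leRHS]ger0_norm; last by rewrite addr_ge0 ?sqr_ge0.
  rewrite real_ler_norml ?num_real//.
  have : 0 <= (f x - g x) ^+ 2 by exact: sqr_ge0.
  have : 0 <= (f x + g x) ^+ 2 by exact: sqr_ge0.
  have : 0 <= f x ^+ 2 by exact: sqr_ge0.
  have : 0 <= g x ^+ 2 by exact: sqr_ge0.
  by rewrite !sqrrD sqrrN => *; apply/andP; split; lra.
- have := @integrableD _ _ _ mu half (measurable_itv _) _ _ f2 g2.
  by apply: eq_integrable => //; exact: measurable_itv.
Qed.

Lemma L2_sum (n : nat) (F : 'I_n -> R -> R) : (forall i, mu.-integrable half (fun x => (F i x)%:E)) ->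
  mu.-integrable half (fun x => (\sum_i F i x)%:E).
Proof.
move=> H; have := @integrable_sum _ _ _ mu half (measurable_itv _) _ (index_enum 'I_n) xpredT
  (fun i x => (F i x)%:E) (fun i _ => H i).
by apply: eq_integrable => [|x _]; [exact: measurable_itv|rewrite sumEFin].
Qed.

Lemma rprim_deriv (f : R -> R) : AC_halfline f -> rprim f (deriv_halfline f).
Proof.
move=> ac; split=> //; apply: ae_imply (AC_derivable_ae ac) => x H x0.
rewrite /deriv_halfline x0 derive1E; exact: derivableP (H x0).
Qed.

Lemma prim_deriv p q (F : R -> 'M[C]_(p, q)) : entrywise (@AC_halfline R) F -> prim F (Defs.deriv F).
Proof.
by move=> ac i j; have [a b] := ac i j; split; rewrite /=;
  apply: rprim_eq (rprim_deriv _) => // x _; rewrite mxE.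
Qed.

Lemma integrable_L1loc (g : R -> R) : mu.-integrable half (EFin \o g) -> L1loc_halfline g.
Proof.
move=> ig X X0; apply: integrableS ig; try exact: measurable_itv.
by move=> x /=; rewrite !in_itv /= andbT => /andP[].
Qed.

(** f(n) is the integral of [g] over [0, n]. Integers suffice, as the limits are later used for
    constant or monotone quantities. *)
Lemma rprim_tends0 (f g : R -> R) : rprim f g -> f 0 = 0 -> mu.-integrable half (EFin \o g) ->
  \int[mu]_(x in half) g x = 0 -> f n%:R @[n --> \oo] --> 0.
Proof.
move=> pf f0 ig g0.
have pd := rprimB pf (rprim_integral (integrable_L1loc ig)).
have E n : f n%:R = rint g n%:R.
  have h1 := rprim_le pd (lexx 0) (ler0n R n).
  have h2 := rprim_le (rprimN pd) (lexx 0) (ler0n R n).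
  have r0 := rint0 g; rewrite /rint in r0.
  have {}h1 : f 0 - rint g 0 <= f n%:R - rint g n%:R.
    by apply: h1; apply: ae_all => x _; rewrite subrr.
  have {}h2 : - (f 0 - rint g 0) <= - (f n%:R - rint g n%:R).
    by apply: h2; apply: ae_all => x _; rewrite subrr oppr0.
  by move: h1 h2; rewrite rint0 f0; clear; lra.
by under eq_fun do rewrite E; rewrite -g0; exact: rint_cvg.
Qed.

End boundary_form.

(** * The boundary form at infinity *)

Section self_adjoint_form.
Variables (R : realType) (m : nat).
Local Notation C := R[i].
Local Notation Re := complex.Re.
Local Notation Im := complex.Im.
Local Notation mu := (@lebesgue_measure R).
Local Notation half := (`[0%R, +oo[%classic : set R).
Implicit Types (Q : R -> 'M[C]_m) (u v g h : R -> 'cV[C]_m).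

Lemma eq_half (f f' : R -> R) : (forall x, f x = f' x) ->
  mu.-integrable half (fun x => (f x)%:E) -> mu.-integrable half (fun x => (f' x)%:E).
Proof. by move=> H; apply: eq_integrable => [|x _]; [exact: measurable_itv|rewrite H]. Qed.

Lemma L2_dot u v : L2 u -> L2 v ->
  mu.-integrable half (fun x => (Re ((adj (u x) *m v x) 0 0))%:E) /\
  mu.-integrable half (fun x => (Im ((adj (u x) *m v x) 0 0))%:E).
Proof.
move=> hu hv; split.
  have := @L2_sum R m (fun k x => Re (u x k 0) * Re (v x k 0) + Im (u x k 0) * Im (v x k 0)).
  move=> h; apply: eq_half (h _) => [x|k].
    rewrite mxE cRe_sum; apply: eq_bigr => k _.
    by rewrite adjE cReM cReJ cImJ; ring.
  have [a b] := hu k 0; have [c d] := hv k 0.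
  have := @integrableD _ _ _ mu half (measurable_itv _) _ _ (L2_mul a c) (L2_mul b d).
  by apply: eq_integrable => //; exact: measurable_itv.
have := @L2_sum R m (fun k x => Re (u x k 0) * Im (v x k 0) - Im (u x k 0) * Re (v x k 0)).
move=> h; apply: eq_half (h _) => [x|k].
  rewrite mxE cIm_sum; apply: eq_bigr => k _.
  by rewrite adjE cImM cReJ cImJ; ring.
have [a b] := hu k 0; have [c d] := hv k 0.
have := @integrableB _ _ _ mu half (measurable_itv _) _ _ (L2_mul a d) (L2_mul b c).
by apply: eq_integrable => //; exact: measurable_itv.
Qed.

Lemma innerE u v : inner u v =
  ((\int[mu]_(x in half) Re ((adj (u x) *m v x) 0 0)) +i*
   (\int[mu]_(x in half) Im ((adj (u x) *m v x) 0 0)))%C.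
Proof.
by congr (_ +i* _)%C; apply: eq_Rintegral => x _; congr (_ _); rewrite mxE;
  apply: eq_bigr => k _; rewrite adjE.
Qed.

Lemma prim_schrodinger Q g : F_F'_AC g -> prim g (Defs.deriv g) /\
  prim (Defs.deriv g) (fun x => Q x *m g x - schrodinger_expr Q g x).
Proof.
move=> [a _ b]; split; first exact: prim_deriv.
apply: prim_eq (prim_deriv b) => x _.
by rewrite /schrodinger_expr opprD opprK addrCA subrr addr0.
Qed.

(** Lagrange's identity: W' = (T g)^* h - g^* T h, whose integral over the half-line is 0 by
    symmetry of the operator. Since W(0) = 0 by the Dirichlet condition, W vanishes at infinity. *)
Lemma domH_form_tends0 Q B g h : hermitian_ae Q ->
  self_adjoint (domH Q B) (schrodinger_expr Q) -> domH Q B g -> domH Q B h ->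
  let W x := (adj (g x) *m Defs.deriv h x - adj (Defs.deriv g x) *m h x) 0 0 in
  Re (W n%:R) @[n --> \oo] --> 0 /\ Im (W n%:R) @[n --> \oo] --> 0.
Proof.
move=> hQ [_ sa] dg dh W.
have [L2g ACg g0 _ L2Tg] := dg; have [L2h ACh h0 _ L2Th] := dh.
have [pg pg'] := prim_schrodinger Q ACg; have [ph ph'] := prim_schrodinger Q ACh.
set Tg := schrodinger_expr Q g in pg' L2Tg; set Th := schrodinger_expr Q h in ph' L2Th.
have sym : inner Tg h = inner g Th.
  have [sa' _] := sa h Th L2h L2Th.
  by apply: sa' => //; exists h; split=> //; apply: ae_all.
have pW : cprim W (fun x => (adj (Tg x) *m h x) 0 0 - (adj (g x) *m Th x) 0 0).
  have := primB (primM (prim_adj pg) ph') (primM (prim_adj pg') ph) => /(_ 0 0).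
  apply: cprim_ae; apply: ae_imply hQ => x H /ltW/H {}H.
  have <- : (adj (Tg x) *m h x - adj (g x) *m Th x) 0 0 =
    (adj (Tg x) *m h x) 0 0 - (adj (g x) *m Th x) 0 0 by rewrite [LHS]mxE [X in _ + X]mxE.
  congr (_ _ 0 0); rewrite adjB adjM -H mulmxBl mulmxBr !mulmxA.
  by apply/matrixP => i j; rewrite !mxE; ring.
have W0 : W 0 = 0 by rewrite /W g0 h0 adj0 mul0mx mulmx0 subrr mxE.
have [i1 i2] := L2_dot L2Tg L2h; have [i3 i4] := L2_dot L2g L2Th.
have e1 := congr1 (@complex.Re R) sym; have e2 := congr1 (@complex.Im R) sym.
rewrite !innerE /= in e1 e2.
case: pW => pR pI; split.
  apply: (rprim_tends0 (rprim_eq _ pR)).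
  - by move=> x _; rewrite cReD cReN.
  - by rewrite W0.
  - have := @integrableB _ _ _ mu half (measurable_itv _) _ _ i1 i3.
    by apply: eq_integrable => //; exact: measurable_itv.
  - by rewrite RintegralB// ?e1 ?subrr//; exact: measurable_itv.
apply: (rprim_tends0 (rprim_eq _ pI)).
- by move=> x _; rewrite cImD cImN.
- by rewrite W0.
- have := @integrableB _ _ _ mu half (measurable_itv _) _ _ i2 i4.
  by apply: eq_integrable => //; exact: measurable_itv.
- by rewrite RintegralB// ?e2 ?subrr//; exact: measurable_itv.
Qed.

End self_adjoint_form.

(** * Weyl solutions and the Weyl-Titchmarsh matrix *)

Section weyl_data.
Variables (R : realType) (m : nat).
Local Notation C := R[i].
Local Notation Re := complex.Re.
Local Notation Im := complex.Im.
Local Notation mu := (@lebesgue_measure R).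
Implicit Types (Q : R -> 'M[C]_m) (B : (R -> 'cV[C]_m) -> Prop) (z : C).

Lemma cvg0_sum n (F : 'I_n -> nat -> R) : (forall i, F i k @[k --> \oo] --> 0) ->
  (\sum_i F i k) @[k --> \oo] --> 0.
Proof.
elim: n F => [F _|n IH F H].
  by under eq_fun do rewrite big_ord0; exact: cvg_cst.
have h : (F ord0 k + \sum_(i < n) F (lift ord0 i) k) @[k --> \oo] --> (0 + 0 : R).
  by apply: cvgD; [exact: H|exact: (IH (fun i k => F (lift ord0 i) k) (fun i => H (lift ord0 i)))].
rewrite addr0 in h; under eq_fun do rewrite big_ord_recl; exact: h.
Qed.

Lemma cvg0_mxN p q (F : nat -> 'M[C]_(p, q)) :
  (forall i j, Re (F k i j) @[k --> \oo] --> 0 /\ Im (F k i j) @[k --> \oo] --> 0) ->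
  mxN (F k) @[k --> \oo] --> 0.
Proof.
move=> H; apply: cvg0_sum => i; apply: cvg0_sum => j; have [a b] := H i j.
rewrite /N1 -[X in _ --> X](addr0 (0 : R)).
apply: cvgD.
  by rewrite -(@normr0 _ R); exact: cvg_norm.
by rewrite -(@normr0 _ R); exact: cvg_norm.
Qed.

Lemma deriv_near_infty p q (F G : R -> 'M[C]_(p, q)) :
  (\forall x \near +oo, F x = G x) -> \forall x \near +oo, Defs.deriv F x = Defs.deriv G x.
Proof.
move=> [A [_ HA]]; exists (`|A|); split=> [|x Ax]; first exact: num_real.
have x0 : 0 < x by apply: le_lt_trans Ax.
have near : \forall t \near x, F t = G t.
  apply: filterS (gt_nbhs (le_lt_trans (ler_norm A) Ax)) => t At; exact: HA.
apply/matrixP => i j; rewrite !mxE /deriv_halfline x0 !derive1E.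
by congr (_ +i* _)%C; apply: near_eq_derive; apply: filterS near => t ->.
Qed.

Lemma deriv_col p q (F : R -> 'M[C]_(p, q)) j x :
  Defs.deriv (fun t => col j (F t)) x = col j (Defs.deriv F x).
Proof.
apply/matrixP => i k; rewrite !mxE.
have E (re : C -> R) : (fun t => re (col j (F t) i k)) = (fun t => re (F t i j)).
  by apply: boolp.funext => t; rewrite mxE.
by rewrite (E (@complex.Re R)) (E (@complex.Im R)).
Qed.

(** The Wronskian of U1^* and U2; for hermitian Q it is constant when z2 is the conjugate of z1. *)
Definition form p q (U1 V1 : R -> 'M[C]_(m, p)) (U2 V2 : R -> 'M[C]_(m, q)) x : 'M[C]_(p, q) :=
  adj (U1 x) *m V2 x - adj (V1 x) *m U2 x.

Lemma form_prim Q z1 z2 p q (U1 V1 : R -> 'M[C]_(m, p)) (U2 V2 : R -> 'M[C]_(m, q)) :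
  hermitian_ae Q -> sol Q z1 U1 V1 -> sol Q z2 U2 V2 ->
  prim (form U1 V1 U2 V2) (fun x => ((z1^*)%C - z2) *: (adj (U1 x) *m U2 x)).
Proof.
move=> hQ [pU1 pV1] [pU2 pV2].
apply: prim_ae (primB (primM (prim_adj pU1) pV2) (primM (prim_adj pV1) pU2)).
apply: ae_imply hQ => x H /ltW/H {}H.
rewrite adjB adjM adjZ -H mulmxBl mulmxBr !mulmxA -scalemxAl -scalemxAr.
by apply/matrixP => i j; rewrite !mxE; ring.
Qed.

Lemma weyl_sol Q B z Psi : weyl_solution Q B z Psi -> sol Q z Psi (Defs.deriv Psi).
Proof.
move=> [[a _ b] eq _ _ _]; split; first exact: prim_deriv.
apply: prim_ae (prim_deriv b); apply: ae_imply eq => x H /ltW/H {}H.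
by apply/eqP; rewrite -subr_eq0 -oppr_eq0 opprB -mul_scalar_mx -mulmxBl addrC; apply/eqP.
Qed.

(** Weyl solutions violate the Dirichlet condition, but near infinity each column and its derivative
    coincide with those of an element of the domain, to which [domH_form_tends0] applies. *)
Lemma weyl_form_tends0 Q B z1 z2 Psi1 Psi2 : potential Q -> sa_bc_at_infinity Q B ->
  weyl_solution Q B z1 Psi1 -> weyl_solution Q B z2 Psi2 ->
  mxN (form Psi1 (Defs.deriv Psi1) Psi2 (Defs.deriv Psi2) n%:R) @[n --> \oo] --> 0.
Proof.
move=> [_ hQ] [_ sa] [_ _ _ _ d1] [_ _ _ _ d2]; apply: cvg0_mxN => i j.
have [g dg g1] := d1 i; have [h dh h2] := d2 j.
have g1' : \forall x \near +oo, col i (Defs.deriv Psi1 x) = Defs.deriv g x.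
  by apply: filterS (deriv_near_infty g1) => x; rewrite deriv_col.
have h2' : \forall x \near +oo, col j (Defs.deriv Psi2 x) = Defs.deriv h x.
  by apply: filterS (deriv_near_infty h2) => x; rewrite deriv_col.
have E : \forall n \near \oo, (adj (g n%:R) *m Defs.deriv h n%:R -
    adj (Defs.deriv g n%:R) *m h n%:R) 0 0 =
    form Psi1 (Defs.deriv Psi1) Psi2 (Defs.deriv Psi2) n%:R i j.
  have N := @cvgr_idn R.
  have n1 : \forall n \near \oo, col i (Psi1 n%:R) = g n%:R by exact: (N _ g1).
  have n2 : \forall n \near \oo, col j (Psi2 n%:R) = h n%:R by exact: (N _ h2).
  have n1' : \forall n \near \oo, col i (Defs.deriv Psi1 n%:R) = Defs.deriv g n%:R.
    exact: (N _ g1').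
  have n2' : \forall n \near \oo, col j (Defs.deriv Psi2 n%:R) = Defs.deriv h n%:R.
    exact: (N _ h2').
  apply: filterS3 (filterI n1 n1') n2 n2' => n [<- <-] <- <-.
  rewrite /form !mxE; congr (_ - _); apply: eq_bigr => k _; rewrite !adjE !mxE//.
have [a b] := domH_form_tends0 hQ sa dg dh.
split; [apply: cvg_trans a|apply: cvg_trans b]; apply: near_eq_cvg;
  by apply: filterS E => n ->.
Unshelve. all: by end_near. Qed.

(** At conjugate spectral parameters the form is constant, and it tends to 0. This is the symmetry
    of the Weyl-Titchmarsh matrix before division by Psi(0). *)
Lemma weyl_symmetric Q B z Psi1 Psi2 : potential Q -> sa_bc_at_infinity Q B ->
  weyl_solution Q B (z^*)%C Psi1 -> weyl_solution Q B z Psi2 ->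
  adj (Psi1 0) *m Defs.deriv Psi2 0 = adj (Defs.deriv Psi1 0) *m Psi2 0.
Proof.
move=> pQ sa w1 w2; have [_ hQ] := pQ.
have L := weyl_form_tends0 pQ sa w1 w2.
have pF := form_prim hQ (weyl_sol w1) (weyl_sol w2).
apply/eqP; rewrite -subr_eq0; apply/eqP.
set F := form _ _ _ _ in L pF; rewrite -[LHS]/(F 0); apply: mxN_eq0.
have pF0 : prim F (fun=> 0).
  by apply: prim_eq pF => x _; rewrite conjcK subrr scale0r.
have E n : F n%:R = F 0.
  by apply: (prim_eq_halfline pF0 (prim_cst (F 0))).
rewrite (_ : mxN (F 0) = 0)//; apply: (@cvg_unique _ _ (mxN (F n%:R) @[n --> \oo])) => //.
by apply: cvg_near_cst; apply: nearW => n; rewrite E.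
Qed.

(** The form of Psi with itself, tested on c, is 2 i times the flux. So Im z times the flux tends to
    0 along the integers, and it is nonincreasing. *)
Lemma weyl_flux Q B z Psi : potential Q -> sa_bc_at_infinity Q B -> weyl_solution Q B z Psi ->
  forall (c : 'cV[C]_m) x, 0 <= x -> 0 <= Im z * flux (Psi x *m c) (Defs.deriv Psi x *m c).
Proof.
move=> pQ sa w c x x0; have [_ hQ] := pQ.
have L := weyl_form_tends0 pQ sa w w; set F := form _ _ _ _ in L.
have s := sol_mulr c (weyl_sol w).
have pf := flux_prim hQ s; set f := fun x => flux _ _ in pf.
have fF y : 2 * `|f y| <= mxN c * mxN (F y) * mxN c.
  have -> : 2 * `|f y| = `|Im ((adj c *m F y *m c) 0 0)|.
    rewrite -[2]ger0_norm// -normrM; congr (`|_|).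
    rewrite /F /form mulmxBr mulmxBl mxE cImD [X in _ + Im X]mxE cImN.
    have -> : (adj c *m (adj (Defs.deriv Psi y) *m Psi y) *m c) 0 0 =
      (((adj c *m (adj (Psi y) *m Defs.deriv Psi y) *m c) 0 0)^*)%C.
      by rewrite -adjE !adjM !adjK !mulmxA.
    rewrite cImJ opprK /f /flux adjM !mulmxA.
    by rewrite mulr_natl.
  apply: (@le_trans _ _ (N1 ((adj c *m F y *m c) 0 0))); first by rewrite /N1 lerDr.
  rewrite (le_trans (N1_le_mxN _ _ _))// (le_trans (mxNM _ _))//.
  by rewrite ler_wpM2r ?mxN_ge0// (le_trans (mxNM _ _))// mxN_adj.
have fL : Im z * f n%:R @[n --> \oo] --> 0.
  rewrite -[0](mulr0 (Im z)); apply: cvgMr; apply/norm_cvg0P.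
  apply: (@squeeze_cvgr _ _ _ _ (fun=> 0) (fun n => mxN c * mxN (F n%:R) * mxN c)).
  - near=> n; rewrite normr_ge0/= (le_trans _ (fF _))//.
    by rewrite mulr_natl lerDl.
  - exact: cvg_cst.
  - rewrite -[X in _ --> X](mul0r (mxN c)); apply: cvgMl.
    by rewrite -[X in _ --> X](mulr0 (mxN c)); apply: cvgMr.
apply: (cvgr_to_le fL).
exists (Num.truncn x).+1 => // n /= xn.
have xn' : x <= n%:R by rewrite ltW// (lt_le_trans (truncnS_gt x))// ler_nat.
have := rprim_le (rprimN (rprimZ (Im z) pf)) x0 xn'; rewrite lerN2; apply.
apply: ae_all => t _.
by rewrite mulrA mulrN mulNr opprK mulr_ge0 ?mxsq_ge0// -expr2 sqr_ge0.
Unshelve. all: by end_near. Qed.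

Lemma ae_gt0_cst (P : Prop) : {ae mu, forall x : R, 0 < x -> P} -> P.
Proof.
move=> h; apply: boolp.contrapT => nP.
have := rprim_le (rprimN (rprim_id R)) (lexx 0) ler01.
have -> : (- (0:R) <= - 1) = false by rewrite oppr0 ler0N1.
suff H : {ae mu, forall x : R, 0 < x < 1 -> 0 <= - (1 : R)} by move/(_ H).
by apply: ae_imply h => x H /andP[/H].
Qed.

(** If Psi(0) c = 0, the flux of Psi c starts at 0; being monotone and of constant sign it stays 0,
    and its derivative - Im z |Psi c|^2 then forces Psi c = 0, against the independence of the
    columns. *)
Lemma weyl_unitmx Q B z Psi : Im z != 0 -> potential Q -> sa_bc_at_infinity Q B ->
  weyl_solution Q B z Psi -> Psi 0 \in unitmx.
Proof.
move=> z0 pQ sa w; have [_ hQ] := pQ; have sP := weyl_sol w.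
have inj (c : 'cV[C]_m) : Psi 0 *m c = 0 -> c = 0.
  move=> c0; have F0 := weyl_flux pQ sa w c.
  case: w => _ _ + _ _; apply.
  have s := sol_mulr c sP.
  have pf := flux_prim hQ s; set f := fun x => flux _ _ in pf.
  have f0 x : 0 <= x -> f x = 0.
    move=> x0; have := rprim_le (rprimN (rprimZ (Im z) pf)) (lexx 0) x0.
    rewrite lerN2 => H.
    have {}H : Im z * f x <= Im z * f 0.
      apply: H; apply: ae_all => t _.
      by rewrite mulrA mulrN mulNr opprK mulr_ge0 ?mxsq_ge0// -expr2 sqr_ge0.
    have E : f 0 = 0 by rewrite /f /flux c0 adj0 mul0mx mxE.
    have := F0 x x0; rewrite E mulr0 in H => {}F0.
    have /eqP : Im z * f x = 0 by apply: le_anti; rewrite H F0.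
    by rewrite mulf_eq0 (negbTE z0) => /eqP.
  have U0 : {ae mu, forall x : R, 0 < x -> Psi x *m c = 0}.
    apply: ae_imply pf.2 => x H x0; apply: mxN_eq0.
    have d0 : is_derive x 1 f 0.
      apply: (@near_eq_is_derive _ _ _ (cst (0 : R))).
      by apply: filterS (gt_nbhs x0) => t /ltW/f0 ->.
    have E : - Im z * mxsq (Psi x *m c) = 0.
      by have [_ <-] := H x0; have [_ <-] := d0.
    move/eqP: E; rewrite mulf_eq0 oppr_eq0 (negbTE z0) /= => /eqP E.
    have := mxN_le_mxsq (Psi x *m c); rewrite E mulr0 => h.
    by rewrite leNgt; apply/negP => p0; move: h; rewrite leNgt exprn_gt0.
  (* From a.e. to everywhere: when Psi c = 0 a.e. its derivative is a constant V0, so Psi c = x V0,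
     and a single x > 0 gives V0 = 0. *)
  have [pUc pVc] := s.
  have pVc0 : prim (fun x => Defs.deriv Psi x *m c) (fun=> 0).
    by apply: prim_ae pVc; apply: ae_imply U0 => x H /H ->; rewrite mulmx0 scaler0 subrr.
  set V0 := Defs.deriv Psi 0 *m c.
  have pUc0 : prim (fun x => Psi x *m c) (fun=> V0).
    apply: prim_eq pUc => x /ltW x0.
    exact: (prim_eq_halfline pVc0 (prim_cst V0)).
  have pE : prim (fun x : R => x%:C%C *: V0) (fun=> V0).
    by apply: prim_eq (primZ (cprim_real R) (prim_cst V0)) => y _; rewrite scale1r scaler0 addr0.
  have EU (x : R) : 0 <= x -> Psi x *m c = x%:C%C *: V0.
    by apply: (prim_eq_halfline pUc0 pE) => /=; rewrite c0 scale0r.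
  have V00 : V0 = 0.
    apply: ae_gt0_cst; apply: ae_imply U0 => x H x0; have := H x0.
    rewrite EU ?ltW// => /eqP; rewrite scaler_eq0 => /orP[/eqP/(congr1 (@complex.Re R))/= x00|/eqP//].
    by move: x0; rewrite x00 ltxx.
  by move=> x x0; rewrite EU// V00 scaler0.
rewrite -unitmx_tr -row_free_unit -kermx_eq0; apply/eqP/row_matrixP => i.
rewrite row0 -[LHS]trmxK [X in X^T](_ : _ = 0) ?trmx0//; apply: inj.
by rewrite -{1}[Psi 0]trmxK -trmx_mul -row_mul mulmx_ker row0 trmx0.
Qed.

(** All that the rest of the proof uses of the condition at infinity: symmetry of M, and the sign of
    the flux for the solution normalised by Psi(0)^-1. *)
Lemma weyl_data Q B M z : potential Q -> sa_bc_at_infinity Q B -> weyl_titchmarsh Q B M ->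
  Im z != 0 -> [/\ adj (M (z^*)%C) = M z &
  exists U V : R -> 'M[C]_m, [/\ sol Q z U V, U 0 = 1%:M, V 0 = M z &
    forall (c : 'cV[C]_m) x, 0 <= x -> 0 <= Im z * flux (U x *m c) (V x *m c)]].
Proof.
move=> pQ sa wt z0.
have z0' : Im (z^*)%C != 0 by rewrite cImJ oppr_eq0.
have [P w E] := wt z z0; have [P' w' E'] := wt _ z0'.
have u := weyl_unitmx z0 pQ sa w; have u' := weyl_unitmx z0' pQ sa w'.
split.
  have s := weyl_symmetric pQ sa w' w.
  have ua : adj (P' 0) *m adj (invmx (P' 0)) = 1%:M by rewrite -adjM mulVmx// adj1.
  have ua' := mulmx1C ua.
  rewrite E E' adjM -[LHS]mulmx1 -(mulmxV u) !mulmxA -[_ *m _ *m P 0]mulmxA -s.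
  by rewrite mulmxA ua' mul1mx.
exists (fun x => P x *m invmx (P 0)), (fun x => Defs.deriv P x *m invmx (P 0)); split=> //.
- exact: sol_mulr (weyl_sol w).
- by rewrite mulmxV.
- by move=> c x x0; rewrite -!mulmxA; exact: (weyl_flux pQ sa w).
Qed.

End weyl_data.

(** * Functions with second-order expansions *)

Section second_order_expansions.
Variable R : realType.
Local Notation C := R[i].
Implicit Types (f g : C -> C) (z h a b : C).

(* Second-order expansion at every point; for entire functions it is Taylor's formula. *)
Definition expands f := forall z, exists a1 a2 : C, exists K d : R, 0 < d <= 1 /\
  forall h, N1 h <= d -> N1 (f (z + h) - f z - a1 * h - a2 * h ^+ 2) <= K * N1 h ^+ 3.

Lemma expands_cst a : expands (fun=> a).
Proof.
move=> z; exists 0, 0, 0, 1; split=> [|h _]; first by rewrite ltr01 lexx.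
by rewrite !mul0r !subr0 subrr N1_0.
Qed.

Lemma expands_id : expands id.
Proof.
move=> z; exists 1, 0, 0, 1; split=> [|h _]; first by rewrite ltr01 lexx.
by rewrite [leLHS](_ : _ = N1 0); [rewrite N1_0 mul0r|congr N1; ring].
Qed.

Lemma expands_conj f : expands f -> expands (fun z => (f (z^*)%C)^*)%C.
Proof.
move=> H z; have [a1 [a2 [K [d [d1 He]]]]] := H (z^*)%C.
exists (a1^*)%C, (a2^*)%C, K, d; split=> // h hd.
have := He (h^*)%C; rewrite N1J => /(_ hd); apply: le_trans.
by rewrite -N1J !rmorphB !rmorphM /= !conjcK rmorphD !expr2.
Qed.

Lemma expands_comp f g : expands f -> expands g -> expands (f \o g).
Proof.
move=> Hf Hg z; have [b1 [b2 [Kg [dg [/andP[dg0 dg1] Eg]]]]] := Hg z.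
have [a1 [a2 [Kf [df [/andP[df0 df1] Ef]]]]] := Hf (g z).
have Kg0 : 0 <= `|Kg| by [].
(* B |h| bounds the increment of [g], so the radius df / B keeps this increment within the reach of
   the expansion of [f]. *)
pose B := N1 b1 + N1 b2 + `|Kg| + 1.
have B0 : 0 < B by rewrite ltr_wpDl// !addr_ge0// N1_ge0.
pose K := `|Kf| * B ^+ 3 + N1 a1 * `|Kg| + N1 a2 * ((N1 b2 + `|Kg|) * (2 * B)).
exists (a1 * b1), (a1 * b2 + a2 * b1 ^+ 2), K, (Num.min dg (df / B)); split.
  by rewrite lt_min dg0 divr_gt0// ge_min dg1.
move=> h; rewrite le_min => /andP[hg hf].
have n0 : 0 <= N1 h := N1_ge0 h; set n := N1 h in n0 hg hf *.
have n1 : n <= 1 by exact: le_trans dg1.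
have n21 : n ^+ 2 <= n by rewrite expr2 ler_piMl.
have n32 : n ^+ 3 <= n ^+ 2 by rewrite exprS ler_piMl// exprn_ge0.
pose h' := g (z + h) - g z; pose e := h' - b1 * h - b2 * h ^+ 2.
have Ee : N1 e <= `|Kg| * n ^+ 3.
  by rewrite (le_trans (Eg h hg))// ler_wpM2r ?exprn_ge0// ler_norm.
have Nb1 : N1 (b1 * h) <= N1 b1 * n by exact: N1M.
have Nb2 : N1 (b2 * h ^+ 2) <= N1 b2 * n ^+ 2.
  by rewrite (le_trans (N1M _ _))// ler_wpM2l ?N1_ge0// N1X.
have E2 : N1 (h' - b1 * h) <= (N1 b2 + `|Kg|) * n ^+ 2.
  rewrite (_ : h' - b1 * h = b2 * h ^+ 2 + e); last by rewrite /e; ring.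
  rewrite (le_trans (N1D _ _))// mulrDl lerD// (le_trans Ee)//.
  by rewrite ler_wpM2l.
have E1 : N1 h' <= B * n.
  rewrite (_ : h' = b1 * h + (h' - b1 * h)); last by ring.
  rewrite (le_trans (N1D _ _))//.
  have h1 : (N1 b2 + `|Kg|) * n ^+ 2 <= (N1 b2 + `|Kg|) * n by rewrite ler_wpM2l// addr_ge0// N1_ge0.
  by move: Nb1 E2 h1 n0; rewrite /B; clear; lra.
have E3 : N1 (h' + b1 * h) <= 2 * B * n.
  rewrite (le_trans (N1D _ _))//.
  have h1 : N1 b1 * n <= B * n.
    rewrite ler_wpM2r//; have := N1_ge0 b2; rewrite /B; move: Kg0; clear; lra.
  by move: Nb1 E1 h1; clear; lra.
have E4 : N1 (f (g z + h') - f (g z) - a1 * h' - a2 * h' ^+ 2) <= `|Kf| * B ^+ 3 * n ^+ 3.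
  have h'd : N1 h' <= df by rewrite (le_trans E1)// mulrC -ler_pdivlMr.
  rewrite (le_trans (Ef _ h'd))// -mulrA -exprMn.
  apply: (@le_trans _ _ (`|Kf| * N1 h' ^+ 3)).
    by rewrite ler_wpM2r ?exprn_ge0 ?N1_ge0// ler_norm.
  by rewrite ler_wpM2l// lerXn2r// nnegrE ?N1_ge0// mulr_ge0// ltW.
(* Three errors of order |h|^3: the remainder of f, a1 times that of g, and a2 (h'^2 - (b1 h)^2),
   factored as an O(|h|^2) times an O(|h|). *)
have -> : (f \o g) (z + h) - (f \o g) z - a1 * b1 * h - (a1 * b2 + a2 * b1 ^+ 2) * h ^+ 2 =
  (f (g z + h') - f (g z) - a1 * h' - a2 * h' ^+ 2) + (a1 * e + a2 * ((h' - b1 * h) * (h' + b1 * h))).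
  by rewrite /= (_ : g z + h' = g (z + h)); [rewrite /e; ring|rewrite /h'; ring].
rewrite (_ : K * n ^+ 3 = `|Kf| * B ^+ 3 * n ^+ 3 + (N1 a1 * `|Kg| * n ^+ 3 +
  N1 a2 * ((N1 b2 + `|Kg|) * (2 * B)) * n ^+ 3)); last by rewrite /K; ring.
apply: (le_trans (N1D _ _)); apply: lerD => //.
apply: (le_trans (N1D _ _)); apply: lerD.
  by rewrite (le_trans (N1M _ _))// -mulrA ler_wpM2l ?N1_ge0.
rewrite (le_trans (N1M _ _))// -mulrA ler_wpM2l ?N1_ge0// (le_trans (N1M _ _))//.
apply: (@le_trans _ _ (((N1 b2 + `|Kg|) * n ^+ 2) * (2 * B * n))).
  by rewrite ler_pM ?N1_ge0.
by rewrite [leLHS](_ : _ = (N1 b2 + `|Kg|) * (2 * B) * n ^+ 3); last by ring.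
Qed.

Lemma expandsD f g : expands f -> expands g -> expands (fun z => f z + g z).
Proof.
move=> Hf Hg z; have [b1 [b2 [Kg [dg [/andP[dg0 dg1] Eg]]]]] := Hg z.
have [a1 [a2 [Kf [df [/andP[df0 df1] Ef]]]]] := Hf z.
exists (a1 + b1), (a2 + b2), (Kf + Kg), (Num.min df dg); split.
  by rewrite lt_min dg0 df0 ge_min dg1 orbT.
move=> h; rewrite le_min => /andP[/Ef hf /Eg hg].
rewrite (_ : _ - _ = (f (z + h) - f z - a1 * h - a2 * h ^+ 2) +
  (g (z + h) - g z - b1 * h - b2 * h ^+ 2)); last by ring.
by rewrite (le_trans (N1D _ _))// mulrDl lerD.
Qed.

Lemma expands_sqr : expands (fun z => z ^+ 2).
Proof.
move=> z; exists (2 * z), 1, 0, 1; split=> [|h _]; first by rewrite ltr01 lexx.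
by rewrite [leLHS](_ : _ = N1 0); [rewrite N1_0 mul0r|congr N1; ring].
Qed.

Lemma expandsZ a f : expands f -> expands (fun z => a * f z).
Proof.
apply: (@expands_comp ( *%R a)) => z; exists a, 0, 0, 1; split=> [|h _]; first by rewrite ltr01 lexx.
by rewrite [leLHS](_ : _ = N1 0); [rewrite N1_0 mul0r|congr N1; ring].
Qed.

(* Polarisation: 4 f g = (f + g)^2 - (f - g)^2. *)
Lemma expandsM f g : expands f -> expands g -> expands (fun z => f z * g z).
Proof.
move=> Hf Hg.
have h1 := expands_comp expands_sqr (expandsD Hf Hg).
have h2 := expands_comp expands_sqr (expandsD Hf (expandsZ (-1) Hg)).
have := expandsD (expandsZ (4^-1) h1) (expandsZ (- 4^-1) h2).
by congr expands; apply: boolp.funext => z /=; field.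
Qed.

Lemma expands_sum n (F : 'I_n -> C -> C) : (forall i, expands (F i)) ->
  expands (fun z => \sum_i F i z).
Proof.
elim: n F => [|n IH] F H.
  have := expands_cst 0; congr expands; apply: boolp.funext => z; by rewrite big_ord0.
have := expandsD (H ord0) (IH (fun i => F (lift ord0 i)) (fun i => H _)).
by congr expands; apply: boolp.funext => z; rewrite big_ord_recl.
Qed.

End second_order_expansions.

(** * The maximum principle *)

Section maximum_principle.
Variable R : realType.
Local Notation C := R[i].
Local Notation Re := complex.Re.
Local Notation Im := complex.Im.
Implicit Types (f : C -> C) (p q h : C).

Lemma cprim_increment (f g : R -> C) (c : R) : cprim f g -> 0 <= c ->
  (forall t, 0 <= t <= 1 -> N1 (g t) <= c) -> forall t, 0 <= t <= 1 -> N1 (f t - f 0) <= c.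
Proof.
move=> pf c0 H t /andP[t0 t1].
have N11 (z : C) : mxN (z%:M : 'M[C]_1) = N1 z.
  by rewrite /mxN big_ord_recl big_ord0 addr0 big_ord_recl big_ord0 addr0 mxE mulr1n.
have pF : prim (fun x => (f x)%:M : 'M[C]_1) (fun x => (g x)%:M).
  move=> i j; rewrite !ord1.
  by have [a b] := pf; split; [move: a|move: b]; congr rprim; apply: boolp.funext => x;
    rewrite mxE mulr1n.
have := prim_norm_le pF (rprimZ c (rprim_id R)) (lexx 0) t0.
rewrite -raddfB N11 mulr0 subr0 mulr1 => h; apply: le_trans (h _) _.
  by apply: ae_all => x /andP[x0 xt]; rewrite N11 H// (ltW x0) (le_trans (ltW xt)).
by rewrite ler_piMr.
Qed.

(** Three integrations along t in [0, 1]: each remainder has derivative h times the previous one and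
    so gains a factor |h|. The constant 2 e bounds exp (h t) for |h| <= 1. *)
Lemma expands_cexp : expands (@cexp R).
Proof.
move=> z; pose E : R := 2 * expR 1; have E0 : 0 <= E by rewrite mulr_ge0// expR_ge0.
exists (cexp z), (cexp z / 2), (N1 (cexp z) * E), 1; split=> [|h h1]; first by rewrite ltr01 lexx.
have n0 := N1_ge0 h; set n := N1 h in h1 n0 *.
have ph := cprimM (cprim_cst h) (cprim_real R).
have ph2 := cprimM ph ph.
have pe := cprim_cexp h.
have B0 (t : R) : 0 <= t <= 1 -> N1 (h * cexp (h * t%:C%C)) <= n * E.
  move=> /andP[t0 t1]; rewrite (le_trans (N1M _ _))// ler_wpM2l// (le_trans (N1_cexp _))//.
  rewrite ler_wpM2l// ler_expR cReM /= mulr0 subr0.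
  apply: (@le_trans _ _ (`|Re h| * 1)).
    by apply: (@le_trans _ _ (`|Re h| * t)); [rewrite ler_wpM2r// ler_norm|rewrite ler_wpM2l].
  by rewrite mulr1 (le_trans _ h1)// /n /N1 lerDl.
have B1 (t : R) : 0 <= t <= 1 -> N1 (cexp (h * t%:C%C) - 1) <= n * E.
  move=> tI; have := cprim_increment pe (mulr_ge0 n0 E0) B0 tI.
  by rewrite mulr0 cexp0.
have B2 (t : R) : 0 <= t <= 1 -> N1 (cexp (h * t%:C%C) - 1 - h * t%:C%C) <= n * (n * E).
  move=> tI.
  have := cprim_increment (cprimD pe (cprimN ph)) (mulr_ge0 n0 (mulr_ge0 n0 E0)) _ tI.
  rewrite mulr0 cexp0 oppr0 addr0 => H.
  rewrite addrAC; apply: H => s sI; rewrite mul0r add0r.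
  rewrite (_ : _ - _ = h * (cexp (h * s%:C%C) - 1)); last by ring.
  by rewrite (le_trans (N1M _ _))// ler_wpM2l// B1.
have tI : 0 <= (1 : R) <= 1 by rewrite ler01 lexx.
have := cprim_increment (cprimD (cprimD pe (cprimN ph)) (cprimN (cprimM (cprim_cst 2^-1) ph2)))
  (mulr_ge0 n0 (mulr_ge0 n0 (mulr_ge0 n0 E0))) _ tI.
rewrite !mulr0 cexp0 oppr0 !addr0 => H.
rewrite cexpD (_ : _ - _ = cexp z * (cexp (h * 1%:C%C) - h * 1%:C%C
  - 2^-1 * (h * 1%:C%C * (h * 1%:C%C)) - 1)); last by rewrite mulr1; field.
apply: (le_trans (N1M _ _)); rewrite -[leRHS]mulrA; apply: ler_wpM2l; first exact: N1_ge0.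
rewrite (_ : E * n ^+ 3 = n * (n * (n * E))); last by ring.
apply: H => s sI.
rewrite (_ : _ - _ = h * (cexp (h * s%:C%C) - 1 - h * s%:C%C)); last by field.
by rewrite (le_trans (N1M _ _))// ler_wpM2l// B2.
Qed.

(** Both constants may depend on the point: this amounts to quantitative continuity, enough for a
    maximum on compact sets. *)
Definition lip (g : C -> R) := forall p, exists M d : R, 0 < d /\
  forall h, N1 h <= d -> `|g (p + h) - g p| <= M * N1 h.

Lemma sqD (w e : C) : sq (w + e) = sq w + sq e + 2 * (Re w * Re e + Im w * Im e).
Proof. by rewrite /sq cReD cImD; ring. Qed.

Lemma dot_le (w e : C) : `|Re w * Re e + Im w * Im e| <= N1 w * N1 e.
Proof.
rewrite (le_trans (ler_normD _ _))// !normrM /N1 mulrDl !mulrDr.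
by rewrite -!addrA lerD2l addrA lerDr addr_ge0// mulr_ge0.
Qed.

Lemma lip_sq f : expands f -> lip (fun z => sq (f z)).
Proof.
move=> H p; have [a1 [a2 [K [d [/andP[d0 d1] E]]]]] := H p.
pose L := N1 a1 + N1 a2 + `|K|.
have L0 : 0 <= L by rewrite !addr_ge0// N1_ge0.
exists (L * (L + 2 * N1 (f p))), d; split=> // h hd.
have n0 := N1_ge0 h; have n1 := le_trans hd d1; set n := N1 h in n0 hd n1 *.
pose e := f (p + h) - f p.
have Ne : N1 e <= L * n.
  rewrite (_ : e = a1 * h + (a2 * h ^+ 2 + (e - a1 * h - a2 * h ^+ 2))); last by ring.
  rewrite (_ : L * n = N1 a1 * n + (N1 a2 * n + `|K| * n)); last by rewrite /L; ring.
  apply: (le_trans (N1D _ _)); apply: lerD; first exact: N1M.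
  apply: (le_trans (N1D _ _)); apply: lerD.
    rewrite (le_trans (N1M _ _))// ler_wpM2l ?N1_ge0// (le_trans (N1X _ _))//.
    by rewrite expr2 ler_piMl.
  apply: (le_trans (E h hd)); rewrite -/n.
  apply: (@le_trans _ _ (`|K| * n ^+ 3)); first by rewrite ler_wpM2r ?exprn_ge0// ler_norm.
  by rewrite ler_wpM2l// exprS ler_piMr// exprn_ile1.
rewrite (_ : f (p + h) = f p + e); last by rewrite /e; ring.
have -> : sq (f p + e) - sq (f p) = sq e + 2 * (Re (f p) * Re e + Im (f p) * Im e).
  by rewrite sqD; ring.
rewrite (le_trans (ler_normD _ _))//.
have h1 : `|sq e| <= L * n * (L * n).
  rewrite ger0_norm ?sq_ge0// (le_trans (sq_le_N1 _))// expr2.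
  by rewrite ler_pM ?N1_ge0.
have h2 : `|2 * (Re (f p) * Re e + Im (f p) * Im e)| <= 2 * (N1 (f p) * (L * n)).
  rewrite normrM ger0_norm// ler_wpM2l// (le_trans (dot_le _ _))//.
  by rewrite ler_wpM2l ?N1_ge0.
have h3 : L * n * (L * n) <= L * n * (L * 1) by rewrite ler_wpM2l ?mulr_ge0// ler_wpM2l.
apply: (@le_trans _ _ (L * n * (L * 1) + 2 * (N1 (f p) * (L * n)))); last first.
  by rewrite [leLHS](_ : _ = L * (L + 2 * N1 (f p)) * n)//; ring.
by move: h1 h2 h3; clear; lra.
Qed.

Lemma lipD g g' : lip g -> lip g' -> lip (fun z => g z + g' z).
Proof.
move=> H H' p; have [M [d [d0 E]]] := H p; have [M' [d' [d0' E']]] := H' p.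
exists (M + M'), (Num.min d d'); split=> [|h]; first by rewrite lt_min d0.
rewrite le_min => /andP[/E h1 /E' h2].
rewrite (_ : _ - _ = (g (p + h) - g p) + (g' (p + h) - g' p)); last by ring.
by rewrite (le_trans (ler_normD _ _))// mulrDl lerD.
Qed.

Lemma lipZ (c : R) g : lip g -> lip (fun z => c * g z).
Proof.
move=> H p; have [M [d [d0 E]]] := H p; exists (`|c| * M), d; split=> // h hd.
by rewrite -mulrBr normrM -mulrA ler_wpM2l// E.
Qed.

(** One parametrisation for two shapes: s = 0, t = 1 gives a rectangle; t = 0 and y in [-1, 1] give
    the triangle |Im| <= s Re. *)
Lemma lip_max (a b c d s t : R) (g : C -> R) : a <= b -> c <= d -> lip g ->
  let P x y : C := (x +i* ((s * x + t) * y))%C in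
  exists x y, [/\ a <= x <= b, c <= y <= d &
    forall x' y', a <= x' <= b -> c <= y' <= d -> g (P x' y') <= g (P x y)].
Proof.
move=> ab cd lg P.
pose A : set (R * R) := `[a, b]%classic `*` `[c, d]%classic.
have cA : compact A by apply: compact_setX; exact: segment_compact.
have A0 : A !=set0 by exists (a, c); split; rewrite /= in_itv /= lexx.
have cont : continuous (fun xy : R * R => g (P xy.1 xy.2)).
  move=> [x y].
  have [M [r [r0 E]]] := lg (P x y).
  have c1 : (fun xy : R * R => xy.1) @ (x, y) --> x by exact: cvg_fst.
  have c2 : (fun xy : R * R => (s * xy.1 + t) * xy.2) @ (x, y) --> (s * x + t) * y.
    apply: cvgM; last exact: cvg_snd.
    by apply: cvgD; [apply: cvgM; [exact: cvg_cst|exact: cvg_fst]|exact: cvg_cst].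
  apply/cvgrPdist_lt => /= e e0.
  pose D := Num.min r (e / (`|M| + 1)).
  have M1 : 0 < `|M| + 1 by rewrite ltr_wpDl.
  have D0 : 0 < D / 2 by rewrite divr_gt0// lt_min r0 divr_gt0.
  move/cvgrPdist_lt : c1 => /(_ _ D0) c1; move/cvgrPdist_lt : c2 => /(_ _ D0) c2.
  near=> xy.
  have h1 : `|x - xy.1| < D / 2 by near: xy.
  have h2 : `|(s * x + t) * y - (s * xy.1 + t) * xy.2| < D / 2 by near: xy.
  pose h := P xy.1 xy.2 - P x y.
  have hD : N1 h < D.
    by rewrite /N1 !(cReD, cImD, cReN, cImN) /= distrC [X in _ + X]distrC [D]splitr ltrD.
  have hr : N1 h <= r by rewrite (le_trans (ltW hD))// ge_min lexx.
  rewrite distrC (_ : P xy.1 xy.2 = P x y + h); last by rewrite /h addrC subrK.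
  rewrite (le_lt_trans (E h hr))//.
  apply: (@le_lt_trans _ _ ((`|M| + 1) * N1 h)).
    by rewrite ler_wpM2r ?N1_ge0// ler_wpDr// ler_norm.
  by rewrite mulrC -ltr_pdivlMr// (lt_le_trans hD)// ge_min lexx orbT.
have [[x y] /set_mem [/= xI yI] H] := compact_EVT_max A0 cA (continuous_subspaceT cont).
exists x, y; split; [by rewrite in_itv in xI|by rewrite in_itv in yI|].
move=> x' y' x'I y'I; apply: (H (x', y')); apply/mem_set.
by split; rewrite /= in_itv.
Unshelve. all: by end_near. Qed.

(* The four values of h are the fourth roots of s^4, over which h, h^2 and h^3 sum to 0. *)
Lemma second_difference f p : expands f -> exists K d : R, 0 < d /\
  forall s : R, 0 <= s <= d ->
  4 * sq (f p) - K * s ^+ 3 <=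
  sq (f (p + s%:C%C)) + sq (f (p - s%:C%C)) + sq (f (p + (0 +i* s)%C)) + sq (f (p - (0 +i* s)%C)).
Proof.
move=> H; have [a1 [a2 [K [d [/andP[d0 d1] E]]]]] := H p.
pose B := N1 (f p) + N1 a1 + N1 a2.
exists (8 * (B * `|K|)), d; split=> // s /andP[s0 sd].
pose u h := f p + a1 * h + a2 * h ^+ 2.
have key h : N1 h = s -> sq (u h) - 2 * (B * `|K|) * s ^+ 3 <= sq (f (p + h)).
  move=> hs; pose e := f (p + h) - u h.
  have Ne : N1 e <= `|K| * s ^+ 3.
    rewrite (_ : e = f (p + h) - f p - a1 * h - a2 * h ^+ 2); last by rewrite /e /u; ring.
    rewrite (le_trans (E h _)) ?hs// ler_wpM2r ?exprn_ge0//; exact: ler_norm.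
  have s1 := le_trans sd d1.
  have Nu : N1 (u h) <= B.
    apply: (le_trans (N1D _ _)); apply: lerD; first apply: (le_trans (N1D _ _)); first apply: lerD => //.
      by rewrite (le_trans (N1M _ _))// hs ler_piMr ?N1_ge0.
    by rewrite (le_trans (N1M _ _))// ler_piMr ?N1_ge0// (le_trans (N1X _ _))// hs exprn_ile1.
  rewrite (_ : f (p + h) = u h + e); last by rewrite /e; ring.
  rewrite sqD; have := dot_le (u h) e; rewrite ler_norml => /andP[h1 _].
  have h2 : N1 (u h) * N1 e <= B * (`|K| * s ^+ 3) by rewrite ler_pM ?N1_ge0.
  have := sq_ge0 e; move: h1 h2; clear; lra.
have Ns : N1 s%:C%C = s by rewrite N1_real ger0_norm.
have Ni : N1 (0 +i* s)%C = s by rewrite /N1 /= normr0 add0r ger0_norm.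
have k1 := key _ Ns; have k3 := key _ Ni.
have k2 := key (- s%:C%C); rewrite N1N in k2; have {}k2 := k2 Ns.
have k4 := key (- (0 +i* s)%C); rewrite N1N in k4; have {}k4 := k4 Ni.
have S : sq (u s%:C%C) + sq (u (- s%:C%C)) + sq (u (0 +i* s)%C) + sq (u (- (0 +i* s)%C)) =
  4 * (sq (f p) + sq a1 * s ^+ 2 + sq a2 * s ^+ 4).
  rewrite /u; case: (f p) (a1) (a2) => [x y] [x1 y1] [x2 y2].
  by rewrite /sq !expr2 !(cReD, cImD, cReM, cImM, cReN, cImN) /= ; ring.
have h1 : 0 <= sq a1 * s ^+ 2 by rewrite mulr_ge0 ?sq_ge0// exprn_ge0.
have h2 : 0 <= sq a2 * s ^+ 4 by rewrite mulr_ge0 ?sq_ge0// exprn_ge0.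
by move: k1 k2 k3 k4 S h1 h2; clear; lra.
Qed.

Lemma le_small (x M B : R) : (forall e, 0 < e -> x <= M + e * B) -> x <= M.
Proof.
move=> H; rewrite leNgt; apply/negP => Mx.
have B1 : 0 < `|B| + 1 by rewrite ltr_wpDl.
pose e := (x - M) / 2 / (`|B| + 1).
have xM : 0 < (x - M) / 2 by rewrite divr_gt0// subr_gt0.
have e0 : 0 < e by rewrite divr_gt0.
have h1 := H e e0.
have h2 : e * B <= (x - M) / 2.
  rewrite (@le_trans _ _ (e * (`|B| + 1)))//; last by rewrite /e divfK// gt_eqF.
  by rewrite (ler_wpM2l (ltW e0))//; have := ler_norm B; clear; lra.
by move: h1 h2 xM; clear; lra.
Qed.

(** Adding e |z|^2 makes |f|^2 strictly subharmonic, so its maximum over K cannot be interior and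
    lies in E; then e tends to 0. K and E stay abstract to serve triangles and squares alike. *)
Lemma max_principle f (K E : C -> Prop) (M B : R) : expands f ->
  (forall g, lip g -> exists p, K p /\ forall q, K q -> g q <= g p) ->
  (forall p, K p -> ~ E p -> exists2 r : R, 0 < r & forall h, N1 h <= r -> K (p + h)) ->
  (forall p, K p -> sq p <= B) ->
  (forall p, K p -> E p -> sq (f p) <= M) ->
  forall p, K p -> sq (f p) <= M.
Proof.
move=> ef att int bnd HE q Kq; apply: (@le_small _ _ B) => e e0.
have lg : lip (fun z => sq (f z) + e * sq z).
  by apply: lipD; [exact: lip_sq|apply: lipZ; exact: (lip_sq (@expands_id R))].
have [p [Kp Hp]] := att _ lg.
have [Ep|nEp] := boolp.pselect (E p).
  have h1 := Hp q Kq; have h2 := HE p Kp Ep.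
  have h3 : e * sq p <= e * B by rewrite (ler_wpM2l (ltW e0))// bnd.
  have h4 : 0 <= e * sq q by rewrite mulr_ge0 ?sq_ge0// ltW.
  by move: h1 h2 h3 h4; clear; lra.
exfalso.
have [r r0 Hr] := int p Kp nEp; have [L [d [d0 Hd]]] := second_difference p ef.
have L1 : 0 < `|L| + 1 by rewrite ltr_wpDl.
(* At an interior maximum the four neighbours at distance s would give 4 e s^2 <= L s^3; the bound s
   <= e / (|L| + 1) makes L s^3 <= e s^2. *)
pose s := Num.min r (Num.min d (e / (`|L| + 1))).
have s0 : 0 < s by rewrite !lt_min r0 d0 divr_gt0.
have sr : s <= r by rewrite ge_min lexx.
have sd : s <= d by rewrite !ge_min lexx orbT.
have se : s <= e / (`|L| + 1) by rewrite !ge_min lexx !orbT.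
have Ns : N1 s%:C%C = s by rewrite N1_real ger0_norm// ltW.
have Ni : N1 (0 +i* s)%C = s by rewrite /N1 /= normr0 add0r ger0_norm// ltW.
have k1 := Hp _ (Hr s%:C%C _); rewrite Ns in k1; have {}k1 := k1 sr.
have k2 := Hp _ (Hr (- s%:C%C) _); rewrite N1N Ns in k2; have {}k2 := k2 sr.
have k3 := Hp _ (Hr (0 +i* s)%C _); rewrite Ni in k3; have {}k3 := k3 sr.
have k4 := Hp _ (Hr (- (0 +i* s)%C) _); rewrite N1N Ni in k4; have {}k4 := k4 sr.
have sI : 0 <= s <= d by rewrite (ltW s0).
have k5 := Hd s sI.
have S : e * sq (p + s%:C%C) + e * sq (p - s%:C%C) + e * sq (p + (0 +i* s)%C) +
    e * sq (p - (0 +i* s)%C) = 4 * (e * sq p) + 4 * (e * s ^+ 2).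
  by rewrite /sq !(cReD, cImD, cReN, cImN) /=; ring.
have h1 : L * s ^+ 3 <= e * s ^+ 2.
  rewrite exprSr [_ * s]mulrC mulrA ler_wpM2r ?exprn_ge0 ?(ltW s0)//.
  rewrite (@le_trans _ _ ((`|L| + 1) * s))//; last by rewrite mulrC -ler_pdivlMr.
  by rewrite ler_wpM2r ?(ltW s0)// ler_wpDr// ler_norm.
have h2 : 0 < e * s ^+ 2 by rewrite mulr_gt0// exprn_gt0.
by move: k1 k2 k3 k4 k5 S h1 h2; clear; lra.
Qed.

End maximum_principle.

(** * The Phragmén-Lindelöf principle *)

Section phragmen_lindelof.
Variable R : realType.
Local Notation C := R[i].
Local Notation Re := complex.Re.
Local Notation Im := complex.Im.
Implicit Types (f : C -> C) (p q h k : C).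

Lemma Re_le_N1 h : `|Re h| <= N1 h. Proof. by rewrite /N1 lerDl. Qed.
Lemma Im_le_N1 h : `|Im h| <= N1 h. Proof. by rewrite /N1 lerDr. Qed.

Lemma max_triangle f (L t M : R) : expands f -> 0 <= L -> 0 < t ->
  (forall p, Re p = L -> `|Im p| <= t * Re p -> sq (f p) <= M) ->
  (forall p, 0 <= Re p <= L -> `|Im p| = t * Re p -> sq (f p) <= M) ->
  forall p, 0 <= Re p <= L -> `|Im p| <= t * Re p -> sq (f p) <= M.
Proof.
move=> ef L0 t0 H1 H2 p pL pt.
pose K p := 0 <= Re p <= L /\ `|Im p| <= t * Re p.
pose E p := Re p = L \/ `|Im p| = t * Re p.
apply: (@max_principle R f K E M (L ^+ 2 + (t * L) ^+ 2) ef) => //.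
- move=> g lg; have h11 : -1 <= 1 :> R by clear; lra.
  have [x [y [/andP[x0 xL] yI H]]] := lip_max t 0 L0 h11 lg.
  exists (x +i* ((t * x + 0) * y))%C; split.
    split; rewrite /= ?x0// addr0 normrM ger0_norm ?mulr_ge0//; last exact: ltW.
    by rewrite ler_piMr ?mulr_ge0// ?ler_norml//; exact: ltW.
  move=> [a b] [/= /andP[a0 aL] bt].
  (* The parametrisation collapses at the vertex, where b / (t a) makes no sense. *)
  have [a00|a00] := eqVneq a 0.
    have b00 : b = 0 by apply/eqP; rewrite -normr_le0 (le_trans bt)// a00 mulr0.
    have := H a 0; rewrite a0 aL mulr0 a00 b00; apply=> //.
    by rewrite lerN10 ler01.
  have ta : 0 < t * a by rewrite mulr_gt0// lt_neqAle eq_sym a00.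
  have := H a (b / (t * a)); rewrite addr0 [t * a * _]mulrC divfK ?gt_eqF//; apply.
    by rewrite a0.
  by rewrite -ler_norml normrM normfV (ger0_norm (ltW ta)) ler_pdivrMr// mul1r.
- move=> [a b] [/= /andP[a0 aL] bt] nE.
  have aL' : a < L by rewrite lt_neqAle aL andbT; apply/eqP => e; apply: nE; left.
  have bt' : `|b| < t * a by rewrite lt_neqAle bt andbT; apply/eqP => e; apply: nE; right.
  have t1 : 0 < 1 + t by rewrite addr_gt0.
  exists (Num.min (L - a) ((t * a - `|b|) / (1 + t))).
    by rewrite lt_min !subr_gt0 aL' divr_gt0// subr_gt0.
  move=> h; rewrite le_min ler_pdivlMr// => /andP[h1 h2].
  have h3 := Re_le_N1 h; have h4 := Im_le_N1 h.
  have h5 := ler_norm (Re h); have h6 := ler_norm (- Re h); rewrite normrN in h6.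
  have h7 := ler_normD b (Im h); have h8 := N1_ge0 h.
  have h9 : t * (- Re h) <= t * N1 h by rewrite (ler_wpM2l (ltW t0))// (le_trans h6).
  have h10 : `|b + Im h| <= t * (a + Re h) by move: h2 h4 h7 h9; clear; lra.
  split; rewrite ?cReD ?cImD//=.
  have h11 : 0 <= t * (a + Re h) by rewrite (le_trans _ h10).
  rewrite pmulr_rge0// in h11; rewrite h11 /=.
  by move: h1 h3 h5; clear; lra.
- move=> q [/andP[q0 qL] qt]; rewrite /sq lerD//.
    by rewrite lerXn2r ?nnegrE.
  rewrite -(real_normK (num_real (Im q))) lerXn2r ?nnegrE//.
    by rewrite mulr_ge0// ltW.
  by rewrite (le_trans qt)// (ler_wpM2l (ltW t0)).
- by move=> q [qL qt] [e|e]; [apply: H1|apply: H2].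
Qed.

Lemma max_square f (L M : R) : expands f -> 0 <= L ->
  (forall p, L <= N1 p -> sq (f p) <= M) -> forall p, sq (f p) <= M.
Proof.
move=> ef L0 H p.
pose K p := `|Re p| <= L /\ `|Im p| <= L.
pose E p := `|Re p| = L \/ `|Im p| = L.
have [pL|/ltW] := leP (N1 p) L; last exact: H.
apply: (@max_principle R f K E M (L ^+ 2 + L ^+ 2) ef) => //.
- move=> g lg; have h11 : - L <= L by rewrite ge0_cp.
  have [x [y [xI yI HH]]] := lip_max 0 1 h11 h11 lg.
  exists (x +i* ((0 * x + 1) * y))%C; split.
    by split; rewrite /= ?mul0r ?add0r ?mul1r ler_norml.
  move=> [a b] [/= aL bL]; have := HH a b; rewrite mul0r add0r mul1r.
  by apply; rewrite -ler_norml.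
- move=> q [aL bL] nE.
  have aL' : `|Re q| < L by rewrite lt_neqAle aL andbT; apply/eqP => e; apply: nE; left.
  have bL' : `|Im q| < L by rewrite lt_neqAle bL andbT; apply/eqP => e; apply: nE; right.
  exists (Num.min (L - `|Re q|) (L - `|Im q|)); first by rewrite lt_min !subr_gt0 aL'.
  move=> h; rewrite le_min => /andP[h1 h2].
  have h3 := Re_le_N1 h; have h4 := Im_le_N1 h.
  split; rewrite ?cReD ?cImD.
    have := ler_normD (Re q) (Re h); move: h1 h3; clear; lra.
  have := ler_normD (Im q) (Im h); move: h2 h4; clear; lra.
- move=> q [aL bL]; rewrite /sq -(real_normK (num_real (Re q))) -(real_normK (num_real (Im q))).
  by rewrite lerD// lerXn2r ?nnegrE.
- by move=> q [_ _] [e|e]; apply: H; rewrite /N1 -e ?lerDl ?lerDr.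
- by split; [apply: le_trans (Re_le_N1 p) pL|apply: le_trans (Im_le_N1 p) pL].
Qed.

(** On |Im z| <= t Re z with t < 1, Re (z^2) >= (1 - t^2) (Re z)^2, so exp (- e z^2) is at most 1 in
    modulus and beats any exponential on a far vertical edge; then e tends to 0. *)
Lemma phragmen_lindelof f (t A B M : R) : expands f -> 0 < t < 1 -> 0 <= A -> 0 <= B -> 0 < M ->
  (forall p, 0 <= Re p -> `|Im p| <= t * Re p -> sq (f p) <= A * expR (B * Re p)) ->
  (forall p, 0 <= Re p -> `|Im p| = t * Re p -> sq (f p) <= M) ->
  forall p, 0 <= Re p -> `|Im p| <= t * Re p -> sq (f p) <= M.
Proof.
move=> ef /andP[t0 t1] A0 B0 M0 HA HM p p0 pt.
pose w := Re p ^+ 2 - Im p ^+ 2.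
apply: (@le_small _ _ _ (2 * w * sq (f p))) => e e0.
pose c := 2 * e * (1 - t ^+ 2).
have t21 : t ^+ 2 < 1 by rewrite expr_lt1// ltW.
have c0 : 0 < c by rewrite !mulr_gt0// subr_gt0.
(* The edge Re z = L lies beyond p. There c L >= B + 1 reduces the bound to A exp (- L), and A / M
   <= L <= exp L brings it below M. *)
pose L := Num.max (Re p) (Num.max ((B + 1) / c) (Num.max (A / M) 1)).
have Lp : Re p <= L by rewrite le_max lexx.
have LB : (B + 1) / c <= L by rewrite !le_max lexx !orbT.
have LA : A / M <= L by rewrite !le_max lexx !orbT.
have L1 : 1 <= L by rewrite !le_max lexx !orbT.
have L0 : 0 < L by exact: lt_le_trans L1.
pose g z := f z * cexp (- (e%:C%C) * z ^+ 2).
have sqg z : sq (g z) = sq (f z) * expR (- (2 * e * (Re z ^+ 2 - Im z ^+ 2))).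
  rewrite sqM sq_cexp -expRM_natl; congr (_ * expR _).
  by rewrite !expr2 !(cReM, cImM, cReN, cImN) /=; ring.
have eg : expands g.
  apply: expandsM => //; apply: (@expands_comp R (@cexp R) (fun z => - e%:C%C * z ^+ 2)).
    exact: expands_cexp.
  by apply: expandsZ; exact: expands_sqr.
have dec z : 0 <= Re z -> `|Im z| <= t * Re z ->
    c * Re z ^+ 2 <= 2 * e * (Re z ^+ 2 - Im z ^+ 2).
  move=> z0 zt; rewrite /c -mulrA; apply: ler_wpM2l; first by rewrite mulr_ge0// ltW.
  rewrite mulrBl mul1r lerD2l lerN2 -exprMn -(real_normK (num_real (Im z))).
  by rewrite lerXn2r ?nnegrE// mulr_ge0// ltW.
have dec1 z : 0 <= Re z -> `|Im z| <= t * Re z ->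
    expR (- (2 * e * (Re z ^+ 2 - Im z ^+ 2))) <= 1.
  move=> z0 zt; rewrite -[leRHS]expR0 ler_expR oppr_le0; apply: le_trans (dec z z0 zt).
  by rewrite mulr_ge0 ?exprn_ge0// ltW.
have far z : Re z = L -> `|Im z| <= t * Re z -> sq (g z) <= M.
  move=> zL zt; have z0 : 0 <= Re z by rewrite zL ltW.
  rewrite sqg; apply: (@le_trans _ _ (A * expR (B * L) * expR (- (c * L ^+ 2)))).
    rewrite ler_pM ?sq_ge0 ?expR_ge0//; first by rewrite -zL HA.
    by rewrite ler_expR lerN2 -zL dec.
  rewrite -mulrA -expRD.
  have h1 : (B + 1) * L <= c * L ^+ 2.
    rewrite expr2 mulrA (ler_wpM2r (ltW L0))// mulrC -ler_pdivrMr//.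
  apply: (@le_trans _ _ (A * expR (- L))).
    by rewrite ler_wpM2l// ler_expR; move: h1; clear; lra.
  rewrite expRN ler_pdivrMr ?expR_gt0// -ler_pdivrMl// mulrC (le_trans LA)//.
  by rewrite (le_trans _ (expR_ge1Dx _))// lerDr.
have edge z : 0 <= Re z <= L -> `|Im z| = t * Re z -> sq (g z) <= M.
  move=> /andP[z0 _] zt; rewrite sqg (le_trans _ (HM z z0 zt))//.
  by rewrite ler_piMr ?sq_ge0// dec1// zt.
have pI : 0 <= Re p <= L by rewrite p0.
have := max_triangle eg (ltW L0) t0 far edge pI pt.
rewrite sqg -/w.
have := expR_ge1Dx (- (2 * e * w)) => h1 h2.
have h3 : sq (f p) * (1 - 2 * e * w) <= M.
  by rewrite (le_trans _ h2)// ler_wpM2l ?sq_ge0.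
by move: h3; clear; lra.
Qed.

End phragmen_lindelof.

(** * Vanishing of even entire functions *)

Section vanishing.
Variable R : realType.
Local Notation C := R[i].
Local Notation Re := complex.Re.
Local Notation Im := complex.Im.
Implicit Types (f : C -> C) (p q h k e : C).

(* The coordinate [conj (e1 + e2) * k] puts the bisector of the sector on the positive real axis. *)
Lemma sector_bound f e1 e2 (A B M : R) : expands f -> sq e1 = 1 -> sq e2 = 1 ->
  0 < Re e1 * Re e2 + Im e1 * Im e2 < 1 -> 0 <= A -> 0 <= B -> 0 < M ->
  (forall k, sq (f k) <= A * expR (B * N1 k)) ->
  (forall r : R, 0 <= r -> sq (f (r%:C%C * e1)) <= M) ->
  (forall r : R, 0 <= r -> sq (f (r%:C%C * e2)) <= M) ->
  forall u v : R, 0 <= u -> 0 <= v -> sq (f (u%:C%C * e1 + v%:C%C * e2)) <= M.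
Proof.
move=> ef s1 s2 /andP[]; set d := _ + _ => d0 d1 A0 B0 M0 HA H1 H2 u v u0 v0.
(* Up to sign, [d] and [x] are the cosine and sine of the opening of the sector, and [t] below is
   the tangent of its half; d > 0 yields t < 1. *)
pose x := Im e1 * Re e2 - Re e1 * Im e2.
have xd : x ^+ 2 + d ^+ 2 = 1.
  by rewrite -[RHS](mulr1 1) -{1}s1 -{1}s2 /x /d /sq; ring.
have d10 : 0 < 1 + d by rewrite addr_gt0.
pose t := `|x| / (1 + d).
have x0 : 0 < `|x|.
  rewrite normr_gt0; apply/negP => /eqP x0.
  have : d ^+ 2 < 1 by rewrite expr_lt1// ltW.
  by rewrite -xd x0 expr0n add0r ltxx.
have x1 : `|x| < 1 + d.
  rewrite -ltr_sqr ?nnegrE ?ltW// real_normK ?num_real//.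
  have := mulr_gt0 d0 d0; rewrite -expr2 => dd; move: xd d0 dd; rewrite sqrrD; clear; lra.
have t01 : 0 < t < 1 by rewrite divr_gt0//= ltr_pdivrMr// mul1r.
(* As |E|^2 = 2 (1 + d), multiplication by [nu] inverts multiplication by the conjugate of [E]. *)
pose E := e1 + e2; pose nu := (2 * (1 + d))^-1%:C%C * E.
have nuK k : nu * ((E^*)%C * k) = k.
  rewrite /nu mulrA -[_ * E * _]mulrA sq_conj.
  have -> : sq E = 2 * (1 + d).
    by rewrite /E /sq cReD cImD; move: s1 s2; rewrite /sq /d; clear; lra.
  rewrite (_ : _ * _%:C%C = 1) ?mul1r//.
  apply: complex_eqP; rewrite ?cReM ?cImM /= ?mulr0 ?mul0r ?subr0 ?addr0//.
  by rewrite mulVf// gt_eqF// mulr_gt0.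
have ReE (a b : R) : Re ((E^*)%C * (a%:C%C * e1 + b%:C%C * e2)) = (a + b) * (1 + d).
  rewrite (_ : _ * (1 + d) = a * sq e1 + b * sq e2 + (a + b) * d); last by rewrite s1 s2; ring.
  by rewrite /E !(cReM, cReD, cImD, cReJ, cImJ, cImM) /= /sq /d; ring.
have ImE (a b : R) : Im ((E^*)%C * (a%:C%C * e1 + b%:C%C * e2)) = x * (a - b).
  by rewrite /E !(cReM, cReD, cImD, cReJ, cImJ, cImM) /= /x; ring.
pose F l := f (nu * l).
have eF : expands F.
  by apply: (@expands_comp R f ( *%R nu)) => //; apply: expandsZ; exact: expands_id.
pose B' := B * (N1 nu * (1 + t)).
have [t0 t1] := andP t01.
have B'0 : 0 <= B' by rewrite !mulr_ge0 ?N1_ge0// addr_ge0// ltW.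
have txE : t * (1 + d) = `|x| by rewrite /t divfK// gt_eqF.
have := @phragmen_lindelof R F t A B' M eF t01 A0 B'0 M0 _ _ ((E^*)%C * (u%:C%C * e1 + v%:C%C * e2)).
rewrite /F nuK; apply.
- move=> p p0 pt; apply: (le_trans (HA _)); rewrite ler_wpM2l// ler_expR /B' -[leRHS]mulrA.
  apply: ler_wpM2l => //; apply: (le_trans (N1M _ _)); rewrite -[leRHS]mulrA.
  by apply: ler_wpM2l; [exact: N1_ge0|rewrite /N1 (ger0_norm p0) mulrDl mul1r lerD2l].
- move=> p p0 pt; pose s := Re p / (1 + d).
  have s0 : 0 <= s by rewrite divr_ge0// ltW.
  have ps : Re p = s * (1 + d) by rewrite /s divfK// gt_eqF.
  have : `|Im p| = `|x * s| by rewrite pt ps mulrCA txE mulrC normrM (ger0_norm s0).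
  move=> /eqP; rewrite eqr_norm2 => /orP[] /eqP ip.
    have -> : p = (E^*)%C * (s%:C%C * e1 + 0%:C%C * e2).
      by apply: complex_eqP; rewrite ?ReE ?ImE ?addr0 ?subr0.
    by rewrite nuK mul0r addr0 H1.
  have -> : p = (E^*)%C * (0%:C%C * e1 + s%:C%C * e2).
    by apply: complex_eqP; rewrite ?ReE ?ImE ?add0r ?sub0r ?mulrN.
  by rewrite nuK mul0r add0r H2.
- by rewrite ReE; apply: mulr_ge0; [exact: addr_ge0|exact: ltW].
- rewrite ReE ImE normrM mulrCA txE mulrC ler_wpM2r//.
  by rewrite ler_norml; move: u0 v0; clear; lra.
Qed.

(** Three sectors, bounded by the directions 1, c + i s, - c + i s and - 1: c > 0 keeps the outer
    ones below a right angle, c < s the middle one. *)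
Lemma half_plane_bound f (c s A B M : R) : expands f -> 0 < c -> c < s -> c ^+ 2 + s ^+ 2 = 1 ->
  0 <= A -> 0 <= B -> 0 < M -> (forall k, sq (f k) <= A * expR (B * N1 k)) ->
  (forall r : R, sq (f r%:C%C) <= M) ->
  (forall r : R, 0 <= r -> sq (f (r * c +i* (r * s))%C) <= M) ->
  (forall r : R, 0 <= r -> sq (f (r * - c +i* (r * s))%C) <= M) ->
  forall k, 0 <= Im k -> sq (f k) <= M.
Proof.
move=> ef c0 cs cs1 A0 B0 M0 HA Hr H1 H2 [x y] /= y0.
have s0 : 0 < s by exact: lt_trans cs.
have c1 : c < 1.
  rewrite -ltr_sqr ?nnegrE ?ltW// expr1n -cs1 ltrDl exprn_gt0//.
pose e0 : C := (1 +i* 0)%C; pose e1 : C := (c +i* s)%C.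
pose e2 : C := (- c +i* s)%C; pose e3 : C := (- 1 +i* 0)%C.
have R0 (r : R) : 0 <= r -> sq (f (r%:C%C * e0)) <= M.
  move=> _; rewrite (_ : r%:C%C * e0 = r%:C%C)//.
  by apply: complex_eqP; rewrite ?cReM ?cImM /=; ring.
have R1 (r : R) : 0 <= r -> sq (f (r%:C%C * e1)) <= M.
  move=> /H1; rewrite (_ : r%:C%C * e1 = (r * c +i* (r * s))%C)//.
  by apply: complex_eqP; rewrite ?cReM ?cImM /=; ring.
have R2 (r : R) : 0 <= r -> sq (f (r%:C%C * e2)) <= M.
  move=> /H2; rewrite (_ : r%:C%C * e2 = (r * - c +i* (r * s))%C)//.
  by apply: complex_eqP; rewrite ?cReM ?cImM /=; ring.
have R3 (r : R) : 0 <= r -> sq (f (r%:C%C * e3)) <= M.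
  move=> _; have := Hr (- r); rewrite (_ : r%:C%C * e3 = (- r)%:C%C)//.
  by apply: complex_eqP; rewrite ?cReM ?cImM /=; ring.
have n0 : sq e0 = 1 by rewrite /sq /=; ring.
have n1 : sq e1 = 1 by rewrite /sq /=.
have n2 : sq e2 = 1 by rewrite /sq /= sqrrN.
have n3 : sq e3 = 1 by rewrite /sq /=; ring.
have ys : 0 <= y / s by rewrite divr_ge0// ltW.
(* y / s * c is the abscissa at height y of the ray of direction c + i s; in each case the weights
   are the coordinates of k along the two sides of its sector. *)
have [h|h] := leP (y / s * c) x.
  have d : 0 < Re e0 * Re e1 + Im e0 * Im e1 < 1 by rewrite /= mul1r mul0r addr0 c0.
  have := sector_bound ef n0 n1 d A0 B0 M0 HA R0 R1 (_ : 0 <= x - y / s * c) ys.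
  rewrite subr_ge0 h => /(_ isT); congr (sq (f _) <= M).
  by apply: complex_eqP; rewrite ?(cReD, cImD) ?cReM ?cImM /=; field; rewrite gt_eqF.
have [h'|h'] := leP x (- (y / s * c)).
  have d : 0 < Re e2 * Re e3 + Im e2 * Im e3 < 1.
    by rewrite /= mulrNN mulr1 mulr0 addr0 c0.
  have := sector_bound ef n2 n3 d A0 B0 M0 HA R2 R3 ys (_ : 0 <= - x - y / s * c).
  rewrite subr_ge0 lerNr h' => /(_ isT); congr (sq (f _) <= M).
  by apply: complex_eqP; rewrite ?(cReD, cImD) ?cReM ?cImM /=; field; rewrite gt_eqF.
have d : 0 < Re e1 * Re e2 + Im e1 * Im e2 < 1.
  have : c * c < s * s by rewrite ltr_pM ?ltW.
  have := mulr_gt0 c0 c0; move: cs1; rewrite /= !expr2; clear; lra.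
have xc1 : x / c < y / s by rewrite ltr_pdivrMr.
have xc2 : - (y / s) < x / c by rewrite ltr_pdivlMr// mulNr.
have := sector_bound ef n1 n2 d A0 B0 M0 HA R1 R2
  (_ : 0 <= (y / s + x / c) / 2) (_ : 0 <= (y / s - x / c) / 2).
move=> H; have {}H : sq (f (((y / s + x / c) / 2)%:C%C * e1 + ((y / s - x / c) / 2)%:C%C * e2)) <= M.
  by apply: H; move: xc1 xc2; clear; lra.
move: H; congr (sq (f _) <= M).
by apply: complex_eqP; rewrite ?(cReD, cImD) ?cReM ?cImM /=; field; rewrite !gt_eqF.
Qed.

(** k f(k) is bounded in the upper half-plane by sectors and in the lower one by parity; then f is
    O(1 / |k|) and the maximum principle on ever larger squares gives 0. *)
Lemma even_entire_eq0 f (c s A B M r0 : R) : expands f -> (forall k, f (- k) = f k) ->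
  0 < c -> c < s -> c ^+ 2 + s ^+ 2 = 1 -> 0 <= A -> 0 <= B ->
  let g k := k * f k in
  (forall k, r0 <= N1 k -> sq (g k) <= A * expR (B * N1 k)) ->
  (forall r : R, r0 <= r -> sq (g r%:C%C) <= M) ->
  (forall r : R, r0 <= r -> sq (g (r * c +i* (r * s))%C) <= M) ->
  (forall r : R, r0 <= r -> sq (g (r * - c +i* (r * s))%C) <= M) ->
  forall k, f k = 0.
Proof.
move=> ef fe c0 cs cs1 A0 B0 g HA Hr H1 H2.
have s0 : 0 < s by exact: lt_trans cs.
have eg : expands g by apply: expandsM => //; exact: expands_id.
have gN k : sq (g (- k)) = sq (g k) by rewrite /g fe mulNr /sq cReN cImN !sqrrN.
(* The estimates are assumed only beyond r0; compactness covers N1 k <= r1. The factor 2 is there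
   because on the rays N1 k may reach 2 r. *)
pose r1 := 2 * (`|r0| + 1); have r10 : 0 <= r1 by rewrite mulr_ge0// addr_ge0.
have [M0 M00 HM0] : exists2 M0, 0 <= M0 & forall k, N1 k <= r1 -> sq (g k) <= M0.
  have h11 : - r1 <= r1 by rewrite ge0_cp.
  have [x [y [_ _ H]]] := lip_max 0 1 h11 h11 (lip_sq eg).
  exists (sq (g (x +i* ((0 * x + 1) * y))%C)); first exact: sq_ge0.
  move=> [a b] abr; have := H a b; rewrite mul0r add0r mul1r; apply; rewrite -ler_norml.
    exact: le_trans (Re_le_N1 _) abr.
  exact: le_trans (Im_le_N1 _) abr.
pose M' := `|M| + M0 + 1.
have M'0 : 0 < M' by rewrite ltr_wpDl// addr_ge0.
have MM' : M <= M' by rewrite /M'; have := ler_norm M; move: M00; clear; lra.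
have M0M' : M0 <= M' by rewrite /M'; have := normr_ge0 M; clear; lra.
have r0r : r0 <= r1 by rewrite /r1; have := ler_norm r0; have := normr_ge0 r0; clear; lra.
have HA' k : sq (g k) <= (A + M0) * expR (B * N1 k).
  rewrite mulrDl; have [h|/ltW h] := leP (N1 k) r1.
    rewrite (le_trans (HM0 k h))// -[leLHS]add0r lerD ?mulr_ge0 ?expR_ge0//.
    by rewrite ler_peMr// -[leLHS]expR0 ler_expR mulr_ge0// N1_ge0.
  by rewrite (le_trans (HA k (le_trans r0r h)))// lerDl mulr_ge0// expR_ge0.
have b0 (r : R) : sq (g r%:C%C) <= M'.
  wlog rr : r / 0 <= r => [H|].
    have [|/ltW h] := leP 0 r; first exact: H.
    rewrite -[r]opprK (_ : (- - r)%:C%C = - (- r)%:C%C) ?gN ?H ?oppr_ge0//.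
    by apply: complex_eqP; rewrite /= ?oppr0.
  have [h|/ltW h] := leP r r1; last by rewrite (le_trans (Hr r (le_trans r0r h))).
  by rewrite (le_trans (HM0 _ _))// N1_real ger0_norm.
have ray (c' : R) : `|c'| = c -> (forall r : R, r0 <= r -> sq (g (r * c' +i* (r * s))%C) <= M) ->
    forall r : R, 0 <= r -> sq (g (r * c' +i* (r * s))%C) <= M'.
  move=> cc H r rr; have [h|/ltW h] := leP r (`|r0|).
    rewrite (le_trans (HM0 _ _))// /N1 /= !normrM cc (ger0_norm rr) (ger0_norm (ltW s0)).
    have c1 : c <= 1 by rewrite -ler_sqr ?nnegrE ?ltW// expr1n -cs1 ltrDl exprn_gt0.
    have s1 : s <= 1 by rewrite -ler_sqr ?nnegrE ?ltW// expr1n -cs1 ltrDr exprn_gt0.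
    have h1 : r * c <= r by rewrite ler_piMr.
    have h2 : r * s <= r by rewrite ler_piMr.
    by rewrite /r1; move: h h1 h2; clear; lra.
  by rewrite (le_trans (H _ _))// (le_trans (ler_norm r0)).
have upper := half_plane_bound eg c0 cs cs1 (addr_ge0 A0 M00) B0 M'0 HA' b0
  (ray c (ger0_norm (ltW c0)) H1) (ray (- c) _ H2).
have all k : sq (g k) <= M'.
  have [h|/ltW h] := leP 0 (Im k); first by apply: upper => //; rewrite normrN ger0_norm// ltW.
  by rewrite -gN; apply: upper; rewrite ?normrN ?(ger0_norm (ltW c0))// cImN oppr_ge0.
(* Where N1 p >= L one has |p|^2 >= L^2 / 2, so |p f(p)|^2 <= M' bounds |f|^2 by 2 M' / L^2. *)
move=> k; have bound (L : R) : 0 < L -> sq (f k) <= 2 * M' / L ^+ 2.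
  move=> L0; apply: (max_square ef (ltW L0)) => p pL.
  rewrite ler_pdivlMr ?exprn_gt0//.
  have h1 : L ^+ 2 <= 2 * sq p.
    by rewrite (le_trans _ (N1_le_sq p))// lerXn2r// nnegrE ?N1_ge0 ?ltW.
  have h2 := all p; rewrite sqM in h2.
  have h3 : sq (f p) * L ^+ 2 <= sq (f p) * (2 * sq p) by rewrite ler_wpM2l// sq_ge0.
  by move: h2 h3; clear; lra.
have sq0 : sq (f k) <= 0.
  apply: (@le_small _ _ _ (2 * M')) => e e0; rewrite add0r.
  have e1 : 0 < 1 + 1 / e by rewrite addr_gt0// divr_gt0.
  apply: (le_trans (bound _ e1)); rewrite mulrC; apply: ler_wpM2r.
    by rewrite mulr_ge0// ltW.
  rewrite -[leRHS]invrK lef_pV2 ?posrE ?invr_gt0 ?exprn_gt0// -div1r.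
  have e2 : 0 < 1 / e by rewrite divr_gt0.
  have := mulr_gt0 e2 e2; rewrite expr2; move: e2; clear; nra.
apply: N1_eq0; rewrite leNgt; apply/negP => N0.
have := N1_le_sq (f k); rewrite leNgt => /negP; apply.
by apply: (@le_lt_trans _ _ 0); [move: sq0; clear; lra|rewrite exprn_gt0].
Qed.

End vanishing.

(** * The entire matrix W and its growth *)

Section wronskian_type_matrix.
Variables (R : realType) (m : nat).
Local Notation C := R[i].
Local Notation Im := complex.Im.
Implicit Types (Q : R -> 'M[C]_m).

Definition init_sol Q (U0 V0 : 'M[C]_m) (U V : C -> R -> 'M[C]_m) :=
  forall z, [/\ sol Q z (U z) (V z), U z 0 = U0 & V z 0 = V0].

Lemma init_sol_exists Q U0 V0 : mxL1 Q -> exists U V, init_sol Q U0 V0 U V.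
Proof.
move=> hQ.
have /boolp.choice[F HF] : forall z, exists UV : (R -> 'M[C]_m) * (R -> 'M[C]_m),
    [/\ sol Q z UV.1 UV.2, UV.1 0 = U0 & UV.2 0 = V0].
  by move=> z; have [U [V H]] := sol_exists z U0 V0 hQ; exists (U, V).
by exists (fun z => (F z).1), (fun z => (F z).2).
Qed.

Lemma expands_init_sol Q U0 V0 U V x i j : mxL1 Q -> init_sol Q U0 V0 U V -> 0 <= x ->
  expands (fun z => U z x i j).
Proof.
move=> hQ H x0 z.
have X0 : 0 < x + 1 by rewrite ltr_wpDl.
have [U1 [U2 [K HK]]] := sol_taylor z hQ X0 (fun w => let: And3 a _ _ := H w in a)
  (fun w => let: And3 _ a _ := H w in a) (fun w => let: And3 _ _ a := H w in a).
exists (U1 x i j), (U2 x i j), K, 1; split=> [|h h1]; first by rewrite ltr01 lexx.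
have xX : 0 <= x <= x + 1 by rewrite x0 lerDl ler01.
have := le_trans (N1_le_mxN _ i j) (HK h h1 x xX).
by rewrite !mxE ![_ * h]mulrC ![_ * h ^+ 2]mulrC.
Qed.

Local Notation n0 := (mxN (1%:M : 'M[C]_m)).

Lemma mxN1_ge0 : 0 <= n0. Proof. exact: mxN_ge0. Qed.
#[local] Hint Resolve mxN1_ge0 : core.

Lemma init_sol_bounds Q th thd ph phd X : mxL1 Q -> 0 < X ->
  init_sol Q 1%:M 0 th thd -> init_sol Q 0 1%:M ph phd ->
  exists2 r : R, 0 < r & forall k x, 0 <= Im k -> r <= N1 k -> 0 <= x <= X ->
    mxN (th (k ^+ 2) x) <= 8 * n0 * expR (Im k * x) /\
    mxN (ph (k ^+ 2) x) <= 8 * n0 / N1 k * expR (Im k * x).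
Proof.
move=> hQ X0 Hth Hph; set q := 8 * rint (fun t => mxN (Q t)) X.
exists (`|q| + 1) => [|k x k0 rk /andP[x0 xX]]; first by rewrite ltr_wpDl.
have Nk : 0 < N1 k by apply: lt_le_trans rk; rewrite ltr_wpDl.
have qk : q <= N1 k by rewrite (le_trans _ rk)//; have := ler_norm q; clear; lra.
have [a b c] := Hth (k ^+ 2); have [d e f] := Hph (k ^+ 2).
have := sol_growth hQ X0 a k0 Nk qk (lexx 0) x0 xX.
have := sol_growth hQ X0 d k0 Nk qk (lexx 0) x0 xX.
by rewrite b c e f subr0 mxN0 mul0r addr0 add0r mulrA.
Qed.

(** The root of the conjugate of k^2 in the same half-plane as k is minus the conjugate of k, to
    which the bounds for Im k >= 0 apply. *)
Lemma conj_sqr (k : C) : ((k ^+ 2)^*)%C = (- (k^*)%C) ^+ 2.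
Proof. by rewrite sqrrN rmorphXn. Qed.

Lemma mxN_cols p q (A : 'M[C]_(p, q)) : mxN A = \sum_j mxN (A *m delta_mx j 0 : 'cV[C]_p).
Proof.
rewrite /mxN exchange_big; apply: eq_bigr => j _; apply: eq_bigr => i _.
by rewrite big_ord_recl big_ord0 addr0 -colE mxE.
Qed.

(** Proved column by column, since the flux controls vectors; Im (k^2) and [c] have the same sign,
    so the flux condition takes the form that [weyl_dominated] expects. *)
Lemma weyl_decay Q X (c s : R) : mxL1 Q -> hermitian_ae Q -> 0 < X -> c != 0 -> 0 < s ->
  exists D r0 : R, [/\ 0 <= D, 0 < r0 & forall r, r0 <= r -> let k := (r * c +i* (r * s))%C in
    forall U V : R -> 'M[C]_m, sol Q (k ^+ 2) U V -> U 0 = 1%:M ->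
    (forall (v : 'cV[C]_m) x, 0 <= x -> 0 <= Im (k ^+ 2) * flux (U x *m v) (V x *m v)) ->
    forall x, 0 <= x <= X -> mxN (U x) <= D * expR (- (r * s * x))].
Proof.
move=> hQ sQ X0 c0 s0.
have [L [K [L0 HL]]] := weyl_dominated hQ sQ X0 c0 s0.
have [D D0 HD] := @dominated_decay R m L X L0 X0.
exists (D * n0), (`|K| + 1); split=> [||r Kr k U V sU U0 fl x xX].
- exact: mulr_ge0.
- by rewrite ltr_wpDl.
have r0 : 0 < r by apply: lt_le_trans Kr; rewrite ltr_wpDl.
have Kr' : K <= r by rewrite (le_trans _ Kr)//; have := ler_norm K; clear; lra.
rewrite mxN_cols [leRHS](_ : _ = \sum_j D * expR (- (r * s * x)) * mxN ((1%:M : 'M[C]_m) *m delta_mx j 0 : 'cV[C]_m)); last first.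
  by rewrite -mulr_sumr -mxN_cols; ring.
apply: ler_sum => j _; set v : 'cV[C]_m := delta_mx j 0.
have s' := sol_mulr v sU.
have fl' y : 0 <= y -> 0 <= c * flux (U y *m v) (V y *m v).
  move=> y0; have := fl v y y0.
  rewrite (_ : Im (k ^+ 2) = 2 * (r ^+ 2 * s) * c); last by rewrite expr2 cImM /k /=; ring.
  rewrite -[_ * c * _]mulrA pmulr_rge0//; apply: mulr_gt0 => //; apply: mulr_gt0 => //.
  exact: exprn_gt0.
have := HD _ _ (imag R * k) s'.1 (HL r Kr' _ _ s' fl') x xX.
by rewrite U0 Re_imag /k /= mulNr.
Qed.

Variables (Q1 Q2 : R -> 'M[C]_m) (th1 thd1 ph1 phd1 th2 thd2 ph2 phd2 : C -> R -> 'M[C]_m).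
Hypotheses (hQ1 : mxL1 Q1) (hQ2 : mxL1 Q2).
Hypotheses (s1 : hermitian_ae Q1) (s2 : hermitian_ae Q2).
Hypotheses (Hth1 : init_sol Q1 1%:M 0 th1 thd1) (Hph1 : init_sol Q1 0 1%:M ph1 phd1).
Hypotheses (Hth2 : init_sol Q2 1%:M 0 th2 thd2) (Hph2 : init_sol Q2 0 1%:M ph2 phd2).

Definition W z x := th1 z x *m adj (ph2 (z^*)%C x) - ph1 z x *m adj (th2 (z^*)%C x).

Lemma expands_W x i j : 0 <= x -> expands (fun z => W z x i j).
Proof.
move=> x0.
have e : expands (fun z => \sum_l th1 z x i l * (ph2 (z^*)%C x j l)^*%C +
    (-1) * \sum_l ph1 z x i l * (th2 (z^*)%C x j l)^*%C).
  apply: expandsD; last apply: expandsZ.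
    apply: expands_sum => l; apply: expandsM; first exact: expands_init_sol hQ1 Hth1 x0.
    exact: (@expands_conj R (fun z => ph2 z x j l) (expands_init_sol _ _ hQ2 Hph2 x0)).
  apply: expands_sum => l; apply: expandsM; first exact: expands_init_sol hQ1 Hph1 x0.
  exact: (@expands_conj R (fun z => th2 z x j l) (expands_init_sol _ _ hQ2 Hth2 x0)).
move: e; congr expands; apply: boolp.funext => z.
rewrite /W !mxE mulN1r; congr (_ - _); apply: eq_bigr => l _; rewrite adjE//.
Qed.

Lemma W_growth X : 0 < X -> exists A r : R, [/\ 0 <= A, 0 < r & forall k x, r <= N1 k -> 0 <= x <= X ->
  N1 k * mxN (W (k ^+ 2) x) <= A * expR (2 * X * `|Im k|)].
Proof.
move=> X0.
have [r1 r10 B1] := init_sol_bounds hQ1 X0 Hth1 Hph1.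
have [r2 r20 B2] := init_sol_bounds hQ2 X0 Hth2 Hph2.
exists (2 * (8 * n0) ^+ 2), (Num.max r1 r2); split.
- by rewrite mulr_ge0// exprn_ge0// mulr_ge0.
- by rewrite lt_max r10.
move=> k x; wlog k0 : k / 0 <= Im k => [H|].
  have [|/ltW h] := leP 0 (Im k); first exact: H.
  move=> rk xX; have := H (- k); rewrite N1N cImN oppr_ge0 sqrrN normrN; exact.
rewrite ge_max => /andP[k1 k2] xX; have Nk : 0 < N1 k by exact: lt_le_trans k1.
have [x0 xX'] := andP xX.
have Ek : expR (Im k * x) * expR (Im k * x) <= expR (2 * X * `|Im k|).
  rewrite -expRD ler_expR ger0_norm//.
  rewrite (_ : 2 * X * _ = Im k * X + Im k * X); last by ring.
  by rewrite lerD// ler_wpM2l.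
have [a1 b1] := B1 k x k0 k1 xX.
have := B2 (- (k^*)%C) x; rewrite cImN cImJ opprK N1N N1J -conj_sqr => /(_ k0 k2 xX)[a2 b2].
set e := expR (Im k * x) in a1 b1 a2 b2 Ek; have e0 : 0 <= e := expR_ge0 _.
have h1 : mxN (W (k ^+ 2) x) <= 2 * (8 * n0) ^+ 2 / N1 k * (e * e).
  rewrite /W (le_trans (mxNB _ _))//.
  have g1 : mxN (th1 (k ^+ 2) x *m adj (ph2 ((k ^+ 2)^*)%C x)) <= 8 * n0 * e * (8 * n0 / N1 k * e).
    by rewrite (le_trans (mxNM _ _))// mxN_adj ler_pM ?mxN_ge0.
  have g2 : mxN (ph1 (k ^+ 2) x *m adj (th2 ((k ^+ 2)^*)%C x)) <= 8 * n0 / N1 k * e * (8 * n0 * e).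
    by rewrite (le_trans (mxNM _ _))// mxN_adj ler_pM ?mxN_ge0.
  rewrite (_ : 2 * _ / _ * _ = 8 * n0 * e * (8 * n0 / N1 k * e) + 8 * n0 / N1 k * e * (8 * n0 * e));
    last by ring.
  exact: lerD.
rewrite (le_trans (ler_wpM2l (ltW Nk) h1))//.
rewrite (_ : N1 k * _ = 2 * (8 * n0) ^+ 2 * (e * e)); last by field; rewrite gt_eqF.
by rewrite ler_wpM2l// mulr_ge0// exprn_ge0// mulr_ge0.
Qed.

End wronskian_type_matrix.

(** * Boundedness of k W on the rays *)

Section ray_bounds.
Variables (R : realType) (m : nat).
Local Notation C := R[i].
Local Notation Im := complex.Im.
Local Notation n0 := (mxN (1%:M : 'M[C]_m)).
Variables (Q1 Q2 : R -> 'M[C]_m) (B1 B2 : (R -> 'cV[C]_m) -> Prop) (M1 M2 : C -> 'M[C]_m).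
Variables (th1 thd1 ph1 phd1 th2 thd2 ph2 phd2 : C -> R -> 'M[C]_m).
Hypotheses (pQ1 : potential Q1) (pQ2 : potential Q2).
Hypotheses (sa1 : sa_bc_at_infinity Q1 B1) (sa2 : sa_bc_at_infinity Q2 B2).
Hypotheses (wt1 : weyl_titchmarsh Q1 B1 M1) (wt2 : weyl_titchmarsh Q2 B2 M2).
Hypotheses (Hth1 : init_sol Q1 1%:M 0 th1 thd1) (Hph1 : init_sol Q1 0 1%:M ph1 phd1).
Hypotheses (Hth2 : init_sol Q2 1%:M 0 th2 thd2) (Hph2 : init_sol Q2 0 1%:M ph2 phd2).

Lemma init_sol_decomp Q z th thd ph phd (U V : R -> 'M[C]_m) (A : 'M[C]_m) : mxL1 Q ->
  init_sol Q 1%:M 0 th thd -> init_sol Q 0 1%:M ph phd -> sol Q z U V -> U 0 = 1%:M -> V 0 = A ->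
  forall x, 0 <= x -> U x = th z x + ph z x *m A.
Proof.
move=> hQ Hth Hph sU U0 V0; have [[pt pt'] t0 t1] := Hth z; have [[pp pp'] p0 p1] := Hph z.
have s : sol Q z (fun x => th z x + ph z x *m A) (fun x => thd z x + phd z x *m A).
  split; first by apply: primD => //; exact: primMr.
  apply: prim_eq (primD pt' (primMr A pp')) => x _.
  by rewrite mulmxDr scalerDr mulmxBl mulmxA -scalemxAl opprD addrACA.
by apply: (sol_unique hQ sU s); rewrite ?U0 ?V0 ?t0 ?p0 ?t1 ?p1 ?mul0mx ?mul1mx ?addr0 ?add0r.
Qed.

(** The second Weyl solution enters at the conjugate of z, that is on the mirrored ray k', so decay
    is used for both directions [c] and [- c]. *)
Lemma W_ray (c s a K0 r0 : R) : c != 0 -> 0 < s -> 0 < a ->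
  (forall r, r0 <= r -> let k := (r * c +i* (r * s))%C in
     mxN (M1 (k ^+ 2) - M2 (k ^+ 2)) <= K0 * expR (- (2 * (r * s) * a))) ->
  exists K r1 : R, forall r x, r1 <= r -> 0 <= x <= a -> let k := (r * c +i* (r * s))%C in
    N1 k * mxN (W th1 ph1 th2 ph2 (k ^+ 2) x) <= K.
Proof.
move=> c0 s0 a0 HM; have [hQ1 hh1] := pQ1; have [hQ2 hh2] := pQ2.
have [r1 r10 b1] := init_sol_bounds hQ1 a0 Hth1 Hph1.
have [r2 r20 b2] := init_sol_bounds hQ2 a0 Hth2 Hph2.
have [D1 [q1 [D10 q10 d1]]] := weyl_decay hQ1 hh1 a0 c0 s0.
have c0' : - c != 0 by rewrite oppr_eq0.
have [D2 [q2 [D20 q20 d2]]] := weyl_decay hQ2 hh2 a0 c0' s0.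
exists (8 * n0 * (D1 + D2) + (8 * n0) ^+ 2 * `|K0|).
exists (Num.max (Num.max r0 (Num.max q1 q2)) (Num.max 1 (Num.max r1 r2) / s)) => r x.
rewrite !ge_max ler_pdivrMr// !ge_max.
move=> /andP[/andP[r0r /andP[q1r q2r]] /andP[rs1 /andP[rs2 rs3]]] xa.
set k := (r * c +i* (r * s))%C; lazy zeta.
have [x0 xa'] := andP xa.
have rr : 0 < r by exact: lt_le_trans q1r.
have rs : 0 < r * s by rewrite mulr_gt0.
have Nk : r * s <= N1 k by rewrite /N1 /k /= (ger0_norm (ltW rs)) lerDr.
have Nk1 : 1 <= N1 k by exact: le_trans Nk.
have Nk0 : 0 < N1 k by exact: lt_le_trans Nk1.
pose k' := (r * - c +i* (r * s))%C.
have kk' : k' = - (k^*)%C by apply: complex_eqP; rewrite ?cReN ?cImN ?cReJ ?cImJ /k /=; ring.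
have Nk' : N1 k' = N1 k by rewrite kk' N1N N1J.
have kz : ((k ^+ 2)^*)%C = k' ^+ 2 by rewrite kk' conj_sqr.
have imz : Im (k ^+ 2) != 0.
  rewrite expr2 cImM /k /= (_ : _ + _ = (r * c) * (r * s) *+ 2); last by ring.
  by rewrite mulrn_eq0 /= !mulf_neq0// gt_eqF.
have imz' : Im ((k ^+ 2)^*)%C != 0 by rewrite cImJ oppr_eq0.
have [_ [U1 [V1 [sU1 U10 V10 f1]]]] := weyl_data pQ1 sa1 wt1 imz.
have [M2J _] := weyl_data pQ2 sa2 wt2 imz.
have [_ [U2 [V2 [sU2 U20 V20 f2]]]] := weyl_data pQ2 sa2 wt2 imz'.
have E1 := init_sol_decomp hQ1 Hth1 Hph1 sU1 U10 V10 x0.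
have E2 := init_sol_decomp hQ2 Hth2 Hph2 sU2 U20 V20 x0.
have B1' := d1 r q1r U1 V1 sU1 U10 f1 x xa.
have B2' : mxN (U2 x) <= D2 * expR (- (r * s * x)).
  by rewrite kz in sU2 f2; exact: (d2 r q2r U2 V2 sU2 U20 f2 x xa).
have [_ P1] := b1 k x (ltW rs) (le_trans rs2 Nk) xa.
have [_ P2] : mxN (th2 (k' ^+ 2) x) <= 8 * n0 * expR (Im k' * x) /\
    mxN (ph2 (k' ^+ 2) x) <= 8 * n0 / N1 k' * expR (Im k' * x).
  by apply: b2; rewrite ?Nk' ?(le_trans rs3)//; exact: ltW.
rewrite Nk' in P2; have B3 := HM r r0r.
rewrite [Im k]/= in P1; rewrite [Im k']/= in P2.
set e := expR (r * s * x) in P1 P2; have e0 : 0 < e := expR_gt0 _.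
rewrite expRN -/e in B1' B2'.
have WE : W th1 ph1 th2 ph2 (k ^+ 2) x = U1 x *m adj (ph2 (k' ^+ 2) x) -
  ph1 (k ^+ 2) x *m adj (U2 x) -
  ph1 (k ^+ 2) x *m ((M1 (k ^+ 2) - M2 (k ^+ 2)) *m adj (ph2 (k' ^+ 2) x)).
  rewrite E1 E2 /W kz adjD adjM -kz M2J kz.
  rewrite mulmxDl mulmxDr mulmxBl mulmxBr !mulmxA.
  by apply/matrixP => i j; rewrite !mxE; ring.
have nn : 0 <= 8 * n0 by rewrite mulr_ge0// mxN_ge0.
have T1 : mxN (U1 x *m adj (ph2 (k' ^+ 2) x)) <= 8 * n0 * D1 / N1 k.
  rewrite (le_trans (mxNM _ _))// mxN_adj.
  apply: (@le_trans _ _ (D1 / e * (8 * n0 / N1 k * e))); first by rewrite ler_pM ?mxN_ge0.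
  by rewrite le_eqVlt; apply/orP; left; apply/eqP; field; rewrite !gt_eqF.
have T2 : mxN (ph1 (k ^+ 2) x *m adj (U2 x)) <= 8 * n0 * D2 / N1 k.
  rewrite (le_trans (mxNM _ _))// mxN_adj.
  apply: (@le_trans _ _ (8 * n0 / N1 k * e * (D2 / e))); first by rewrite ler_pM ?mxN_ge0.
  by rewrite le_eqVlt; apply/orP; left; apply/eqP; field; rewrite !gt_eqF.
have T3 : mxN (ph1 (k ^+ 2) x *m ((M1 (k ^+ 2) - M2 (k ^+ 2)) *m adj (ph2 (k' ^+ 2) x))) <=
    (8 * n0) ^+ 2 * `|K0| / N1 k.
  (* The only place where x <= a matters: the decay exp (- 2 a Im k) of M1 - M2 compensates the
     growth exp (2 x Im k) of the two factors [ph1] and [ph2]. *)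
  have B4 : mxN (M1 (k ^+ 2) - M2 (k ^+ 2)) <= `|K0| * (e * e)^-1.
    apply: (le_trans B3); apply: (@le_trans _ _ (`|K0| * expR (- (2 * (r * s) * a)))).
      by rewrite ler_wpM2r ?expR_ge0// ler_norm.
    rewrite ler_wpM2l// -expRD -expRN ler_expR lerN2.
    have : r * s * x <= r * s * a by rewrite ler_wpM2l// ltW.
    by move: x0; nra.
  rewrite (le_trans (mxNM _ _))//.
  have B5 : mxN ((M1 (k ^+ 2) - M2 (k ^+ 2)) *m adj (ph2 (k' ^+ 2) x)) <=
      `|K0| * (e * e)^-1 * (8 * n0 / N1 k * e).
    by rewrite (le_trans (mxNM _ _))// mxN_adj ler_pM ?mxN_ge0.
  apply: (@le_trans _ _ (8 * n0 / N1 k * e * (`|K0| * (e * e)^-1 * (8 * n0 / N1 k * e)))).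
    by rewrite ler_pM ?mxN_ge0.
  rewrite [leLHS](_ : _ = (8 * n0) ^+ 2 * `|K0| / N1 k * (N1 k)^-1); last by field; rewrite !gt_eqF.
  rewrite ler_piMr ?invf_le1//; apply: divr_ge0; last exact: ltW.
  by rewrite mulr_ge0// exprn_ge0.
rewrite WE mulrC -ler_pdivlMr//.
apply: (le_trans (mxNB _ _)); rewrite mulrDl mulrDr mulrDl; apply: lerD => //.
by apply: (le_trans (mxNB _ _)); apply: lerD.
Qed.

End ray_bounds.

(** * Vanishing of W *)

Section uniqueness.
Variables (R : realType) (m : nat).
Local Notation C := R[i].
Local Notation Im := complex.Im.

Lemma mxN_le_norm p q (A : 'M[C]_(p, q)) (a : R) : `|A| <= a%:C%C ->
  mxN A <= (p * q)%:R * (2 * a).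
Proof.
move=> h.
have key i j : N1 (A i j) <= 2 * a.
  apply: N1_le_real; apply: le_trans h.
  rewrite [leRHS]/Num.norm /= mx_normE.
  exact: (le_bigmax _ (fun ij => `|A ij.1 ij.2|%:nng) (i, j)).
apply: (@le_trans _ _ (\sum_(i < p) \sum_(j < q) 2 * a)).
  by apply: ler_sum => i _; apply: ler_sum => j _.
by rewrite sumr_const sumr_const !card_ord -mulrnA [leRHS]mulr_natl mulnC.
Qed.

(** The two roots of k^2 are k and - k, and the branch picks the one with nonnegative imaginary
    part. *)
Lemma Im_sqrtC_sqr (k : C) : 0 < Im k -> Im (sqrtC (k ^+ 2)) = Im k.
Proof.
move=> k0; have := Im_rootC_ge0 (k ^+ 2) (isT : (1 < 2)%N); set w := sqrtC _.
rewrite -complexIm => w0; have {}w0 : 0 <= Im w by move: w0; rewrite ler0c.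
have /eqP : w ^+ 2 = k ^+ 2 by rewrite sqrtCK.
rewrite eqf_sqr => /orP[/eqP -> //|/eqP wk].
by move: w0; rewrite wk cImN oppr_ge0 leNgt k0.
Qed.

Variables (Q1 Q2 : R -> 'M[C]_m) (B1 B2 : (R -> 'cV[C]_m) -> Prop) (M1 M2 : C -> 'M[C]_m).
Variables (th1 thd1 ph1 phd1 th2 thd2 ph2 phd2 : C -> R -> 'M[C]_m).
Hypotheses (pQ1 : potential Q1) (pQ2 : potential Q2).
Hypotheses (sa1 : sa_bc_at_infinity Q1 B1) (sa2 : sa_bc_at_infinity Q2 B2).
Hypotheses (wt1 : weyl_titchmarsh Q1 B1 M1) (wt2 : weyl_titchmarsh Q2 B2 M2).
Hypotheses (Hth1 : init_sol Q1 1%:M 0 th1 thd1) (Hph1 : init_sol Q1 0 1%:M ph1 phd1).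
Hypotheses (Hth2 : init_sol Q2 1%:M 0 th2 thd2) (Hph2 : init_sol Q2 0 1%:M ph2 phd2).

Lemma W_eq0 (eps a : R) : 0 < eps < pi / 2 -> 0 < a -> ray_asymp M1 M2 (pi - eps) a ->
  forall x, 0 <= x <= a -> W th1 ph1 th2 ph2 0 x = 0.
Proof.
move=> /andP[e0 e1] a0 [K0 [r00 [_ HK]]] x xa.
have [hQ1 hh1] := pQ1; have [hQ2 hh2] := pQ2; have [x0 _] := andP xa.
pose b := (pi - eps) / 2; pose c := cos b; pose s := sin b.
have bb : pi - eps = b + b by rewrite /b; field.
have pi0 := pi_gt0 R.
have c0 : 0 < c.
  by apply: cos_gt0_pihalf; rewrite /b; apply/andP; split; lra.
have s0 : 0 < s.
  by apply: sin_gt0_pi; rewrite /b; apply/andP; split; lra.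
have cs1 : c ^+ 2 + s ^+ 2 = 1 by rewrite cos2Dsin2.
(* s^2 - c^2 = - cos (pi - eps) = cos eps, positive because eps < pi / 2. *)
have cs : c < s.
  rewrite -ltr_sqr ?nnegrE ?ltW// -subr_lt0 !expr2 -cosD -bb cosB cospi sinpi mul0r addr0 mulN1r.
  by rewrite oppr_lt0; apply: cos_gt0_pihalf; apply/andP; split; lra.
have kE (r : R) : on_ray (pi - eps) (r ^+ 2) = (r * c +i* (r * s))%C ^+ 2.
  rewrite /on_ray bb cosD sinD -/c -/s; apply: complex_eqP; rewrite expr2 ?cReM ?cImM /=; ring.
pose L := m%:R ^+ 2 * (2 * K0); pose r0 := `|r00| + 1.
have HM r : r0 <= r -> let k := (r * c +i* (r * s))%C in
    mxN (M1 (k ^+ 2) - M2 (k ^+ 2)) <= L * expR (- (2 * (r * s) * a)).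
  move=> rr; set k := (r * c +i* (r * s))%C; lazy zeta.
  have r1 : 1 <= r by rewrite (le_trans _ rr)// lerDr.
  have r20 : r00 < r ^+ 2.
    apply: (@lt_le_trans _ _ r); last by rewrite expr2 ler_peMl// (le_trans ler01).
    by apply: lt_le_trans rr; rewrite (le_lt_trans (ler_norm _))// ltrDl.
  have := HK _ r20; rewrite kE -/k Im_sqrtC_sqr /=; last by rewrite mulr_gt0// (lt_le_trans ltr01).
  move=> /mxN_le_norm h; apply: (le_trans h).
  by rewrite [leLHS](_ : _ = L * expR (- (2 * (r * s) * a)))// /L natrM; ring.
(* The hypothesis concerns one ray only; the symmetry of M1 and M2 carries it to the conjugate
   ray. *)
have HM' r : r0 <= r -> let k := (r * - c +i* (r * s))%C in
    mxN (M1 (k ^+ 2) - M2 (k ^+ 2)) <= L * expR (- (2 * (r * s) * a)).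
  move=> rr; set k := (r * - c +i* (r * s))%C; lazy zeta.
  have r1 : 0 < r by rewrite (lt_le_trans _ rr)// ltr_wpDl.
  have := HM r rr; set k1 := (r * c +i* (r * s))%C; lazy zeta.
  have -> : k ^+ 2 = ((k1 ^+ 2)^*)%C.
    by rewrite conj_sqr; congr (_ ^+ 2); apply: complex_eqP; rewrite ?cReN ?cImN ?cReJ ?cImJ /=; ring.
  have imz : Im (k1 ^+ 2) != 0.
    rewrite expr2 cImM /k1 /= (_ : _ + _ = (r * c) * (r * s) *+ 2); last by ring.
    by rewrite mulrn_eq0 /= !mulf_neq0// gt_eqF.
  have [J1 _] := weyl_data pQ1 sa1 wt1 imz; have [J2 _] := weyl_data pQ2 sa2 wt2 imz.
  by rewrite -J1 -J2 -adjB mxN_adj.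
have cn0 : c != 0 by rewrite gt_eqF.
have cn0' : - c != 0 by rewrite oppr_eq0.
have [K1 [q1 HW1]] := W_ray pQ1 pQ2 sa1 sa2 wt1 wt2 Hth1 Hph1 Hth2 Hph2 cn0 s0 a0 HM.
have [K2 [q2 HW2]] := W_ray pQ1 pQ2 sa1 sa2 wt1 wt2 Hth1 Hph1 Hth2 Hph2 cn0' s0 a0 HM'.
have [A [q3 [A0 _ HW3]]] := W_growth hQ1 hQ2 Hth1 Hph1 Hth2 Hph2 a0.
apply/matrixP => i j; rewrite [RHS]mxE.
pose f (k : C) := W th1 ph1 th2 ph2 (k ^+ 2) x i j.
have ef : expands f.
  apply: (@expands_comp R (fun z => W th1 ph1 th2 ph2 z x i j) (fun k => k ^+ 2)).
    exact: (expands_W hQ1 hQ2 Hth1 Hph1 Hth2 Hph2).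
  exact: expands_sqr.
have sqf (k : C) (y : R) : N1 k * mxN (W th1 ph1 th2 ph2 (k ^+ 2) x) <= y -> sq (k * f k) <= y ^+ 2.
  move=> h; apply: (le_trans (sq_le_N1 _)).
  have h2 : N1 (k * f k) <= y.
    by rewrite (le_trans _ h)// (le_trans (N1M _ _))// ler_wpM2l ?N1_ge0// N1_le_mxN.
  by rewrite lerXn2r// nnegrE ?N1_ge0// (le_trans (N1_ge0 _) h2).
pose M := A ^+ 2 + K1 ^+ 2 + K2 ^+ 2.
pose q := Num.max q3 (Num.max q1 q2).
have sA := sqr_ge0 A; have sK1 := sqr_ge0 K1; have sK2 := sqr_ge0 K2.
have MA : A ^+ 2 <= M by rewrite /M -addrA lerDl addr_ge0.
have MK1 : K1 ^+ 2 <= M by rewrite /M addrAC lerDr addr_ge0.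
have MK2 : K2 ^+ 2 <= M by rewrite /M lerDr addr_ge0.
have f0 : f 0 = 0; last by move: f0; rewrite /f expr0n /=.
(* The rate 4 a is twice that of [W_growth], since squared moduli are compared. *)
apply: (@even_entire_eq0 R f c s (A ^+ 2) (4 * a) M q ef _ c0 cs cs1 sA).
- by move=> k; rewrite /f sqrrN.
- by rewrite mulr_ge0// ltW.
- move=> k; rewrite !ge_max => /andP[qk _].
  have := sqf _ _ (HW3 k x qk xa); rewrite exprMn => h; apply: (le_trans h).
  rewrite ler_wpM2l// expr2 -expRD ler_expR.
  rewrite (_ : 4 * a * N1 k = 2 * a * N1 k + 2 * a * N1 k); last by ring.
  by rewrite lerD// ler_wpM2l ?Im_le_N1// mulr_ge0// ltW.
- move=> r; rewrite !ge_max => /andP[qr _].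
  have qr' : q3 <= N1 r%:C%C by rewrite N1_real (le_trans qr)// ler_norm.
  have := sqf _ _ (HW3 _ x qr' xa); rewrite /= normr0 mulr0 expR0 mulr1 => h.
  exact: le_trans h MA.
- move=> r; rewrite !ge_max => /andP[_ /andP[qr _]].
  exact: le_trans (sqf _ _ (HW1 r x qr xa)) MK1.
- move=> r; rewrite !ge_max => /andP[_ /andP[_ qr]].
  exact: le_trans (sqf _ _ (HW2 r x qr xa)) MK2.
Qed.

End uniqueness.

(** * From W = 0 to the equality of the potentials *)

Section recovery_of_potential.
Variables (R : realType) (m : nat).
Local Notation C := R[i].
Local Notation mu := (@lebesgue_measure R).

Lemma ae_forall_ord p (P : 'I_p -> R -> Prop) : (forall i, {ae mu, forall x, P i x}) ->
  {ae mu, forall x, forall i, P i x}.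
Proof.
move=> H.
have : {ae mu, forall x, forall n (i : 'I_p), i = n :> nat -> P i x}.
  apply/ae_foralln => n; have [np|pn] := ltnP n p.
    apply: ae_imply (H (Ordinal np)) => x Px i ni.
    by rewrite (_ : i = Ordinal np)//; exact: val_inj.
  by apply: ae_all => x i ni; move: (ltn_ord i); rewrite ni ltnNge pn.
by apply: ae_imply => x Px i; exact: Px.
Qed.

Lemma prim_eq0_deriv p q (F G : R -> 'M[C]_(p, q)) (a : R) : prim F G ->
  (forall x, 0 <= x <= a -> F x = 0) -> {ae mu, forall x : R, 0 < x < a -> G x = 0}.
Proof.
move=> pF F0.
have key (f g : R -> R) : rprim f g -> (forall x, 0 <= x <= a -> f x = 0) ->
    {ae mu, forall x : R, 0 < x < a -> g x = 0}.
  move=> [_ df] f0; apply: ae_imply df => x H /andP[x0 xa].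
  have d0 : is_derive x 1 f 0.
    apply: (@near_eq_is_derive _ _ _ (cst (0 : R))).
    have n1 := gt_nbhs x0; have n2 := lt_nbhsl xa.
    by apply: filterS2 n1 n2 => t t0 ta; rewrite f0// (ltW t0) ltW.
  by have [_ <-] := H x0; have [_ <-] := d0.
have : {ae mu, forall x : R, forall i j, 0 < x < a -> G x i j = 0}.
  apply: ae_forall_ord => i; apply: ae_forall_ord => j; have [p1 p2] := pF i j.
  have h1 := key _ _ p1; have h2 := key _ _ p2.
  apply: ae_imply2 (h1 _) (h2 _) => [x H1 H2 xa|x xa|x xa].
  - by apply: complex_eqP; [exact: H1|exact: H2].
  - by rewrite F0// mxE.
  - by rewrite F0// mxE.
by apply: ae_imply => x H xa; apply/matrixP => i j; rewrite H// mxE.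
Qed.

(* The derivative of |F|^2 vanishes wherever F does. *)
Lemma prim_ae_eq0 p q (F G : R -> 'M[C]_(p, q)) (a : R) : prim F G -> F 0 = 0 ->
  {ae mu, forall x : R, 0 < x < a -> F x = 0} -> forall x, 0 <= x <= a -> F x = 0.
Proof.
move=> pF F0 Fae x /andP[x0 xa]; apply: mxN_eq0.
have := rprim_le (rprimN (rprim_mxsq pF)) (lexx 0) x0; rewrite lerN2 F0 => H.
have {}H : mxsq (F x) <= mxsq (0 : 'M[C]_(p, q)).
  apply: H; apply: ae_imply Fae => t Ht /andP[t0 tx].
  rewrite Ht; last by rewrite t0 (lt_le_trans tx).
  rewrite oppr_ge0 big1// => i _; rewrite big1// => j _.
  by rewrite mxE /= !mul0r addr0 mulr0.
have z0 : mxsq (0 : 'M[C]_(p, q)) = 0.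
  by rewrite /mxsq big1// => i _; rewrite big1// => j _; rewrite mxE /sq /= expr0n addr0.
have := mxN_le_mxsq (F x); rewrite leNgt => /negP h; rewrite leNgt; apply/negP => N0; apply: h.
apply: (@le_lt_trans _ _ 0); last exact: exprn_gt0.
by rewrite mulr_ge0_le0// ?mulr_ge0 ?exprn_ge0// -z0.
Qed.

Lemma prim_cst_on p q (F G : R -> 'M[C]_(p, q)) (a : R) : prim F G ->
  {ae mu, forall x : R, 0 < x < a -> G x = 0} -> forall x, 0 <= x <= a -> F x = F 0.
Proof.
move=> pF G0 x /andP[x0 xa]; apply/eqP; rewrite -subr_eq0; apply/eqP; apply: mxN_eq0.
have := prim_norm_le pF (rprim_cst 0) (lexx 0) x0; rewrite subrr; apply.
apply: ae_imply G0 => t Ht /andP[t0 tx]; rewrite Ht ?mxN0//.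
by rewrite t0 (lt_le_trans tx).
Qed.

(* The four matrices [t11], [t12], [t21], [t22] are the blocks of the product of the fundamental
   matrix of the first equation with the adjoint inverse of that of the second one; [t12 = - W]
   and they satisfy a linear first-order system in which Q1 and Q2 are the only coefficients. *)
Lemma potentials_eq (Q1 Q2 : R -> 'M[C]_m) th1 thd1 ph1 phd1 th2 thd2 ph2 phd2 (a : R) :
  hermitian_ae Q2 ->
  init_sol Q1 1%:M 0 th1 thd1 -> init_sol Q1 0 1%:M ph1 phd1 ->
  init_sol Q2 1%:M 0 th2 thd2 -> init_sol Q2 0 1%:M ph2 phd2 ->
  (forall x, 0 <= x <= a -> W th1 ph1 th2 ph2 0 x = 0) ->
  {ae mu, forall x : R, 0 < x < a -> Q1 x = Q2 x}.
Proof.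
move=> hQ2 /(_ 0)[[pA pA'] A0 A'0] /(_ 0)[[pB pB'] B0 B'0]
  /(_ 0)[[pP pP'] P0 P'0] /(_ 0)[[pS pS'] S0 S'0] W0.
move: A'0 B'0 P'0 S'0 A0 B0 P0 S0 W0; rewrite /W rmorph0.
move: (th1 0) (thd1 0) (ph1 0) (phd1 0) (th2 0) (thd2 0) (ph2 0) (phd2 0)
  pA pA' pB pB' pP pP' pS pS' => A A' B B' P P' S S' pA pA' pB pB' pP pP' pS pS'.
move=> A'0 B'0 P'0 S'0 A0 B0 P0 S0 W0.
pose t11 x := A x *m adj (S' x) - B x *m adj (P' x).
pose t12 x := B x *m adj (P x) - A x *m adj (S x).
pose t21 x := A' x *m adj (S' x) - B' x *m adj (P' x).
pose t22 x := B' x *m adj (P x) - A' x *m adj (S x).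
have p12 : prim t12 (fun x => t22 x - t11 x).
  apply: prim_eq (primB (primM pB (prim_adj pP)) (primM pA (prim_adj pS))) => x _.
  by apply/matrixP => i j; rewrite /t22 /t11 !mxE; ring.
have p11 : prim t11 (fun x => t21 x - t12 x *m Q2 x).
  apply: prim_ae (primB (primM pA (prim_adj pS')) (primM pB (prim_adj pP'))).
  apply: ae_imply hQ2 => x H /ltW/H {}H.
  rewrite !scale0r !subr0 !adjM -H /t21 /t12 mulmxBl !mulmxA.
  by apply/matrixP => i j; rewrite !mxE; ring.
have p22 : prim t22 (fun x => Q1 x *m t12 x - t21 x).
  apply: prim_eq (primB (primM pB' (prim_adj pP)) (primM pA' (prim_adj pS))) => x _.
  rewrite !scale0r !subr0 /t21 /t12 mulmxBr !mulmxA.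
  by apply/matrixP => i j; rewrite !mxE; ring.
have p21 : prim t21 (fun x => Q1 x *m t11 x - t22 x *m Q2 x).
  apply: prim_ae (primB (primM pA' (prim_adj pS')) (primM pB' (prim_adj pP'))).
  apply: ae_imply hQ2 => x H /ltW/H {}H.
  rewrite !scale0r !subr0 !adjM -H /t11 /t22 mulmxBl mulmxBr !mulmxA.
  by apply/matrixP => i j; rewrite !mxE; ring.
have t12_0 x : 0 <= x <= a -> t12 x = 0.
  by move=> xa; rewrite /t12 -opprB W0// oppr0.
have e11 : t11 0 = 1%:M by rewrite /t11 A0 B0 S'0 adj1 mul1mx mul0mx subr0.
have e22 : t22 0 = 1%:M by rewrite /t22 P0 A'0 B'0 adj1 mul1mx mul0mx subr0.
have e21 : t21 0 = 0 by rewrite /t21 A'0 P'0 mul0mx adj0 mulmx0 subrr.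
pose D x := t22 x - t11 x.
(* t12 = 0 kills its derivative t22 - t11, at first only a.e. *)
have D0 : forall x, 0 <= x <= a -> D x = 0.
  apply: (prim_ae_eq0 (primB p22 p11)); first by rewrite e11 e22 subrr.
  exact: prim_eq0_deriv p12 t12_0.
(* With t12 = 0 the derivative of t22 - t11 is - 2 t21. *)
have t21_0 : forall x, 0 <= x <= a -> t21 x = 0.
  apply: (prim_ae_eq0 p21 e21).
  have := prim_eq0_deriv (primB p22 p11) D0.
  apply: ae_imply => x H /[dup] /H {}H /andP[x0 xa].
  move: H; rewrite t12_0 ?(ltW x0) ?(ltW xa)// mulmx0 mul0mx sub0r subr0 -opprD => /eqP.
  rewrite oppr_eq0 -mulr2n -scaler_nat scaler_eq0 pnatr_eq0 /= => /eqP.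
  exact.
have t11_1 x : 0 <= x <= a -> t11 x = 1%:M.
  move=> xa; rewrite -e11; apply: (prim_cst_on p11 _ xa).
  apply: ae_all => t /andP[t0 ta].
  by rewrite t21_0 ?t12_0 ?(ltW t0) ?(ltW ta)// mul0mx subr0.
(* Once t11 = t22 = 1, the derivative of t21 = 0 reads Q1 - Q2. *)
have := prim_eq0_deriv p21 t21_0; apply: ae_imply => x H /[dup] /H {}H /andP[x0 xa].
have xI : 0 <= x <= a by rewrite !ltW.
have t22_1 : t22 x = 1%:M by apply/eqP; rewrite -subr_eq0 -(t11_1 x xI); apply/eqP; exact: D0.
by move: H; rewrite t22_1 t11_1// mulmx1 mul1mx => /eqP; rewrite subr_eq0 => /eqP.
Qed.

Lemma ae_neq (a : R) : {ae mu, forall x : R, x != a}.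
Proof.
exists [set a]; split; first exact: measurable_set1.
  exact: lebesgue_measure_set1.
by move=> x /= /negP; rewrite negbK => /eqP.
Qed.

End recovery_of_potential.

Theorem theorem3p1 (R : realType) (m : nat) (hm : (0 < m)%N)
    (Q1 Q2 : R -> 'M[R[i]]_m)
    (B1 B2 : (R -> 'cV[R[i]]_m) -> Prop)
    (M1 M2 : R[i] -> 'M[R[i]]_m)
    (hQ1 : potential Q1) (hQ2 : potential Q2)
    (hB1 : sa_bc_at_infinity Q1 B1) (hB2 : sa_bc_at_infinity Q2 B2)
    (hM1 : weyl_titchmarsh Q1 B1 M1) (hM2 : weyl_titchmarsh Q2 B2 M2)
    (eps : R) (heps : 0 < eps < pi / 2) :
  (forall a : R, 0 < a ->
     ray_asymp M1 M2 (pi - eps) a ->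
     {ae @lebesgue_measure R, forall x, 0 <= x <= a -> Q1 x = Q2 x}) /\
  ((forall a : R, 0 < a -> ray_asymp M1 M2 (pi - eps) a) ->
     {ae @lebesgue_measure R, forall x, 0 <= x -> Q1 x = Q2 x}).
Proof.
have local (a : R) : 0 < a -> ray_asymp M1 M2 (pi - eps) a ->
    {ae @lebesgue_measure R, forall x, 0 <= x <= a -> Q1 x = Q2 x}.
  move=> a0 asym.
  have [th1 [thd1 H1]] := init_sol_exists 1%:M 0 hQ1.1.
  have [ph1 [phd1 H2]] := init_sol_exists 0 1%:M hQ1.1.
  have [th2 [thd2 H3]] := init_sol_exists 1%:M 0 hQ2.1.
  have [ph2 [phd2 H4]] := init_sol_exists 0 1%:M hQ2.1.
  have W0 := W_eq0 hQ1 hQ2 hB1 hB2 hM1 hM2 H1 H2 H3 H4 heps a0 asym.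
  have h := potentials_eq hQ2.2 H1 H2 H3 H4 W0.
  (* The two endpoints, excluded so far, form a null set. *)
  apply: ae_imply2 h (ae_imply2 (fun x => @conj _ _) (ae_neq 0) (ae_neq a)).
  move=> x H [x0 xa] /andP[h0 ha]; apply: H.
  by rewrite !lt_neqAle h0 ha xa eq_sym x0.
split=> // H.
(* Exhaustion by the intervals [0, n + 1]: countably many null sets are discarded. *)
have : {ae @lebesgue_measure R, forall x, forall n : nat, 0 <= x <= n.+1%:R -> Q1 x = Q2 x}.
  by apply/ae_foralln => n; apply: local => //; exact: H.
apply: ae_imply => x Hx x0; apply: (Hx (Num.truncn x)).
by rewrite x0 ltW// truncnS_gt.
Qed.
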